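(* With the notation and assumptions of the context, let $n\in\mathbb{Z}_{>0}$, $i\in\{1,\ldots,g\}$, $\pi\in T_{n,i}$, and $h(T):=h(T^{\mu_i};\pi)$. Then $[h(T)]\in\Gamma_A[p^n]_{\mu_i}$. Consequently, there is an injective map $$T_{n,i}\to\Gamma_A[p^n]_{\mu_i},\qquad\pi\mapsto[h(T^{\mu_i};\pi)].$$
   Context: $p$ is a prime, $K$ a finite extension of $\mathbb{Q}_p$, $|\cdot|$ its absolute value with $|p|=1/p$, $O_K=\{|a|\le1\}$, $\mathcal{M}_K=\{|a|<1\}$. $K((\frac1T))$ is the field of series $\sum_{i\le n}v_iT^i$; the degree is the largest exponent with nonzero coefficient. $A\subset K((\frac1T))$ is a $K$-subalgebra with $A\cap K[[\frac1T]]=K$ and $g:=\dim_KK((\frac1T))/(A+K[[\frac1T]])<\infty$. Put $\underline{M}(A)=\{\deg v : 0\ne v\in A\}=\{s_1<s_2<\cdots\}\subset\mathbb{Z}_{\ge0}$ and $\mathbb{Z}_{\ge0}\setminus\underline{M}(A)=\{\mu_1<\cdots<\mu_g\}$. The standard basis of $A$ is the unique basis $v_i=\sum_jv_{ij}T^j$ with $v_i$ monic of degree $s_i$ and $v_{i,s_j}=0$ for $i>j\ge1$; $A$ is assumed strictly integral, i.e. all $v_{ij}\in O_K$. $d$ is an integer with $p\equiv1\bmod d$ and $d\ge\mu_g$, $\zeta_d\in\mathbb{Z}_p$ is a primitive $d$-th root of unity, and the automorphism $\delta:\sum a_nT^n\mapsto\sum a_n(\zeta_dT)^n$ of $K((\frac1T))$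 is assumed to restrict to an automorphism of $A$. Let $O(A)$ be the set of elements of $A$ with coefficients in $O_K$; one has $O_K[[\frac1T]][T]=O(A)\oplus\frac1TO_K[[\frac1T]]\oplus\bigoplus_iO_KT^{\mu_i}$, and $\mathbf{e}^{(k)}=(e^{(k)}_{ij})\in M_g(O_K)$ is defined by $T^{\mu_jp^k}-\sum_ie^{(k)}_{ij}T^{\mu_i}\in O(A)\oplus\frac1TO_K[[\frac1T]]$; under the present assumptions it is diagonal. Put $l_i(X):=\sum_{k\ge0}\frac{e^{(k)}_{ii}}{p^k}X^{p^k}$ and $T_{n,i}:=\{\pi\in\mathcal{M}_K : l_i(\pi)=0,\ |\pi|\le|p|^{1/(p^n-p^{n-1})}\}$. $H:=\{\sum_{i\in\mathbb{Z}}a_iT^i : a_i\in K,\ \sup|a_i|<\infty,\ \lim_{i\to+\infty}|a_i|=0\}$, a field complete for $\|\sum a_iT^i\|=\sup|a_i|$; $A^{\mathrm{an}}$ is the closure of $A$ in $H$. For $0\le\rho<1$, $\Gamma_\rho:=\{h=\sum h_iT^i\in H^* : \|h\|=|h_0|=1,\ |h_i|\le\rho^i\ \forall i>0\}$, $\Gamma:=\bigcup_{0\le\rho<1}\Gamma_\rho$, $\Gamma_A:=\Gamma/\big(((A^{\mathrm{an}})^*\cap\Gamma)\Gamma_0\big)$; $[h]$ is the class of $h$. The map $\sum a_nT^n\mapsto\sum a_n(\zeta_dT)^n$ on $H$ induces an automorphism $\delta$ of $\Gamma_A$. $\Gamma_A[p^n]$ is the subgroup of elements killed by $p^n$ (a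 $\mathbb{Z}_p$-module), and $\Gamma_A[p^n]_\mu$ is the set of $\alpha\in\Gamma_A[p^n]$ with $\delta\alpha=\zeta_d^\mu\alpha$ (module notation; multiplicatively $\delta(\alpha)=\alpha^{\zeta_d^\mu}$). With $l(T):=\sum_{k\ge0}p^{-k}T^{p^k}$, $h(T;\pi):=\exp(l(\pi T))$, so $h(T^{\mu_i};\pi)=\exp(l(\pi T^{\mu_i}))$. *)

(* Defs.v *)
From HB Require Import structures.
From mathcomp Require Import all_boot all_order all_algebra.
From mathcomp Require Import fieldext.
From mathcomp Require Import all_classical all_reals all_analysis.

Set Implicit Arguments.
Unset Strict Implicit.
Unset Printing Implicit Defensive.

Import Order.TTheory GRing.Theory Num.Theory.
Local Open Scope classical_set_scope.
Local Open Scope ring_scope.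

Section AbsoluteValue.
Context {R : realType} {F : fieldType}.
Variable abs : F -> R.

Record nonarch_abs : Prop := NonarchAbs {
  nonarch_abs_ge0 : forall x, 0 <= abs x;
  nonarch_abs_eq0 : forall x, abs x = 0 <-> x = 0;
  nonarch_absM : forall x y, abs (x * y) = abs x * abs y;
  nonarch_absD : forall x y, abs (x + y) <= Num.max (abs x) (abs y) }.

Definition cvg_abs (u : nat -> F) (l : F) : Prop :=
  forall eps : R, 0 < eps ->
    exists N, forall n, (N <= n)%N -> abs (u n - l) < eps.

Definition complete_abs : Prop :=
  forall u : nat -> F,
    (forall eps : R, 0 < eps ->
      exists N, forall m n, (N <= m)%N -> (N <= n)%N -> abs (u m - u n) < eps) ->
    exists l, cvg_abs u l.

(* 0 if u does not converge *)
Definition lim_abs (u : nat -> F) : F := xget 0 [set l | cvg_abs u l].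

Definition sum_nat (c : nat -> F) : F := lim_abs (fun n => \sum_(k < n) c k).

(* Negz k is -(k+1), so the n-th partial sum runs over [-n, n-1]. *)
Definition sum_int (c : int -> F) : F :=
  lim_abs (fun n => \sum_(k < n) c (Posz k) + \sum_(k < n) c (Negz k)).

(* (F, abs) is the field of p-adic numbers: the completion of the rationals for
   the p-adic absolute value.  A nonarchimedean absolute value with |p| = 1/p
   restricts to the p-adic one on the rationals (and forces characteristic
   0). *)
Record is_padic_field (p : nat) : Prop := IsPadicField {
  padic_abs : nonarch_abs;
  padic_absp : abs p%:R = p%:R^-1;
  padic_dense : forall x (eps : R), 0 < eps ->
    exists q : rat, abs (x - ratr q) < eps;
  padic_complete : complete_abs }.

(* A natural number congruent modulo p^n to the p-adic integer z. *)
Definition residue (p n : nat) (z : F) : nat :=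
  xget 0%N [set m : nat | abs (z - m%:R) <= p%:R ^- n].

End AbsoluteValue.

(* A doubly infinite series \sum_i a_i T^i is encoded by its coefficient
   function int -> K. *)
Section FormalSeries.
Context {K : fieldType}.

Definition laurent : set (int -> K) :=
  [set v | exists n : int, forall i, n < i -> v i = 0].

Definition invT_series : set (int -> K) :=
  [set v | forall i : int, 0 < i -> v i = 0].

Definition mono (n : nat) : int -> K := fun i => (i == n%:Z)%:R.

Definition cmul (c : K) (v : int -> K) : int -> K := fun i => c * v i.

Definition lcomb (n : nat) (c : 'I_n -> K) (v : 'I_n -> int -> K) : int -> K :=
  \sum_(i < n) cmul (c i) (v i).

Definition has_degree (v : int -> K) (n : int) : Prop :=
  v n != 0 /\ forall i, n < i -> v i = 0.

Definition degrees (A : set (int -> K)) : set nat :=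
  [set n | exists2 v, A v & has_degree v n%:Z].

(* \sum_i a_i T^i |-> \sum_i a_i (z T)^i *)
Definition dil (z : K) (v : int -> K) : int -> K := fun i => z ^ i * v i.

(* dim_K K((1/T)) / (A + K[[1/T]]) = g: there are g Laurent series whose classes
   form a basis of the quotient. *)
Definition codim_is (A : set (int -> K)) (g : nat) : Prop :=
  exists b : 'I_g -> int -> K, (forall j, laurent (b j)) /\
    forall v, laurent v -> exists! c : 'rV[K]_g,
      exists2 a, A a & invT_series (v - lcomb (c 0) b - a).

Definition gap_sequence (A : set (int -> K)) (g : nat) (mu : 'I_g -> nat) :
    Prop :=
  (forall i j : 'I_g, (i < j)%N -> (mu i < mu j)%N) /\ range mu = ~` degrees A.

(* 0-based indexing: s 0 = 0 and v 0 = 1. *)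
Record standard_basis (A : set (int -> K)) (s : nat -> nat)
    (v : nat -> int -> K) : Prop := StandardBasis {
  stdb_incr : forall i j, (i < j)%N -> (s i < s j)%N;
  stdb_range : range s = degrees A;
  stdb_free : forall n (c : 'I_n -> K),
    lcomb c (fun i => v i) = 0 -> forall i, c i = 0;
  stdb_span : A = [set f | exists n (c : 'I_n -> K), f = lcomb c (fun i => v i)];
  stdb_deg : forall i, has_degree (v i) (s i)%:Z;
  stdb_monic : forall i, v i (s i)%:Z = 1;
  stdb_reduced : forall i j, (j < i)%N -> v i (s j)%:Z = 0 }.

(* Power series in T, given by their coefficients nat -> K. *)

(* exp(f) for f with f 0 = 0: the coefficient of T^m in \sum_n f^n / n! only
   involves n <= m and the coefficients f j with j <= m. *)
Definition fps_exp (f : nat -> K) (m : nat) : K :=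
  (\sum_(n < m.+1) n`!%:R^-1 *: (\poly_(j < m.+1) f j) ^+ n)`_m.

(* coefficients of l(T) = \sum_k p^-k T^(p^k); k < p^k, so k <= m suffices *)
Definition l_coef (p m : nat) : K :=
  \sum_(k < m.+1 | m == (p ^ k)%N) p%:R ^- k.

(* h(T; pi) = exp(l(pi T)) *)
Definition h_coef (p : nat) (pi : K) : nat -> K :=
  fps_exp (fun m => l_coef p m * pi ^+ m).

(* f(T^mu), for mu > 0, as a series indexed by int *)
Definition subst_pow (mu : nat) (f : nat -> K) : int -> K :=
  fun i => if i is Posz m then (if (mu %| m)%N then f (m %/ mu)%N else 0) else 0.

Definition h_series (p mu : nat) (pi : K) : int -> K :=
  subst_pow mu (h_coef p pi).

End FormalSeries.

Section Gamma.
Context {R : realType} {K : fieldType}.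
Variable abs : K -> R.

Definition integral_series : set (int -> K) :=
  [set v | forall i, abs (v i) <= 1].

(* Product of series.  For Laurent series in 1/T the sum has finitely many
   nonzero terms; for elements of H it converges in K. *)
Definition hmul (a b : int -> K) : int -> K :=
  fun n => sum_int abs (fun i => a i * b (n - i)).

Record subalgebra (A : set (int -> K)) : Prop := Subalgebra {
  subalg_laurent : A `<=` laurent;
  subalg1 : A (mono 0);
  subalgD : forall v w, A v -> A w -> A (v + w);
  subalgZ : forall c v, A v -> A (cmul c v);
  subalgM : forall v w, A v -> A w -> A (hmul v w) }.

Definition strictly_integral (A : set (int -> K)) : Prop :=
  exists s v, standard_basis A s v /\ forall i, integral_series (v i).

(* O(A) + (1/T) O_K[[1/T]] *)
Definition OA_plus_neg (A : set (int -> K)) : set (int -> K) :=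
  [set f | exists a b, [/\ A a /\ integral_series a,
     integral_series b /\ (forall i : int, 0 <= i -> b i = 0) & f = a + b]].

Definition is_e_matrix (p : nat) (A : set (int -> K)) (g : nat)
    (mu : 'I_g -> nat) (k : nat) (E : 'M[K]_g) : Prop :=
  (forall i j, abs (E i j) <= 1) /\
  forall j, OA_plus_neg A
    (mono (mu j * p ^ k) - lcomb (fun i => E i j) (fun i => mono (mu i))).

Definition l_fun (p : nat) (g : nat) (e : nat -> 'M[K]_g) (i : 'I_g) (X : K) : K :=
  sum_nat abs (fun k => e k i i / p%:R ^+ k * X ^+ (p ^ k)).

Definition T_set (p : nat) (g : nat) (e : nat -> 'M[K]_g) (n : nat) (i : 'I_g) :
    set K :=
  [set pi | [/\ abs pi < 1, l_fun p e i pi = 0 &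
     abs pi <= abs p%:R `^ ((p ^ n - p ^ n.-1)%N%:R^-1)]].

Definition H : set (int -> K) :=
  [set a | (exists M : R, forall i, abs (a i) <= M) /\
           cvg_abs abs (fun m => a (Posz m)) 0].

Definition hnorm (a : int -> K) : R := sup (range (fun i => abs (a i))).

Definition units (B : set (int -> K)) : set (int -> K) :=
  [set a | B a /\ exists2 b, B b & hmul a b = mono 0].

Definition A_an (A : set (int -> K)) : set (int -> K) :=
  [set f | H f /\ forall eps : R, 0 < eps ->
     exists a, [/\ A a, H a & hnorm (f - a) < eps]].

Definition Gamma_rho (rho : R) : set (int -> K) :=
  [set h | [/\ units H h, hnorm h = 1, abs (h 0) = 1 &
     forall i : nat, (0 < i)%N -> abs (h (Posz i)) <= rho ^+ i]].

Definition Gamma : set (int -> K) :=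
  \bigcup_(rho in [set rho : R | 0 <= rho < 1]) Gamma_rho rho.

Definition set_hmul (X Y : set (int -> K)) : set (int -> K) :=
  [set hmul x y | x in X & y in Y].

(* The subgroup ((A^an)^* :&: Gamma) Gamma_0. *)
Definition Gamma_trivial (A : set (int -> K)) : set (int -> K) :=
  set_hmul (units (A_an A) `&` Gamma) (Gamma_rho 0).

(* Gamma_A is the group of cosets of Gamma_trivial A in Gamma: its product is the
   product of sets, its identity is Gamma_trivial A, and an automorphism of H
   preserving Gamma and Gamma_trivial A acts on it by direct image. *)
Definition gclass (A : set (int -> K)) (h : int -> K) : set (int -> K) :=
  [set hmul h x | x in Gamma_trivial A].

Definition Gamma_A (A : set (int -> K)) : set (set (int -> K)) :=
  gclass A @` Gamma.

Definition gpow (A : set (int -> K)) (alpha : set (int -> K)) (m : nat) :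
    set (int -> K) :=
  iter m (set_hmul alpha) (Gamma_trivial A).

Definition Gamma_A_torsion (A : set (int -> K)) (m : nat) :
    set (set (int -> K)) :=
  [set alpha | Gamma_A A alpha /\ gpow A alpha m = Gamma_trivial A].

End Gamma.

Section Eigenspace.
Context {R : realType} {Qp : fieldType} {K : fieldExtType Qp}.
Variables (absQ : Qp -> R) (abs : K -> R).

(* Gamma_A[p^n]_m: the p-adic integer zeta^m acts on a class killed by p^n as
   any natural number congruent to it modulo p^n. *)
Definition Gamma_A_eigen (p : nat) (A : set (int -> K)) (zeta : Qp) (n m : nat) :
    set (set (int -> K)) :=
  [set alpha | Gamma_A_torsion abs A (p ^ n) alpha /\
     dil zeta%:A @` alpha = gpow abs A alpha (residue absQ p n (zeta ^+ m))].

End Eigenspace.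

(* Main.v *)
Require Import Defs.
From HB Require Import structures.
From mathcomp Require Import all_boot all_order all_algebra.
From mathcomp Require Import fieldext.
From mathcomp Require Import all_classical all_reals all_analysis.
From mathcomp Require Import zify ring lra.

Set Implicit Arguments.
Unset Strict Implicit.
Unset Printing Implicit Defensive.

Import Order.TTheory GRing.Theory Num.Theory.
Local Open Scope classical_set_scope.
Local Open Scope ring_scope.

(* Let l(T) = sum_k p^-k T^(p^k).  Since T^(mu_i p^k) = e_k T^mu_i + a_k + b_k with
   a_k in O(A), b_k of negative degree and e_k = e^(k)_ii (the matrices are diagonal
   because delta multiplies distinct T^mu_j by distinct roots of unity),
     y l(pi T^mu_i) = y l_i(pi) T^mu_i + a + b = a + b   for l_i(pi) = 0,
   and as soon as |y| <= |p|^n the bound on pi puts a and b in the domain of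
   convergence of exp.  So exp(y l(pi T^mu_i)) = exp(a) exp(b) has trivial class.
   For y = p^n this is the p^n-torsion of [h].  Since zeta^p = zeta, delta h is
   exp(zeta^mu_i l(pi T^mu_i)), which is h^m times such an exponential, with
   y = zeta^mu_i - m, whenever m = zeta^mu_i mod p^n.
   Integrality of h is that of the Artin-Hasse exponential (Dwork's lemma).
   For injectivity, if h(T; pi) / h(T; pi') = u v with u in the closure of A and
   v in Gamma_0, then u has a coefficient of absolute value |pi - pi'| at the gap
   mu_i and strictly smaller ones above, while in a strictly integral algebra the
   coefficient at a gap is bounded by the coefficients above it. *)

(** * Nonarchimedean absolute values *)

Section NonarchAbs.
Context {R : realType} {F : fieldType}.
Variables (abs : F -> R) (absP : nonarch_abs abs).

Lemma abs_ge0 x : 0 <= abs x.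
Proof. exact: nonarch_abs_ge0. Qed.

Lemma absM x y : abs (x * y) = abs x * abs y.
Proof. exact: nonarch_absM. Qed.

Lemma abs0 : abs 0 = 0.
Proof. exact/nonarch_abs_eq0. Qed.

Lemma abs_gt0 x : (0 < abs x) = (x != 0).
Proof.
rewrite lt0r abs_ge0 andbT; congr negb; apply/eqP/eqP => [/nonarch_abs_eq0|->].
  exact.
exact: abs0.
Qed.

Lemma abs1 : abs 1 = 1.
Proof.
have /mulfI : abs 1 != 0 by rewrite gt_eqF // abs_gt0 oner_neq0.
by apply; rewrite -absM !mulr1.
Qed.

Lemma absX x n : abs (x ^+ n) = abs x ^+ n.
Proof. by elim: n => [|n IHn]; rewrite ?abs1 // !exprS absM IHn. Qed.

Lemma absN x : abs (- x) = abs x.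
Proof.
have : abs (-1) ^+ 2 == 1 by rewrite -absX sqrrN expr1n abs1.
rewrite sqrf_eq1 => /orP[] /eqP e1.
  by rewrite -mulN1r absM e1 mul1r.
by have := abs_ge0 (-1); rewrite e1 ler0N1.
Qed.

Lemma absV x : abs x^-1 = (abs x)^-1.
Proof.
have [->|x0] := eqVneq x 0; first by rewrite invr0 abs0 invr0.
have ax : abs x != 0 by rewrite gt_eqF // abs_gt0.
by apply: (mulfI ax); rewrite -absM !divff // abs1.
Qed.

Lemma absB_sym x y : abs (x - y) = abs (y - x).
Proof. by rewrite -absN opprB. Qed.

Lemma absD_le B x y : abs x <= B -> abs y <= B -> abs (x + y) <= B.
Proof.
by move=> xB yB; apply: le_trans (nonarch_absD absP x y) _; rewrite ge_max xB.
Qed.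

Lemma absD_lt B x y : abs x < B -> abs y < B -> abs (x + y) < B.
Proof.
by move=> xB yB; apply: le_lt_trans (nonarch_absD absP x y) _; rewrite gt_max xB.
Qed.

Lemma absB_le B x y : abs x <= B -> abs y <= B -> abs (x - y) <= B.
Proof. by move=> xB yB; apply: absD_le; rewrite ?absN. Qed.

Lemma absB_trans B y x z : abs (x - y) <= B -> abs (y - z) <= B -> abs (x - z) <= B.
Proof. by move=> xB yB; rewrite -(subrKA y x); apply: absD_le. Qed.

Lemma abs_lead x y : abs y < abs x -> abs (x + y) = abs x.
Proof.
move=> yx; apply/eqP; rewrite eq_le absD_le ?(ltW yx) //= leNgt.
apply/negP => xy; have := ltxx (abs x); rewrite -{1}(addrK y x) absD_lt ?absN //.
Qed.

Lemma abs_sum_le (I : Type) (r : seq I) (P : pred I) (u : I -> F) B :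
  0 <= B -> (forall i, P i -> abs (u i) <= B) ->
  abs (\sum_(i <- r | P i) u i) <= B.
Proof.
move=> B0 uB; elim/big_ind: _ => //; first by rewrite abs0.
by move=> x y; apply: absD_le.
Qed.

Lemma abs_nat m : abs m%:R <= 1.
Proof.
elim: m => [|m IHm]; first by rewrite abs0 ler01.
by rewrite -addn1 natrD absD_le // abs1.
Qed.

Lemma abs_le_eps x B : (forall eps, 0 < eps -> abs x <= B + eps) -> abs x <= B.
Proof. by move=> xB; apply/ler_addgt0Pr. Qed.

Lemma abs_eps_eq0 x : (forall eps, 0 < eps -> abs x <= eps) -> x = 0.
Proof.
move=> xe; apply/(nonarch_abs_eq0 absP)/eqP.
rewrite eq_le abs_ge0 andbT; apply: abs_le_eps => e e0; rewrite add0r; exact: xe.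
Qed.

Lemma cvg_absP u l : cvg_abs abs u l <->
  forall eps, 0 < eps -> exists N, forall n, (N <= n)%N -> abs (u n - l) <= eps.
Proof.
split=> ul eps eps0.
  have [N uN] := ul _ eps0; exists N => n /uN /ltW //.
have [|N uN] := ul (eps / 2); first by rewrite divr_gt0.
exists N => n /uN /le_lt_trans; apply; lra.
Qed.

Lemma cvg_abs_unique u l l' : cvg_abs abs u l -> cvg_abs abs u l' -> l = l'.
Proof.
move=> /cvg_absP ul /cvg_absP ul'; apply/eqP; rewrite -subr_eq0; apply/eqP.
apply: abs_eps_eq0 => e e0; have [N uN] := ul _ e0; have [N' uN'] := ul' _ e0.
apply: (@absB_trans _ (u (maxn N N'))); last exact/uN'/leq_maxr.
by rewrite absB_sym; exact/uN/leq_maxl.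
Qed.

Lemma lim_absE u l : cvg_abs abs u l -> lim_abs abs u = l.
Proof.
move=> ul; apply: (cvg_abs_unique _ ul).
by rewrite /lim_abs; case: xgetP => [x _ //|/(_ l)].
Qed.

Lemma cvg_abs_le u l y B N : cvg_abs abs u l ->
  (forall n, (N <= n)%N -> abs (u n - y) <= B) -> abs (l - y) <= B.
Proof.
move=> /cvg_absP ul uB; apply: abs_le_eps => e e0; have [N' uN'] := ul _ e0.
pose n := maxn N N'; have B0 : 0 <= B := le_trans (abs_ge0 _) (uB N (leqnn N)).
apply: (@absB_trans _ (u n)).
  rewrite absB_sym; apply: le_trans (uN' n _) _; rewrite ?leq_maxr //; lra.
apply: le_trans (uB n _) _; rewrite ?leq_maxl //; lra.
Qed.

Lemma cvg_absD u v l m : cvg_abs abs u l -> cvg_abs abs v m ->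
  cvg_abs abs (fun n => u n + v n) (l + m).
Proof.
move=> ul vm e e0; have [N uN] := ul _ e0; have [N' vN] := vm _ e0.
exists (maxn N N') => n; rewrite geq_max => /andP[/uN a /vN b].
by rewrite opprD addrACA absD_lt.
Qed.

Lemma cvg_absMl c u l : cvg_abs abs u l -> cvg_abs abs (fun n => c * u n) (c * l).
Proof.
move=> /cvg_absP ul; apply/cvg_absP => e e0.
have c1 : 0 < abs c + 1 by have := abs_ge0 c; lra.
have [|N uN] := ul (e / (abs c + 1)); first by rewrite divr_gt0.
exists N => n /uN; rewrite ler_pdivlMr // -mulrBr absM => h.
apply: le_trans h; rewrite mulrC; apply: ler_wpM2l; rewrite ?abs_ge0 //; lra.
Qed.

Lemma cvg_abs_cst (x : F) : cvg_abs abs (fun=> x) x.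
Proof. by move=> e e0; exists 0%N => n _; rewrite subrr abs0. Qed.

(* In a nonarchimedean field a sequence whose increments tend to 0 is Cauchy. *)
Lemma cvg_series (c : nat -> F) : complete_abs abs -> cvg_abs abs c 0 ->
  exists l, cvg_abs abs (fun n => \sum_(k < n) c k) l.
Proof.
move=> complete /cvg_absP c0; apply: complete => e e0.
have [|N cN] := c0 (e / 2); first by rewrite divr_gt0.
exists N => m n; wlog mn : m n / (m <= n)%N.
  by case: (leqP m n) => [|/ltnW] mn W Nm Nn; [|rewrite absB_sym]; apply: W.
move=> Nm _; apply: (@le_lt_trans _ _ (e / 2)); last by lra.
rewrite absB_sym -!(big_mkord xpredT) (@big_cat_nat _ _ _ m 0 n) //= addrAC subrr add0r.
rewrite big_nat; apply: abs_sum_le => [|i /andP[mi _]]; first by lra.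
by have := cN i (leq_trans Nm mi); rewrite subr0.
Qed.

End NonarchAbs.

(** * The ring H *)

Section IntegerSums.
Context {R : realType} {F : fieldType}.
Variables (abs : F -> R) (absP : nonarch_abs abs).

Definition window (N : nat) : seq int := map Posz (iota 0 N) ++ map Negz (iota 0 N).

Lemma mem_window N k : (k \in window N) = (- N%:Z <= k < N%:Z).
Proof.
rewrite mem_cat; have Pinj : injective Posz by move=> ? ? [].
have Ninj : injective Negz by move=> ? ? [].
case: k => k.
  rewrite mem_map // mem_iota /= add0n.
  suff -> : (Posz k \in [seq Negz i | i <- iota 0 N]) = false by rewrite orbF; lia.
  by apply/negP => /mapP[].
rewrite orbC mem_map // mem_iota /= add0n.
suff -> : (Negz k \in [seq Posz i | i <- iota 0 N]) = false by rewrite orbF; lia.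
by apply/negP => /mapP[].
Qed.

Lemma window_uniq N : uniq (window N).
Proof.
rewrite cat_uniq !map_inj_uniq ?iota_uniq ?andbT //=; try by move=> ? ? [].
by apply/hasPn => _ /mapP[k _ ->]; apply/negP => /mapP[].
Qed.

Lemma sum_window N (u : int -> F) :
  \sum_(k < N) u (Posz k) + \sum_(k < N) u (Negz k) = \sum_(k <- window N) u k.
Proof.
rewrite big_cat !big_map -(big_mkord xpredT (fun k => u (Posz k))).
by rewrite -(big_mkord xpredT (fun k => u (Negz k))) /index_iota subn0.
Qed.

Definition tends0 (u : int -> F) : Prop := forall eps, 0 < eps ->
  exists N, forall k, k \notin window N -> abs (u k) <= eps.

Definition has_sum (u : int -> F) (s : F) : Prop := forall eps, 0 < eps ->
  exists N, forall S : seq int, uniq S -> {subset window N <= S} ->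
    abs (s - \sum_(k <- S) u k) <= eps.

Lemma sum_superset N S (u : int -> F) eps : 0 <= eps ->
  uniq S -> {subset window N <= S} ->
  (forall k, k \notin window N -> abs (u k) <= eps) ->
  abs (\sum_(k <- window N) u k - \sum_(k <- S) u k) <= eps.
Proof.
move=> e0 Su NS uN.
have -> : \sum_(k <- S) u k
  = \sum_(k <- window N) u k + \sum_(k <- S | k \notin window N) u k.
  rewrite (bigID (mem (window N))) /= -[in LHS]big_filter; congr (_ + _).
  apply: perm_big; apply: uniq_perm; rewrite ?filter_uniq ?window_uniq // => k.
  by rewrite mem_filter andb_idr // => /NS.
by rewrite opprD addrA subrr add0r absN // abs_sum_le.
Qed.

Lemma window_sub N M : (N <= M)%N -> {subset window N <= window M}.
Proof. by move=> NM k; rewrite !mem_window; lia. Qed.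

Lemma tends0_has_sum u : complete_abs abs -> tends0 u -> has_sum u (sum_int abs u).
Proof.
move=> complete u0.
have [l ul] : exists l, cvg_abs abs (fun n => \sum_(k <- window n) u k) l.
  apply: complete => e e0; have [|N uN] := u0 (e / 2); first by rewrite divr_gt0.
  exists N => m n Nm Nn; apply: (@le_lt_trans _ _ (e / 2)); last by lra.
  apply: (absB_trans absP (y := \sum_(k <- window N) u k)).
    rewrite absB_sym //; apply: sum_superset; rewrite ?window_uniq //; first lra.
    exact: window_sub.
  apply: sum_superset; rewrite ?window_uniq //; first lra.
  exact: window_sub.
have sl : sum_int abs u = l.
  apply: (lim_absE absP); move=> e /ul[N ulN]; exists N => n /ulN.
  by rewrite sum_window.
rewrite sl => e e0; have [N uN] := u0 _ e0; exists N => S Su NS.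
apply: (absB_trans absP (y := \sum_(k <- window N) u k)); last first.
  by apply: sum_superset => //; apply: ltW.
apply: (cvg_abs_le absP (N := N) ul) => n Nn; rewrite absB_sym //.
by apply: sum_superset; rewrite ?window_uniq //; [apply: ltW|apply: window_sub].
Qed.

Lemma has_sum_unique u s t : has_sum u s -> has_sum u t -> s = t.
Proof.
move=> us ut; apply/eqP; rewrite -subr_eq0; apply/eqP; apply: (abs_eps_eq0 absP).
move=> e e0; have [N uN] := us _ e0; have [M uM] := ut _ e0.
apply: (absB_trans absP (y := \sum_(k <- window (maxn N M)) u k)).
  by apply: uN; [apply: window_uniq|apply: window_sub; rewrite leq_maxl].
rewrite absB_sym //.
by apply: uM; [apply: window_uniq|apply: window_sub; rewrite leq_maxr].
Qed.

Lemma has_sumE u s : has_sum u s -> sum_int abs u = s.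
Proof.
move=> us; apply: (lim_absE absP); apply/cvg_absP => e e0.
have [N uN] := us _ e0; exists N => n Nn; rewrite sum_window absB_sym //.
by apply: uN; [apply: window_uniq|apply: window_sub].
Qed.

Lemma has_sum_le u s B : (forall k, abs (u k) <= B) -> has_sum u s -> abs s <= B.
Proof.
move=> uB us; have B0 : 0 <= B := le_trans (abs_ge0 absP _) (uB 0).
apply: abs_le_eps => e e0; have [N uN] := us _ e0.
rewrite -[s](subrK (\sum_(k <- window N) u k)); apply: absD_le => //.
  apply: le_trans (uN _ (window_uniq N) _) _ => //; lra.
by apply: abs_sum_le => // [|k _]; [lra|apply: le_trans (uB k) _; lra].
Qed.

Lemma has_sumD u v s t : has_sum u s -> has_sum v t ->
  has_sum (fun k => u k + v k) (s + t).
Proof.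
move=> us vt e e0; have [N uN] := us _ e0; have [M vM] := vt _ e0.
exists (maxn N M) => S Su NS; rewrite big_split opprD addrACA; apply: absD_le => //.
  by apply: uN => // k /(window_sub (leq_maxl N M)) /NS.
by apply: vM => // k /(window_sub (leq_maxr N M)) /NS.
Qed.

Lemma has_sumZ c u s : has_sum u s -> has_sum (fun k => c * u k) (c * s).
Proof.
move=> us e e0; have c1 : 0 < abs c + 1 by have := abs_ge0 absP c; lra.
have [|N uN] := us (e / (abs c + 1)); first by rewrite divr_gt0.
exists N => S Su /(uN S Su); rewrite ler_pdivlMr // -mulr_sumr -mulrBr absM // => h.
apply: le_trans h; rewrite mulrC; apply: ler_wpM2l; rewrite ?abs_ge0 //; lra.
Qed.

Lemma window_cover (S : seq int) : exists N, {subset S <= window N}.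
Proof.
elim: S => [|k S [N SN]]; first by exists 0%N.
exists (maxn N (absz k).+1) => l; rewrite inE => /orP[/eqP ->|/SN].
  by rewrite mem_window; lia.
by rewrite !mem_window; lia.
Qed.

Lemma has_sum_reindex (f h : int -> int) u s : cancel f h -> cancel h f ->
  has_sum u s -> has_sum (u \o f) s.
Proof.
move=> fK hK us e e0; have [N uN] := us _ e0.
have [M hM] := window_cover (map h (window N)).
exists M => S Su MS.
rewrite -(big_map f xpredT u); apply: uN; first by rewrite map_inj_uniq //; exact: can_inj fK.
by move=> k kN; apply/mapP; exists (h k) => //; apply/MS/hM/map_f.
Qed.

Lemma has_sum_finite S u : uniq S -> (forall k, k \notin S -> u k = 0) ->
  has_sum u (\sum_(k <- S) u k).
Proof.
move=> Su uS e e0; have [N SN] := window_cover S; exists N => S' S'u NS'.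
suff -> : \sum_(k <- S') u k = \sum_(k <- S) u k by rewrite subrr abs0 // ltW.
rewrite (bigID (mem S)) /= [X in _ + X]big1 // addr0 -big_filter.
apply: perm_big; apply: uniq_perm; rewrite ?filter_uniq // => k.
by rewrite mem_filter andb_idr // => /SN /NS'.
Qed.

Lemma has_sum_double (u : int -> int -> F) (s : int -> F) x :
  (forall eps, 0 < eps -> exists N, forall j k,
     (j \notin window N) || (k \notin window N) -> abs (u j k) <= eps) ->
  (forall j, has_sum (u j) (s j)) -> has_sum s x ->
  forall eps, 0 < eps -> exists N, forall M, (N <= M)%N ->
    abs (x - \sum_(j <- window M) \sum_(k <- window M) u j k) <= eps.
Proof.
move=> u0 us sx e e0; have [N uN] := u0 _ e0; have [N' sN'] := sx _ e0.
exists (maxn N N') => M; rewrite geq_max => /andP[NM N'M].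
apply: (absB_trans absP (y := \sum_(j <- window M) s j)).
  by apply: sN'; [apply: window_uniq|apply: window_sub].
rewrite -sumrB; apply: abs_sum_le => // [|j _]; first exact: ltW.
have [N'' uN''] := us j _ e0; pose L := maxn M N''.
apply: (absB_trans absP (y := \sum_(k <- window L) u j k)).
  by apply: uN''; [apply: window_uniq|apply/window_sub/leq_maxr].
rewrite absB_sym //; apply: sum_superset; rewrite ?window_uniq //; first exact: ltW.
  exact/window_sub/leq_maxl.
move=> k kM; apply: uN; apply/orP; right; apply: contra kM; exact: window_sub.
Qed.

Lemma has_sum_exchange (u : int -> int -> F) (s t : int -> F) x y :
  (forall eps, 0 < eps -> exists N, forall j k,
     (j \notin window N) || (k \notin window N) -> abs (u j k) <= eps) ->
  (forall j, has_sum (u j) (s j)) -> (forall k, has_sum (u^~ k) (t k)) ->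
  has_sum s x -> has_sum t y -> x = y.
Proof.
move=> u0 us ut sx ty; apply/eqP; rewrite -subr_eq0; apply/eqP.
apply: (abs_eps_eq0 absP) => e e0.
have [N uN] := has_sum_double u0 us sx e0.
have [|N' uN'] := has_sum_double (u := fun j k => u k j) _ ut ty e0.
  by move=> d /u0[M uM]; exists M => j k; rewrite orbC; apply: uM.
apply: (absB_trans absP); first exact/uN/(leq_maxl N N').
rewrite absB_sym // exchange_big; exact/uN'/leq_maxr.
Qed.

End IntegerSums.

(* A bundle, so that the ring of series over [V : nafield R F] is a canonical
   structure. *)
Record nafield (R : realType) (F : fieldType) := NAField {
  naabs :> F -> R;
  naabsP : nonarch_abs naabs;
  naabs_complete : complete_abs naabs }.

Section Convolution.
Context {R : realType} {F : fieldType} (V : nafield R F).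
Local Notation absP := (naabsP V).

Lemma H_bound a : H V a -> exists2 M, 1 <= M & forall k, V (a k) <= M.
Proof.
move=> [[M aM] _]; exists (Num.max 1 M); first by rewrite le_max lexx.
by move=> k; rewrite le_max aM orbT.
Qed.

Lemma H_small a : H V a -> forall eps, 0 < eps ->
  exists N : nat, forall k : int, N%:Z <= k -> V (a k) <= eps.
Proof.
move=> [_ /cvg_absP a0] e /a0[N aN]; exists N => -[] // k Nk.
by have := aN k; rewrite subr0; apply; move: Nk; lia.
Qed.

Lemma HP a : (exists M, forall k, V (a k) <= M) ->
  (forall eps, 0 < eps -> exists N : nat, forall k : int, N%:Z <= k -> V (a k) <= eps) ->
  H V a.
Proof.
move=> aM a0; split=> //; apply/cvg_absP => e /a0[N aN]; exists N => n Nn.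
by rewrite subr0 aN // lez_nat.
Qed.

Lemma conv_tends0 a b n : H V a -> H V b -> tends0 V (fun k => a k * b (n - k)).
Proof.
move=> Ha Hb e e0; have [A A1 aA] := H_bound Ha; have [B B1 bB] := H_bound Hb.
have [|N aN] := H_small Ha (eps := e / B); first by rewrite divr_gt0 //; lra.
have [|N' bN] := H_small Hb (eps := e / A); first by rewrite divr_gt0 //; lra.
exists (N + N' + absz n)%N => k; rewrite mem_window => kN; rewrite absM //; last exact: absP.
have [Nk|kN'] := leP N%:Z k.
  have := aN _ Nk; rewrite ler_pdivlMr; last by lra.
  by move/(le_trans _); apply; apply: ler_wpM2l; rewrite ?abs_ge0 //; exact: absP.
have : V (b (n - k)) <= e / A by apply: bN; lia.
rewrite ler_pdivlMr; last by lra.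
rewrite mulrC; move/(le_trans _); apply; apply: ler_wpM2r; rewrite ?abs_ge0 //; exact: absP.
Qed.

Lemma hmulP a b n : H V a -> H V b ->
  has_sum V (fun k => a k * b (n - k)) (hmul V a b n).
Proof.
move=> Ha Hb; apply: tends0_has_sum; [exact: absP|exact: naabs_complete|].
exact: conv_tends0.
Qed.

Lemma hmul_bound a b r r' : H V a -> H V b -> (forall k, V (a k) <= r) ->
  (forall k, V (b k) <= r') -> forall k, V (hmul V a b k) <= r * r'.
Proof.
move=> Ha Hb ar br n; apply: has_sum_le (hmulP n Ha Hb); first exact: absP.
move=> k; rewrite absM; last exact: absP.
by apply: ler_pM; rewrite ?ar ?br // abs_ge0 //; exact: absP.
Qed.

Lemma H_hmul a b : H V a -> H V b -> H V (hmul V a b).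
Proof.
move=> Ha Hb; have [A A1 aA] := H_bound Ha; have [B B1 bB] := H_bound Hb.
apply: HP => [|e e0]; first by exists (A * B) => k; apply: hmul_bound.
have [|N aN] := H_small Ha (eps := e / B); first by rewrite divr_gt0 //; lra.
have [|N' bN] := H_small Hb (eps := e / A); first by rewrite divr_gt0 //; lra.
exists (N + N')%N => n nN.
apply: has_sum_le (hmulP n Ha Hb); first exact: absP.
move=> k; rewrite absM; last exact: absP.
have [Nk|kN'] := leP N%:Z k.
  have := aN _ Nk; rewrite ler_pdivlMr; last by lra.
  by move/(le_trans _); apply; apply: ler_wpM2l; rewrite ?abs_ge0 //; exact: absP.
have : V (b (n - k)) <= e / A by apply: bN; lia.
rewrite ler_pdivlMr; last by lra.
rewrite mulrC; move/(le_trans _); apply; apply: ler_wpM2r; rewrite ?abs_ge0 //; exact: absP.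
Qed.

Lemma hmulC a b : H V a -> H V b -> hmul V a b = hmul V b a.
Proof.
move=> Ha Hb; apply/funext => n; apply: (has_sum_unique absP (hmulP n Ha Hb)).
have := hmulP n Hb Ha.
move=> /(has_sum_reindex (f := fun k => n - k) (h := fun k => n - k) (subKr n) (subKr n)).
congr (has_sum _ _ _); apply/funext => k /=.
by rewrite mulrC subKr.
Qed.

Lemma hmulA a b c : H V a -> H V b -> H V c ->
  hmul V a (hmul V b c) = hmul V (hmul V a b) c.
Proof.
move=> Ha Hb Hc; apply/funext => n; symmetry.
have [A A1 aA] := H_bound Ha; have [B B1 bB] := H_bound Hb.
have [C C1 cC] := H_bound Hc.
have Hbc := H_hmul Hb Hc; have Hab := H_hmul Ha Hb.
apply: (has_sum_exchange absP (u := fun j k => a k * b (j - k) * c (n - j))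
  (s := fun j => hmul V a b j * c (n - j))
  (t := fun k => a k * hmul V b c (n - k))) => [e e0|j|k| |].
- pose M := A * B * C.
  have AB : 1 <= A * B by rewrite mulr_ege1.
  have M1 : 1 <= M by rewrite mulr_ege1.
  have eM : 0 < e / M by rewrite divr_gt0 //; lra.
  have [N1 aN] := H_small Ha eM; have [N2 bN] := H_small Hb eM.
  have [N3 cN] := H_small Hc eM.
  have small x y z D : V x <= e / M -> V y * V z <= D -> D <= M ->
      V x * (V y * V z) <= e.
    move=> xM yzD DM; have yz0 : 0 <= V y * V z.
      by rewrite mulr_ge0 // abs_ge0 //; exact: absP.
    apply: le_trans (_ : e / M * M <= e); last by rewrite divfK // gt_eqF //; lra.
    by apply: ler_pM; rewrite ?(le_trans yzD) // abs_ge0 //; exact: absP.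
  have V0 x : 0 <= V x by apply: abs_ge0; exact: absP.
  exists (2 * (N1 + N2 + N3) + absz n)%N => j k; rewrite !mem_window => jk.
  rewrite !absM; try exact: absP.
  have [kN|kN] := leP N1%:Z k.
    rewrite -mulrA; apply: (small _ _ _ (B * C)); first exact: aN.
      by apply: ler_pM.
    by rewrite /M -mulrA ler_peMl //; nra.
  have [lN|lN] := leP N2%:Z (j - k).
    rewrite [V (a k) * _]mulrC -mulrA; apply: (small _ _ _ (A * C)); first exact: bN.
      by apply: ler_pM.
    by rewrite /M mulrAC ler_peMr //; nra.
  have [mN|mN] := leP N3%:Z (n - j).
    rewrite mulrC; apply: (small _ _ _ (A * B)); first exact: cN.
      by apply: ler_pM.
    by rewrite /M ler_peMr //; nra.
  exfalso; move: jk; lia.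
- have := has_sumZ absP (c (n - j)) (hmulP j Ha Hb); rewrite [c _ * _]mulrC.
  by congr (has_sum _ _ _); apply/funext => k; rewrite mulrC.
- have := has_sumZ absP (a k) (hmulP (n - k) Hb Hc).
  move=> /(has_sum_reindex (f := fun j => j - k) (h := fun j => j + k) (subrK k) (addrK k)).
  congr (has_sum _ _ _); apply/funext => j /=; rewrite mulrA; congr (_ * c _).
  lia.
- exact: hmulP.
- exact: hmulP.
Qed.

Lemma hmul_mono0 a : hmul V (mono 0) a = a.
Proof.
apply/funext => n.
apply: (@has_sumE _ _ _ absP).
have := @has_sum_finite _ _ V absP [:: 0] (fun k => mono 0 k * a (n - k)).
rewrite big_seq1 /mono eqxx mul1r subr0; apply => // k.
by rewrite inE => /negPf ->; rewrite mul0r.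
Qed.

Lemma H_add a b : H V a -> H V b -> H V (a + b).
Proof.
move=> Ha Hb; have [A A1 aA] := H_bound Ha; have [B B1 bB] := H_bound Hb.
apply: HP => [|e e0].
  exists (Num.max A B) => k; apply: absD_le; first exact: absP.
    by rewrite le_max aA.
  by rewrite le_max bB orbT.
have [N aN] := H_small Ha e0; have [N' bN] := H_small Hb e0.
exists (maxn N N') => k kN; apply: absD_le; first exact: absP.
  by apply: aN; lia.
by apply: bN; lia.
Qed.

Lemma H_cmul c a : H V a -> H V (cmul c a).
Proof.
move=> Ha; have [A A1 aA] := H_bound Ha.
have c1 : 0 < V c + 1 by have := abs_ge0 absP c; lra.
apply: HP => [|e e0].
  exists (V c * A) => k; rewrite absM; last exact: absP.
  by apply: ler_wpM2l; rewrite ?abs_ge0 //; exact: absP.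
have [|N aN] := H_small Ha (eps := e / (V c + 1)); first by rewrite divr_gt0.
exists N => k /aN; rewrite ler_pdivlMr // absM; last exact: absP.
move/(le_trans _); apply; rewrite mulrC; apply: ler_wpM2l; first by apply: abs_ge0; exact: absP.
lra.
Qed.

Lemma H_finite (S : seq int) a : (forall k, k \notin S -> a k = 0) -> H V a.
Proof.
move=> aS; have [N SN] := window_cover S; apply: HP => [|e e0].
  exists (\sum_(k <- S) V (a k)) => k; have [kS|kS] := boolP (k \in S).
    rewrite (big_rem k) //= lerDl sumr_ge0 // => i _.
    by apply: abs_ge0; exact: absP.
  rewrite aS // abs0; last exact: absP.
  by apply: sumr_ge0 => i _; apply: abs_ge0; exact: absP.
exists N => k Nk; rewrite aS ?abs0; [exact: ltW|exact: absP|].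
by apply/negP => /SN; rewrite mem_window; lia.
Qed.

Lemma H_mono n : H V (mono n).
Proof. by apply: (@H_finite [:: n%:Z]) => k; rewrite inE /mono => /negPf ->. Qed.

Lemma H_zero : H V 0.
Proof. exact: (@H_finite [::]). Qed.

Lemma H_opp a : H V a -> H V (- a).
Proof.
move=> /(H_cmul (-1)); congr (H _ _); apply/funext => k.
by rewrite /cmul mulN1r.
Qed.

End Convolution.

Record hser (R : realType) (F : fieldType) (V : nafield R F) := HSer {
  hval :> int -> F; hvalP : H V hval }.

Section SeriesRing.
Context {R : realType} {F : fieldType} {V : nafield R F}.
Implicit Types (a b : hser V) (c d : F).
Local Notation absP := (naabsP V).

Lemma hser_ext a b : (forall k, a k = b k) -> a = b.
Proof.
case: a b => [a Ha] [b Hb] /= /funext ab; case: _ / ab in Hb *.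
by rewrite (Prop_irrelevance Ha Hb).
Qed.

HB.instance Definition _ := gen_eqMixin (hser V).
HB.instance Definition _ := gen_choiceMixin (hser V).

Definition hser_add a b : hser V := HSer (H_add (hvalP a) (hvalP b)).
Definition hser_opp a : hser V := HSer (H_opp (hvalP a)).
Definition hser_zero : hser V := HSer (H_zero V).
Definition hser_one : hser V := HSer (H_mono V 0).
Definition hser_mul a b : hser V := HSer (H_hmul (hvalP a) (hvalP b)).
Definition hser_scale c a : hser V := HSer (H_cmul c (hvalP a)).

Let addA : associative hser_add.
Proof. by move=> a b c; apply: hser_ext => k; apply: addrA. Qed.
Let addC : commutative hser_add.
Proof. by move=> a b; apply: hser_ext => k; apply: addrC. Qed.
Let add0 : left_id hser_zero hser_add.
Proof. by move=> a; apply: hser_ext => k; apply: add0r. Qed.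
Let addN : left_inverse hser_zero hser_opp hser_add.
Proof. by move=> a; apply: hser_ext => k; apply: addNr. Qed.

HB.instance Definition _ := GRing.isZmodule.Build (hser V) addA addC add0 addN.

Let mulA : associative hser_mul.
Proof. by move=> a b c; apply: hser_ext => k /=; rewrite hmulA //; apply: hvalP. Qed.
Let mulC : commutative hser_mul.
Proof. by move=> a b; apply: hser_ext => k /=; rewrite hmulC //; apply: hvalP. Qed.
Let mul1 : left_id hser_one hser_mul.
Proof. by move=> a; apply: hser_ext => k /=; rewrite hmul_mono0. Qed.
Let mulD : left_distributive hser_mul +%R.
Proof.
move=> a b c; apply: hser_ext => n /=.
apply: (@has_sumE _ _ _ absP).
have := has_sumD absP (hmulP n (hvalP a) (hvalP c)) (hmulP n (hvalP b) (hvalP c)).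
by congr (has_sum _ _ _); apply/funext => k; rewrite -mulrDl.
Qed.
Let one_neq0 : hser_one != 0.
Proof.
apply/eqP => /(congr1 (fun a : hser V => hval a 0)) /eqP.
by rewrite /= /mono eqxx oner_eq0.
Qed.

HB.instance Definition _ :=
  GRing.Zmodule_isComNzRing.Build (hser V) mulA mulC mul1 mulD one_neq0.

Let scaleA c d a : hser_scale c (hser_scale d a) = hser_scale (c * d) a.
Proof. by apply: hser_ext => k; apply: mulrA. Qed.
Let scale1 : left_id 1 hser_scale.
Proof. by move=> a; apply: hser_ext => k; apply: mul1r. Qed.
Let scaleDr : right_distributive hser_scale +%R.
Proof. by move=> c a b; apply: hser_ext => k; apply: mulrDr. Qed.
Let scaleDl a : {morph hser_scale^~ a : c d / c + d}.
Proof. by move=> c d; apply: hser_ext => k; apply: mulrDl. Qed.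

HB.instance Definition _ :=
  GRing.Zmodule_isLmodule.Build F (hser V) scaleA scale1 scaleDr scaleDl.

Let scaleAl c a b : c *: (a * b) = (c *: a) * b.
Proof.
apply: hser_ext => n; symmetry; apply: (@has_sumE _ _ _ absP).
have := has_sumZ absP c (hmulP n (hvalP a) (hvalP b)).
by congr (has_sum _ _ _); apply/funext => k; rewrite mulrA.
Qed.

HB.instance Definition _ := GRing.Lmodule_isLalgebra.Build F (hser V) scaleAl.
HB.instance Definition _ := GRing.Lalgebra_isComAlgebra.Build F (hser V).

Lemma hval_mul a b : hval (a * b) = hmul V a b.
Proof. by []. Qed.

Lemma hvalD a b k : (a + b) k = a k + b k.
Proof. by []. Qed.

Lemma hvalN a k : (- a) k = - a k.
Proof. by []. Qed.

Lemma hval0 k : (0 : hser V) k = 0.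
Proof. by []. Qed.

Lemma hvalZ c a k : (c *: a) k = c * a k.
Proof. by []. Qed.

Lemma hval1 : hval (1 : hser V) = mono 0.
Proof. by []. Qed.

Lemma hval_sum (I : Type) (r : seq I) (P : pred I) (u : I -> hser V) k :
  (\sum_(i <- r | P i) u i) k = \sum_(i <- r | P i) u i k.
Proof. exact: (big_morph (fun a : hser V => a k) (fun a b => hvalD a b k) (hval0 k)). Qed.

End SeriesRing.

(** * Completeness of finite extensions *)

Definition cauchy_abs {R : realType} {F : fieldType} (abs : F -> R) (u : nat -> F) :=
  forall eps : R, 0 < eps ->
    exists N, forall m n, (N <= m)%N -> (N <= n)%N -> abs (u m - u n) < eps.

Section FiniteExtension.
Context {R : realType} {F : fieldType} {L : fieldExtType F}.
Variables (absF : F -> R) (abs : L -> R).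
Hypotheses (absFP : nonarch_abs absF) (absP : nonarch_abs abs).
Hypotheses (abs_ext : forall x : F, abs x%:A = absF x) (complete : complete_abs absF).

Lemma abs_scale c v : abs (c *: v) = absF c * abs v.
Proof. by rewrite -mulr_algl absM // abs_ext. Qed.

Lemma cvg_abs_lcomb m (e : nat -> L) (x : nat -> nat -> F) (l : nat -> F) :
  (forall i, (i < m)%N -> cvg_abs absF (x^~ i) (l i)) ->
  cvg_abs abs (fun N => \sum_(i < m) x N i *: e i) (\sum_(i < m) l i *: e i).
Proof.
elim: m => [|m IHm] xl.
  by rewrite big_ord0 => eps e0; exists 0%N => n _; rewrite big_ord0 subrr abs0.
have xm : cvg_abs abs (fun N => x N m *: e m) (l m *: e m).
  have : cvg_abs abs (fun N => (x N m)%:A) (l m)%:A.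
    move=> eps e0; have [N xN] := xl m (ltnSn m) _ e0; exists N => n /xN.
    by rewrite -scalerBl abs_ext.
  move=> /(cvg_absMl absP (e m)); rewrite mulrC mulr_algl.
  by congr (cvg_abs _ _ _); apply/funext => N; rewrite mulrC mulr_algl.
have := cvg_absD absP (IHm (fun i im => xl i (ltnW im))) xm.
by rewrite big_ord_recr; congr (cvg_abs _ _ _); apply/funext => N; rewrite big_ord_recr.
Qed.

(* By induction on m: if the coordinate of e m were not controlled by the
   absolute value, then e m would be a limit of combinations of the previous e i,
   whose coordinates converge by induction, contradicting independence. *)
Lemma cauchy_coord m (e : nat -> L) (x : nat -> nat -> F) :
  (forall c : nat -> F, \sum_(i < m) c i *: e i = 0 -> forall i, (i < m)%N -> c i = 0) ->
  cauchy_abs abs (fun N => \sum_(i < m) x N i *: e i) ->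
  forall i, (i < m)%N -> cauchy_abs absF (x^~ i).
Proof.
elim: m x => // m IHm x e_free.
have e_free' (c : nat -> F) : \sum_(i < m) c i *: e i = 0 -> forall i, (i < m)%N -> c i = 0.
  move=> c0 i im; have := e_free (fun i => if (i < m)%N then c i else 0).
  rewrite big_ord_recr /= ltnn scale0r addr0 => /(_ _ i).
  rewrite im; apply; last exact: ltnW.
  by rewrite -[RHS]c0; apply: eq_bigr => j _; rewrite ltn_ord.
have {}IHm y := IHm y e_free'.
have [d d0 dP] : exists2 d : R, 0 < d &
    forall c : nat -> F, d <= abs (\sum_(i < m) c i *: e i + e m).
  apply: contrapT => noD.
  have cP k : exists c : nat -> F, abs (\sum_(i < m) c i *: e i + e m) < k.+1%:R^-1.
    apply: contrapT => noC; apply: noD; exists k.+1%:R^-1; first by rewrite invr_gt0.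
    by move=> c; rewrite leNgt; apply/negP => ck; apply: noC; exists c.
  have [c {}cP] := choice cP.
  have small (eps : R) : 0 < eps ->
      exists N, forall k, (N <= k)%N -> abs (\sum_(i < m) c k i *: e i + e m) < eps.
    move=> e0; exists (Num.bound eps^-1) => k Nk; apply: lt_le_trans (cP k) _.
    rewrite invf_ple ?posrE //; apply: le_trans (ltW (archi_boundP _)) _.
      by rewrite invr_ge0 ltW.
    by rewrite ler_nat leqW.
  have /IHm cc : cauchy_abs abs (fun k => \sum_(i < m) c k i *: e i).
    move=> eps /small[N cN]; exists N => k l Nk Nl.
    rewrite -[X in X - _](addrK (e m)) -addrA -opprD [e m + _]addrC.
    by apply: absD_lt; rewrite ?absN ?cN.
  have lP i : exists l, (i < m)%N -> cvg_abs absF (c^~ i) l.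
    have [im|im] := boolP (i < m)%N; last by exists 0.
    by have [l cl] := complete (cc i im); exists l.
  have [l {}lP] := choice lP.
  have lim := cvg_absD absP (cvg_abs_lcomb e lP) (cvg_abs_cst absP (e m)).
  have l0 : \sum_(i < m) l i *: e i + e m = 0.
    apply: (cvg_abs_unique absP lim) => eps /small[N cN]; exists N => k /cN.
    by rewrite subr0.
  have : (if (m < m)%N then l m else 1) = 0.
    apply: (e_free (fun i => if (i < m)%N then l i else 1)) (ltnSn m).
    rewrite big_ord_recr /= ltnn scale1r -[RHS]l0; congr (_ + _).
    by apply: eq_bigr => i _; rewrite ltn_ord.
  by rewrite ltnn => /eqP; rewrite oner_eq0.
have dM (c : nat -> F) y : d * absF y <= abs (\sum_(i < m) c i *: e i + y *: e m).
  have [->|y0] := eqVneq y 0; first by rewrite abs0 // mulr0 abs_ge0.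
  have -> : \sum_(i < m) c i *: e i + y *: e m
    = y *: (\sum_(i < m) (y^-1 * c i) *: e i + e m).
    rewrite scalerDr scaler_sumr; congr (_ + _); apply: eq_bigr => i _.
    by rewrite scalerA mulrA divff // mul1r.
  by rewrite abs_scale mulrC; apply: ler_wpM2l; [exact: (abs_ge0 absFP)|exact: (dP (fun i => y^-1 * c i))].
have diff N M : \sum_(i < m.+1) x N i *: e i - \sum_(i < m.+1) x M i *: e i
    = \sum_(i < m) (x N i - x M i) *: e i + (x N m - x M m) *: e m.
  by rewrite -sumrB big_ord_recr /= scalerBl; congr (_ + _); apply: eq_bigr => i _; rewrite scalerBl.
move=> xc; have xm : cauchy_abs absF (x^~ m).
  move=> eps e0; have [|N xN] := xc (eps * d); first by rewrite mulr_gt0.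
  exists N => k l Nk Nl; have := xN k l Nk Nl; rewrite diff.
  by move=> /(le_lt_trans (dM (fun i => x k i - x l i) _)); rewrite mulrC ltr_pM2r.
move=> i; rewrite ltnS leq_eqVlt => /orP[/eqP -> //|]; apply: (IHm x).
move=> eps e0; have em1 : 0 < abs (e m) + 1 by have := abs_ge0 absP (e m); lra.
have [N xN] := xc _ e0; have [|N' xmN] := xm (eps / (abs (e m) + 1)).
  by rewrite divr_gt0.
exists (maxn N N') => k l; rewrite !geq_max => /andP[Nk N'k] /andP[Nl N'l].
have := xN k l Nk Nl; rewrite diff => xkl.
rewrite -sumrB.
under eq_bigr do rewrite -scalerBl.
rewrite -[X in abs X](addrK ((x k m - x l m) *: e m)); apply: absD_lt => //.
rewrite absN // abs_scale; have := xmN k l N'k N'l; rewrite ltr_pdivlMr //.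
apply: le_lt_trans; apply: ler_wpM2l; rewrite ?abs_ge0 //; lra.
Qed.

Lemma complete_fieldExt : complete_abs abs.
Proof.
move=> u uc; pose n := \dim {:L}; pose X := vbasis {:L}.
pose x N i := oapp (fun j : 'I_n => coord X j (u N)) 0 (insub i).
have ux N : u N = \sum_(i < n) x N i *: X`_i.
  rewrite {1}[u N](coord_vbasis (memvf _)); apply: eq_bigr => i _.
  by rewrite /x valK.
have X_free (c : nat -> F) : \sum_(i < n) c i *: X`_i = 0 ->
    forall i, (i < n)%N -> c i = 0.
  move=> c0 i im; have /freeP h := basis_free (vbasisP {:L}).
  exact: (h (fun j => c j) c0 (Ordinal im)).
have /(cauchy_coord X_free) xc : cauchy_abs abs (fun N => \sum_(i < n) x N i *: X`_i).
  move=> eps /uc[N uN]; exists N => k l Nk Nl; rewrite -!ux; exact: uN.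
have lP i : exists l, (i < n)%N -> cvg_abs absF (x^~ i) l.
  have [im|im] := boolP (i < n)%N; last by exists 0.
  by have [l cl] := complete (xc i im); exists l.
have [l {}lP] := choice lP.
exists (\sum_(i < n) l i *: X`_i) => eps e0.
have [N xN] := cvg_abs_lcomb (fun i => X`_i) lP e0; exists N => k /xN.
by rewrite -ux.
Qed.

End FiniteExtension.

(** * Exponentials *)

Section PadicFactorial.
Variables (p : nat) (p_prime : prime p).

Lemma logn_fact_rec n : (logn p n`! = n %/ p + logn p (n %/ p)`!)%N.
Proof.
have p1 := prime_gt1 p_prime.
have [->|n0] := posnP n; first by rewrite div0n.
rewrite !logn_fact // big_ltn ?ltnS // expn1 big_add1 /=; congr addn.
have np : (n %/ p < n)%N by rewrite ltn_Pdiv.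
rewrite (@big_cat_nat _ _ _ (n %/ p).+1 1 n) //= [X in _ = X]/= [X in (_ + X)%N]big1_seq ?addn0.
  by apply: eq_bigr => k _; rewrite expnS divnMA.
move=> k; rewrite mem_index_iota => /andP[_ /andP[kn _]].
rewrite expnS divnMA divn_small //; apply: ltn_trans kn _; exact: ltn_expl.
Qed.

Lemma logn_fact_lt n : (0 < n)%N -> (p.-1 * logn p n`! < n)%N.
Proof.
have p1 := prime_gt1 p_prime.
elim/ltn_ind: n => n IHn n0; rewrite logn_fact_rec.
have [q0|q0] := posnP (n %/ p); first by rewrite q0 fact0 logn1 muln0.
have := IHn _ (ltn_Pdiv p1 n0) q0; have := leq_divM n p; nia.
Qed.

Context {R : realType} {F : fieldType}.

Lemma inv_p_gt0 : 0 < p%:R^-1 :> R.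
Proof. by rewrite invr_gt0 ltr0n prime_gt0. Qed.

Lemma inv_p_lt1 : p%:R^-1 < 1 :> R.
Proof. by rewrite invf_lt1 ?ltr0n ?prime_gt0 // ltr1n prime_gt1. Qed.

Let inv_p_ge0 : 0 <= p%:R^-1 :> R := ltW inv_p_gt0.
Let inv_p_le1 : p%:R^-1 <= 1 :> R := ltW inv_p_lt1.

Variables (abs : F -> R) (absP : nonarch_abs abs) (absp : abs p%:R = p%:R^-1).

Lemma abs_coprime n : ~~ (p %| n)%N -> abs n%:R = 1.
Proof.
move=> pn; have n0 : (0 < n)%N by case: n pn => //; rewrite dvdn0.
apply/eqP; rewrite eq_le abs_nat //= leNgt; apply/negP => n1.
have /eqP : coprime n p by rewrite coprime_sym prime_coprime.
have [u v uv _] := egcdnP p n0; move=> gcd1; move: uv; rewrite gcd1 => uv.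
have : abs (u * n)%:R = 1.
  rewrite uv natrD addrC abs_lead ?abs1 // natrM absM // absp.
  by apply: le_lt_trans inv_p_lt1; rewrite ler_piMl ?abs_nat.
move=> /eqP; rewrite natrM absM // lt_eqF //.
apply: le_lt_trans n1; rewrite ler_piMl ?abs_nat ?abs_ge0 //.
Qed.

Lemma abs_natE n : (0 < n)%N -> abs n%:R = p%:R^-1 ^+ logn p n.
Proof.
move=> n0; move: (n0); have [m pm ->] := pfactor_coprime p_prime n0.
rewrite muln_gt0 => /andP[m0 _].
have am : abs m%:R = 1 by apply: abs_coprime; rewrite -prime_coprime.
rewrite natrM absM // natrX absX // absp am mul1r.
congr (_ ^+ _); rewrite lognM ?expn_gt0 ?(prime_gt0 p_prime) //.
by rewrite pfactorK // [logn p m]logn_coprime.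
Qed.

Lemma natr_neq0 n : (0 < n)%N -> n%:R != 0 :> F.
Proof.
move=> n0; rewrite -(abs_gt0 absP) abs_natE // exprn_gt0 // invr_gt0 ltr0n.
exact: prime_gt0.
Qed.

Lemma fact_neq0 n : n`!%:R != 0 :> F.
Proof. by rewrite natr_neq0 // fact_gt0. Qed.

Lemma fact_bound (s : R) n : 0 <= s -> s ^+ p.-1 = p%:R^-1 -> s ^+ n <= abs n`!%:R.
Proof.
move=> s0 sp; have s1 : s <= 1.
  rewrite leNgt; apply/negP => s1; have := inv_p_lt1; rewrite -sp.
  by rewrite ltNge exprn_ege1 // ltW.
rewrite abs_natE ?fact_gt0 // -sp -exprM; apply: ler_wiXn2l => //.
have [->|n0] := posnP n; first by rewrite logn1 muln0.
exact/ltnW/logn_fact_lt.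
Qed.

Lemma abs_pX_fact m : (0 < m)%N -> abs (m`!%:R^-1 * p%:R ^+ m) <= p%:R^-1.
Proof.
move=> m0; rewrite absM // absV // absX // absp abs_natE ?fact_gt0 //.
have vm : (logn p m`! < m)%N.
  apply: leq_ltn_trans (logn_fact_lt m0); rewrite leq_pmull //.
  by have := prime_gt1 p_prime; lia.
rewrite -[in X in _ * X](subnK (ltnW vm)) exprD mulrC mulfK; last by rewrite expf_neq0 // gt_eqF // inv_p_gt0.
rewrite -[X in _ <= X]expr1; apply: ler_wiXn2l; rewrite ?inv_p_ge0 ?inv_p_le1 //.
by rewrite subn_gt0.
Qed.

End PadicFactorial.

Section TruncatedExponential.
Context {F : fieldType} {B : comAlgType F}.
Hypothesis fact_unit : forall n, n`!%:R != 0 :> F.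
Implicit Types x y : B.

Definition texp N x : B := \sum_(n < N) n`!%:R^-1 *: x ^+ n.

Lemma sum_triangle (f : nat -> nat -> B) N :
  \sum_(n < N) \sum_(j < n.+1) f (n - j)%N j =
  \sum_(i < N) \sum_(j < N | (i + j < N)%N) f i j.
Proof.
have -> : \sum_(n < N) \sum_(j < n.+1) f (n - j)%N j =
    \sum_(n < N) \sum_(j < N | (j < n.+1)%N) f (n - j)%N j.
  by apply: eq_bigr => n _; rewrite (big_ord_widen N (fun j => f (n - j)%N j)).
rewrite (exchange_big_dep xpredT) //= [RHS](exchange_big_dep xpredT) //=.
apply: eq_bigr => j _.
rewrite -(big_mkord (fun n => (j <= n)%N) (fun n => f (n - j)%N j)).
have <- : \sum_(j <= n < N) f (n - j)%N j =
    \sum_(0 <= n < N | (j <= n)%N) f (n - j)%N j by rewrite (big_nat_widenl j 0).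
rewrite -{1}[nat_of_ord j]add0n big_addn big_mkord.
transitivity (\sum_(i < N - j) f i j); first by apply: eq_bigr => i _; rewrite addnK.
rewrite (big_ord_widen N (fun i => f i j)) ?leq_subr //.
by apply: eq_bigl => i; rewrite ltn_subRL addnC.
Qed.

Lemma texpM N x y : texp N x * texp N y = texp N (x + y) +
  \sum_(i < N) \sum_(j < N | (N <= i + j)%N)
     (i`!%:R^-1 *: x ^+ i) * (j`!%:R^-1 *: y ^+ j).
Proof.
pose f i j := (i`!%:R^-1 *: x ^+ i) * (j`!%:R^-1 *: y ^+ j).
have -> : texp N (x + y) = \sum_(n < N) \sum_(j < n.+1) f (n - j)%N j.
  apply: eq_bigr => n _; rewrite exprDn scaler_sumr; apply: eq_bigr => j _.
  rewrite /f -scalerAl -scalerAr scalerA -scaler_nat scalerA; congr (_ *: _).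
  have jn : (j <= n)%N by rewrite -ltnS ltn_ord.
  apply: (mulfI (fact_unit n)); rewrite mulrA divff // mul1r -(bin_fact jn) !natrM.
  by field; rewrite !fact_unit.
rewrite sum_triangle /texp mulr_suml -big_split; apply: eq_bigr => i _ /=.
rewrite mulr_sumr (bigID (fun j : 'I_N => (i + j < N)%N)) /=; congr (_ + _).
by apply: eq_bigl => j; rewrite -leqNgt.
Qed.

Lemma texp0 N : (0 < N)%N -> texp N 0 = 1.
Proof.
case: N => // N _; rewrite /texp big_ord_recl big1 => [|i _].
  by rewrite fact0 invr1 scale1r addr0.
by rewrite expr0n scaler0.
Qed.

End TruncatedExponential.

Section SmallPowers.
Import numFieldNormedType.Exports.

Lemma small_expr (R : realType) (q eps : R) : 0 <= q < 1 -> 0 < eps ->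
  exists N, forall n, (N <= n)%N -> q ^+ n <= eps.
Proof.
move=> /andP[q0 q1] e0; have /cvgrPdist_le /(_ _ e0) : q ^+ n @[n --> \oo] --> (0 : R).
  by apply: cvg_expr; rewrite ger0_norm.
move=> [N _ qN]; exists N => n /qN; rewrite sub0r normrN ger0_norm // exprn_ge0 //.
Qed.

End SmallPowers.

Section SeriesNorm.
Context {R : realType} {F : fieldType} {V : nafield R F}.
Implicit Types (a b : hser V) (r eps : R).
Local Notation absP := (naabsP V).

Definition hle a r : Prop := forall k, V (a k) <= r.

Lemma hle_trans a r r' : hle a r -> r <= r' -> hle a r'.
Proof. by move=> ar rr' k; apply: le_trans (ar k) rr'. Qed.

Lemma hleD a b r : hle a r -> hle b r -> hle (a + b) r.
Proof. by move=> ar br k; apply: absD_le absP _ _ _ (ar k) (br k). Qed.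

Lemma hleN a r : hle a r -> hle (- a) r.
Proof. by move=> ar k; rewrite hvalN (absN absP). Qed.

Lemma hleB a b r : hle a r -> hle b r -> hle (a - b) r.
Proof. by move=> ar br; apply/hleD/hleN. Qed.

Lemma hleB_trans b a c r : hle (a - b) r -> hle (b - c) r -> hle (a - c) r.
Proof. by move=> ab bc; rewrite -(subrKA b a); apply: hleD. Qed.

Lemma hleB_sym a b r : hle (a - b) r -> hle (b - a) r.
Proof. by move/hleN; rewrite opprB. Qed.

Lemma hleM a b r r' : hle a r -> hle b r' -> hle (a * b) (r * r').
Proof. by move=> ar br; apply: hmul_bound => //; apply: hvalP. Qed.

Lemma hle0 r : 0 <= r -> hle 0 r.
Proof. by move=> r0 k; rewrite hval0 (abs0 absP). Qed.

Lemma hle1 : hle 1 1.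
Proof. by move=> k; rewrite hval1 /mono; case: eqP; rewrite ?(abs1 absP) ?(abs0 absP). Qed.

Lemma hleZ c a r : hle a r -> hle (c *: a) (V c * r).
Proof.
by move=> ar k; rewrite hvalZ (absM absP); apply: ler_wpM2l; [exact: abs_ge0 absP _|].
Qed.

Lemma hleX a r n : hle a r -> hle (a ^+ n) (r ^+ n).
Proof.
move=> ar; elim: n => [|n IHn]; first exact: hle1.
by rewrite !exprS; apply: hleM.
Qed.

Lemma hle_sum (I : Type) (s : seq I) (P : pred I) (u : I -> hser V) r : 0 <= r ->
  (forall i, P i -> hle (u i) r) -> hle (\sum_(i <- s | P i) u i) r.
Proof.
by move=> r0 ur; elim/big_ind: _ => //; [apply: hle0|move=> a b; apply: hleD].
Qed.

Lemma hle_bound a : exists2 r, 1 <= r & hle a r.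
Proof. exact: H_bound (hvalP a). Qed.

Lemma hle_eq a b : (forall eps, 0 < eps -> hle (a - b) eps) -> a = b.
Proof.
move=> ab; apply: hser_ext => k; apply/eqP; rewrite -subr_eq0; apply/eqP.
by apply: (abs_eps_eq0 absP) => e /ab /(_ k).
Qed.

Definition hcvg (u : nat -> hser V) a : Prop := forall eps, 0 < eps ->
  exists N, forall n, (N <= n)%N -> hle (u n - a) eps.

Lemma hser_complete (u : nat -> hser V) :
  (forall eps, 0 < eps -> exists N, forall m n, (N <= m)%N -> (N <= n)%N ->
     hle (u m - u n) eps) -> exists a, hcvg u a.
Proof.
move=> uc.
have cP k : exists l, cvg_abs V (fun n => u n k) l.
  move: (@naabs_complete _ _ V (fun n => u n k)); apply => e e0; have [|N uN] := uc (e / 2); first by rewrite divr_gt0.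
  exists N => m n Nm Nn; apply: le_lt_trans (uN m n Nm Nn k) _; lra.
have [l lP] := choice cP.
have lim eps : 0 < eps ->
    exists N, forall n, (N <= n)%N -> forall k, V (u n k - l k) <= eps.
  move=> /uc[N uN]; exists N => n Nn k; rewrite (absB_sym absP).
  by apply: (cvg_abs_le absP (N := N) (lP k)) => m Nm; apply: uN.
have Hl : H V l.
  apply: HP => [|e e0].
    have [N lN] := lim 1 ltr01; have [r r1 uNr] := hle_bound (u N).
    exists r => k; rewrite -[l k](subKr (u N k)); apply: (absB_le absP) => //.
    exact: le_trans (lN N (leqnn N) k) r1.
  have [N lN] := lim _ e0; have [M uM] := H_small (hvalP (u N)) e0.
  exists M => k Mk; rewrite -[l k](subKr (u N k)); apply: (absB_le absP).
    exact: uM.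
  exact: lN.
by exists (HSer Hl) => e /lim[N lN]; exists N => n Nn k; apply: lN.
Qed.

Lemma hser_series (u : nat -> hser V) :
  (forall eps, 0 < eps -> exists N, forall n, (N <= n)%N -> hle (u n) eps) ->
  exists a, hcvg (fun N => \sum_(n < N) u n) a.
Proof.
move=> u0; apply: hser_complete => e e0; have [N uN] := u0 _ e0.
exists N => m n; wlog mn : m n / (m <= n)%N.
  by case: (leqP m n) => [|/ltnW] mn W Nm Nn; [|apply: hleB_sym]; apply: W.
move=> Nm _; apply: hleB_sym.
rewrite -!(big_mkord xpredT u) (@big_cat_nat _ _ _ m 0 n) //= addrAC subrr add0r.
rewrite big_nat; apply: hle_sum => [|i /andP[mi _]]; first exact: ltW.
exact: uN (leq_trans Nm mi).
Qed.

Lemma hcvg_le u a b r N : hcvg u a -> (forall n, (N <= n)%N -> hle (u n - b) r) ->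
  hle (a - b) r.
Proof.
move=> ua ub k; apply: (cvg_abs_le absP (u := fun n => u n k) (N := N)).
  apply/cvg_absP => e /ua[M uM]; exists M => n /uM; exact.
by move=> n Nn; apply: ub.
Qed.

Lemma hcvg_unique u a b : hcvg u a -> hcvg u b -> a = b.
Proof.
move=> ua ub; apply: hle_eq => e e0; have [N uN] := ub _ e0.
exact: hcvg_le ua uN.
Qed.

End SeriesNorm.

Section Exponential.
Context {R : realType} {F : fieldType} {V : nafield R F}.
Variables (p : nat) (p_prime : prime p) (absp : V p%:R = p%:R^-1).
Local Notation absP := (naabsP V).
Local Notation q := (p%:R^-1 : R).

(* |p|^(1 + 1/(p-1)): if |x| is at most this, then |x^n / n!| <= |p|^n. *)
Definition exp_radius : R := q * q `^ (p.-1%:R^-1).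

Let s : R := q `^ (p.-1%:R^-1).

Let q0 : 0 < q := inv_p_gt0 p_prime.
Let q1 : q < 1 := inv_p_lt1 p_prime.

Let s0 : 0 < s.
Proof. exact: powR_gt0. Qed.

Lemma exp_radius_gt0 : 0 < exp_radius.
Proof. exact: mulr_gt0. Qed.

Let sp : s ^+ p.-1 = q.
Proof.
rewrite -powR_mulrn ?ltW // -powRrM mulVf ?powRr1 ?ltW //.
by rewrite pnatr_eq0 -lt0n; have := prime_gt1 p_prime; lia.
Qed.

Lemma exp_radiusX : exp_radius ^+ p.-1 = q ^+ p.
Proof.
rewrite exprMn -/s sp -exprSr prednK // prime_gt0 //.
Qed.

Definition hexp (x : hser V) : hser V := xget 0 [set a | hcvg (fun N => texp N x) a].

Implicit Types x y : hser V.

Lemma exp_term_le x n : hle x exp_radius -> hle (n`!%:R^-1 *: x ^+ n) (q ^+ n).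
Proof.
move=> xr; apply: hle_trans (hleZ _ (hleX n xr)) _.
rewrite (absV absP) exprMn -/s mulrCA.
apply: ler_piMr; first exact: exprn_ge0 (ltW q0).
rewrite mulrC ler_pdivrMr ?mul1r; first by apply: (fact_bound p_prime absP absp) sp; apply: ltW.
by rewrite (abs_gt0 absP) (fact_neq0 p_prime absP absp).
Qed.

Lemma hexp_cvg x : hle x exp_radius -> hcvg (fun N => texp N x) (hexp x).
Proof.
move=> xr; rewrite /hexp; case: xgetP => [a _ //|noa].
have [|a xa] := @hser_series _ _ V (fun n => n`!%:R^-1 *: x ^+ n).
  move=> e e0; have [|N qN] := small_expr (q := q) _ e0; first by rewrite q1 ltW.
  by exists N => n /qN; apply: hle_trans (exp_term_le n xr).
by have := noa a.
Qed.

Lemma texp_le x N : hle x exp_radius -> hle (texp N x) 1.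
Proof.
move=> xr; apply: hle_sum => // i _; apply: hle_trans (exp_term_le i xr) _.
by rewrite exprn_ile1 // ltW.
Qed.

Lemma hexp_texp x N : hle x exp_radius -> hle (hexp x - texp N x) (q ^+ N).
Proof.
move=> xr; apply: (hcvg_le (N := N) (hexp_cvg xr)) => n Nn.
rewrite /texp -!(big_mkord xpredT (fun n => n`!%:R^-1 *: x ^+ n)).
rewrite (@big_cat_nat _ _ _ N 0 n) //= addrAC subrr add0r.
rewrite big_nat; apply: hle_sum => [|i /andP[Ni _]]; first exact: exprn_ge0 (ltW q0).
by apply: hle_trans (exp_term_le i xr) _; apply: ler_wiXn2l => //; apply: ltW.
Qed.

Lemma hexp_le x : hle x exp_radius -> hle (hexp x) 1.
Proof.
move=> xr; rewrite -[hexp x](subrK (texp 0 x)).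
by apply: hleD (texp_le _ xr); apply: hexp_texp xr.
Qed.

Lemma hexp0 : hexp 0 = 1.
Proof.
apply: (hcvg_unique (hexp_cvg (hle0 (ltW exp_radius_gt0)))) => e e0.
exists 1%N => N N0; rewrite texp0 // subrr; exact/hle0/ltW.
Qed.

Lemma hexpD x y : hle x exp_radius -> hle y exp_radius ->
  hexp (x + y) = hexp x * hexp y.
Proof.
move=> xr yr; apply: hle_eq => e e0.
have [|N qN] := small_expr (q := q) _ e0; first by rewrite q1 ltW.
apply: (@hle_trans _ _ _ _ (q ^+ N)); last exact: qN.
apply: (hleB_trans (b := texp N (x + y))); first exact/hexp_texp/hleD.
apply: (hleB_trans (b := texp N x * texp N y)).
  rewrite (texpM (fact_neq0 p_prime absP absp)) opprD addrA subrr add0r.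
  apply: hleN; apply: hle_sum => [|i _]; first exact: exprn_ge0 (ltW q0).
  apply: hle_sum => [|j ij]; first exact: exprn_ge0 (ltW q0).
  apply: hle_trans (hleM (exp_term_le i xr) (exp_term_le j yr)) _.
  by rewrite -exprD; apply: ler_wiXn2l => //; apply: ltW.
apply: (hleB_trans (b := texp N x * hexp y)).
  rewrite -mulrBr -[q ^+ N]mul1r; apply: hleM (texp_le _ xr) _.
  exact/hleB_sym/hexp_texp.
rewrite -mulrBl -[q ^+ N]mulr1; apply: hleM (hexp_le yr).
exact/hleB_sym/hexp_texp.
Qed.

Lemma hexpN x : hle x exp_radius -> hexp x * hexp (- x) = 1.
Proof. by move=> xr; rewrite -hexpD ?subrr ?hexp0 //; apply: hleN. Qed.

End Exponential.

Section TruncatedPowers.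
Context {F : fieldType}.
Implicit Types (P Q : {poly F}) (f g : nat -> F).

Lemma coefM_eq N P P' Q Q' : (forall i, (i < N)%N -> P`_i = P'`_i) ->
  (forall i, (i < N)%N -> Q`_i = Q'`_i) ->
  forall i, (i < N)%N -> (P * Q)`_i = (P' * Q')`_i.
Proof.
move=> PP' QQ' i iN; rewrite !coefM; apply: eq_bigr => j _.
by have := ltn_ord j; rewrite ltnS => ji; rewrite PP' ?QQ' //; lia.
Qed.

Lemma coefX_eq N P P' n : (forall i, (i < N)%N -> P`_i = P'`_i) ->
  forall i, (i < N)%N -> (P ^+ n)`_i = (P' ^+ n)`_i.
Proof.
by move=> PP'; elim: n => // n IHn; rewrite !exprS; apply: coefM_eq.
Qed.

Lemma coefM_small m n P Q : (forall i, (i < m)%N -> P`_i = 0) ->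
  (forall i, (i < n)%N -> Q`_i = 0) -> forall i, (i < m + n)%N -> (P * Q)`_i = 0.
Proof.
move=> P0 Q0 i imn; rewrite coefM big1 // => j _; have := ltn_ord j => ji.
have [jm|jm] := ltnP j m; first by rewrite P0 ?mul0r.
by rewrite Q0 ?mulr0 //; lia.
Qed.

Lemma coefX_small n P : P`_0 = 0 -> forall i, (i < n)%N -> (P ^+ n)`_i = 0.
Proof.
move=> P0; elim: n => // n IHn i iN; rewrite exprS.
by apply: (@coefM_small 1 n) => // -[].
Qed.

Lemma fps_expE f m : fps_exp f m = (texp m.+1 (\poly_(j < m.+1) f j))`_m.
Proof. by []. Qed.

Lemma coef_texp N (P : {poly F}) m :
  (texp N P)`_m = \sum_(n < N) n`!%:R^-1 * (P ^+ n)`_m.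
Proof. by rewrite coef_sum; apply: eq_bigr => n _; rewrite coefZ. Qed.

Lemma fps_exp_trunc f N m : (m < N)%N -> f 0%N = 0 ->
  fps_exp f m = (texp N (\poly_(j < N) f j))`_m.
Proof.
move=> mN f0; rewrite fps_expE !coef_texp.
rewrite (big_ord_widen N (fun n => n`!%:R^-1 * ((\poly_(j < m.+1) f j) ^+ n)`_m)) //.
rewrite big_mkcond; apply: eq_bigr => n _; case: ltnP => nm.
  congr (_ * _); apply: (@coefX_eq m.+1) => // i im; rewrite !coef_poly im.
  by rewrite (leq_ltn_trans _ mN).
by rewrite coefX_small ?mulr0 // coef_poly f0 if_same.
Qed.

Hypothesis fact_unit : forall n, n`!%:R != 0 :> F.

Lemma fps_expD f g m : f 0%N = 0 -> g 0%N = 0 ->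
  fps_exp (fun j => f j + g j) m = \sum_(j < m.+1) fps_exp f j * fps_exp g (m - j).
Proof.
move=> f0 g0; pose P := \poly_(j < m.+1) f j; pose Q := \poly_(j < m.+1) g j.
have fgE : \poly_(j < m.+1) (f j + g j) = P + Q.
  by apply/polyP => i; rewrite coefD !coef_poly; case: ifP; rewrite ?addr0.
have := congr1 (fun P : {poly F} => P`_m) (texpM fact_unit m.+1 P Q).
rewrite /= coefD [X in _ = _ + X]coef_sum [X in _ = _ + X]big1 ?addr0 => [|i _]; last first.
  rewrite coef_sum big1 // => j ij; rewrite -scalerAl -scalerAr !coefZ.
  rewrite (@coefM_small i j) ?mulr0 // => k ki.
    by rewrite coefX_small // coef_poly /= f0.
  by rewrite coefX_small // coef_poly /= g0.
rewrite fps_expE fgE => <-; rewrite coefM; apply: eq_bigr => j _.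
by rewrite -!fps_exp_trunc // ltnS leq_subr.
Qed.

Lemma fps_exp_0 f : fps_exp f 0 = 1.
Proof.
by rewrite fps_expE coef_texp big_ord1 expr0 coef1 mulr1 fact0 invr1.
Qed.

Lemma fps_exp_eq f g m : (forall j, (j <= m)%N -> f j = g j) ->
  fps_exp f m = fps_exp g m.
Proof.
move=> fg; rewrite !fps_expE; suff -> : \poly_(j < m.+1) f j = \poly_(j < m.+1) g j by [].
apply/polyP => i.
by rewrite !coef_poly; case: ltnP => // /fg.
Qed.

Lemma fps_exp_scale f c m : fps_exp (fun j => f j * c ^+ j) m = fps_exp f m * c ^+ m.
Proof.
have scaleX (P Q : {poly F}) n : (forall i, Q`_i = P`_i * c ^+ i) ->
    forall i, (Q ^+ n)`_i = (P ^+ n)`_i * c ^+ i.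
  move=> PQ; elim: n => [|n IHn] i.
    by rewrite !coef1; case: i => [|i]; rewrite ?mul0r // expr0 mulr1.
  rewrite !exprS !coefM mulr_suml; apply: eq_bigr => j _; rewrite PQ IHn.
  have ji : (j <= i)%N by rewrite -ltnS ltn_ord.
  by rewrite mulrACA -exprD subnKC.
rewrite !fps_expE !coef_texp mulr_suml; apply: eq_bigr => n _; rewrite -mulrA.
congr (_ * _); apply: scaleX => i.
by rewrite !coef_poly; case: ifP; rewrite ?mul0r.
Qed.

Lemma fps_exp_subst p f m : (0 < p)%N -> f 0%N = 0 ->
  fps_exp (fun j => if (p %| j)%N then f (j %/ p)%N else 0) m =
  if (p %| m)%N then fps_exp f (m %/ p) else 0.
Proof.
move=> p0 f0; set g := fun j => _; have mp : (m %/ p < m.+1)%N by rewrite ltnS leq_div.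
have g0 : g 0%N = 0 by rewrite /g dvdn0 div0n.
rewrite (fps_exp_trunc mp f0) fps_expE !coef_texp.
transitivity (\sum_(n < m.+1) n`!%:R^-1 *
    (((\poly_(j < m.+1) f j) \Po 'X^p) ^+ n)`_m).
  apply: eq_bigr => n _; congr (_ * _); apply: (@coefX_eq m.+1) => // i im.
  rewrite coef_comp_poly_Xn // !coef_poly im (leq_ltn_trans (leq_div i p) im).
  by rewrite /g.
case: ifP => pm; last first.
  by apply: big1 => n _; rewrite -rmorphXn coef_comp_poly_Xn // pm mulr0.
by apply: eq_bigr => n _; rewrite -rmorphXn coef_comp_poly_Xn // pm.
Qed.

Lemma fps_exp_cst0 m : fps_exp (fun=> 0 : F) m = (m == 0%N)%:R.
Proof.
rewrite fps_expE coef_texp big_ord_recl big1 ?addr0 => [|i _].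
  by rewrite expr0 coef1 fact0 invr1 mul1r.
rewrite (_ : \poly_(_ < _) _ = 0) ?expr0n ?coef0 ?mulr0 //.
by apply/polyP => j; rewrite coef_poly coef0 if_same.
Qed.

Lemma fps_exp_natmul f N m n : f 0%N = 0 -> (m < N)%N ->
  fps_exp (fun j => n%:R * f j) m = ((\poly_(j < N) fps_exp f j) ^+ n)`_m.
Proof.
move=> f0; elim: n m => [|n IHn] m mN.
  by rewrite coef1 -fps_exp_cst0; apply: fps_exp_eq => j _; rewrite mul0r.
rewrite (@fps_exp_eq _ (fun j => f j + n%:R * f j)) => [|j _]; last first.
  by rewrite -natr1 mulrDl mul1r addrC.
rewrite fps_expD ?f0 ?mulr0 // exprS coefM; apply: eq_bigr => j _.
have jm := ltn_ord j.
by rewrite coef_poly IHn ?ifT //; lia.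
Qed.

End TruncatedPowers.

Lemma fps_exp_morph (F L : fieldType) (phi : {rmorphism F -> L}) (f : nat -> F) m :
  fps_exp (fun j => phi (f j)) m = phi (fps_exp f m).
Proof.
rewrite !fps_expE !coef_texp rmorph_sum; apply: eq_bigr => n _.
rewrite rmorphM fmorphV rmorph_nat -coef_map rmorphXn /=.
suff -> : map_poly phi (\poly_(j < m.+1) f j) = \poly_(j < m.+1) phi (f j) by [].
by apply/polyP => i; rewrite coef_map !coef_poly; case: ifP => _; rewrite ?raddf0.
Qed.

(** * The Artin-Hasse exponential *)

Section LogCoefficients.
Context {F : fieldType}.
Variables (p : nat) (p_prime : prime p).
Let p1 : (1 < p)%N := prime_gt1 p_prime.

Lemma l_coef_pow k : @l_coef F p (p ^ k) = p%:R ^- k.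
Proof.
rewrite /l_coef (eq_bigl (fun i : 'I_(p ^ k).+1 => i == k :> nat)); last first.
  by move=> i; rewrite eqn_exp2l // eq_sym.
have kp : (k < (p ^ k).+1)%N by rewrite ltnS ltnW // ltn_expl.
by rewrite (big_pred1 (Ordinal kp)) // => i; rewrite -val_eqE.
Qed.

Lemma l_coef_neq0 m : @l_coef F p m != 0 -> exists k, m = (p ^ k)%N.
Proof.
rewrite /l_coef; have [/existsP[k /eqP ->] _|/existsPn noK] :=
  boolP [exists k : 'I_m.+1, m == (p ^ k)%N]; first by exists k.
by rewrite big_pred0 ?eqxx // => k; apply/negbTE.
Qed.

Lemma l_coef0 : @l_coef F p 0 = 0.
Proof.
have [//|/l_coef_neq0[k /esym/eqP]] := eqVneq (@l_coef F p 0) 0.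
by rewrite expn_eq0 eqn0Ngt (ltnW p1).
Qed.

(* p l(T) = l(T^p) + p T *)
Lemma l_coef_rec m : p%:R != 0 :> F -> p%:R * @l_coef F p m =
  (if (p %| m)%N then @l_coef F p (m %/ p) else 0) + (if m == 1%N then p%:R else 0).
Proof.
move=> pF; have p0 : (0 < p)%N := ltnW p1.
have [l0|/l_coef_neq0[k ->]] := eqVneq (@l_coef F p m) 0; last first.
  rewrite l_coef_pow; case: k => [|k].
    by rewrite expn0 eqxx dvdn1 (gtn_eqF p1) add0r invr1 mulr1.
  rewrite expnS dvdn_mulr // mulKn // l_coef_pow muln_eq1 (gtn_eqF p1) addr0.
  by rewrite exprS invfM mulrA divff // mul1r.
rewrite l0 mulr0; case: eqP => [m1|_].
  have := l_coef_pow 0; rewrite expn0 -m1 l0 => /esym/eqP.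
  by rewrite invr_eq0 expf_eq0.
case: ifP => [pm|_]; last by rewrite addr0.
have [->|/l_coef_neq0[k mk]] := eqVneq (@l_coef F p (m %/ p)) 0; first by rewrite addr0.
have mE : m = (p ^ k.+1)%N by rewrite expnS -mk mulnC divnK.
by move/eqP: l0; rewrite mE l_coef_pow invr_eq0 expf_eq0 (negPf pF) andbF.
Qed.

End LogCoefficients.

Section Dwork.
Context {R : realType} {F : fieldType}.
Variables (abs : F -> R) (absP : nonarch_abs abs).
Variables (p : nat) (p_prime : prime p) (absp : abs p%:R = p%:R^-1).
Hypothesis frobenius : forall x, abs x <= 1 -> abs (x ^+ p - x) <= p%:R^-1.

Let q : R := p%:R^-1.
Let q0 : 0 < q := inv_p_gt0 p_prime.
Let q1 : q < 1 := inv_p_lt1 p_prime.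
Let p_gt1 : (1 < p)%N := prime_gt1 p_prime.
Let pF : p%:R != 0 :> F.
Proof. by rewrite -(abs_gt0 absP) absp. Qed.

Definition poly_le (P : {poly F}) (r : R) : Prop := forall i, abs P`_i <= r.

Lemma poly_leD P Q r : poly_le P r -> poly_le Q r -> poly_le (P + Q) r.
Proof. by move=> Pr Qr i; rewrite coefD; apply: absD_le. Qed.

Lemma poly_leM P Q r s : 0 <= r -> 0 <= s ->
  poly_le P r -> poly_le Q s -> poly_le (P * Q) (r * s).
Proof.
move=> r0 s0 Pr Qs i; rewrite coefM; apply: abs_sum_le => // [|j _].
  exact: mulr_ge0.
by rewrite absM //; apply: ler_pM; rewrite ?abs_ge0.
Qed.

Lemma poly_leX P n : poly_le P 1 -> poly_le (P ^+ n) 1.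
Proof.
move=> P1; elim: n => [|n IHn].
  by move=> i; rewrite coef1 abs_nat.
by rewrite exprS -[1%R]mulr1; apply: poly_leM.
Qed.

Lemma poly_le_sum (I : Type) (s : seq I) (A : pred I) (P : I -> {poly F}) r :
  0 <= r -> (forall i, A i -> poly_le (P i) r) -> poly_le (\sum_(i <- s | A i) P i) r.
Proof. by move=> r0 Pr k; rewrite coef_sum; apply: abs_sum_le => // i /Pr. Qed.

Lemma abs_pmuln n : (p %| n)%N -> abs n%:R <= q.
Proof.
move=> /dvdnP[k ->]; rewrite natrM absM // absp ler_piMl ?abs_nat //; exact: ltW.
Qed.

Lemma frobenius_poly P : poly_le P 1 -> poly_le (P ^+ p - (P \Po 'X^p)) q.
Proof.
have p0 : (0 < p)%N := ltnW p_gt1.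
elim/poly_ind: P => [|P c IHP] Pc.
  by move=> i; rewrite comp_poly0 expr0n gtn_eqF // subrr coef0 abs0 // ltW.
have P1 : poly_le P 1.
  by move=> i; have := Pc i.+1; rewrite coefD coefMX coefC /= addr0.
have c1 : abs c <= 1 by have := Pc 0%N; rewrite coefD coefMX coefC /= add0r.
rewrite comp_poly_MXaddC exprDn.
pose rest := \sum_(i < p.-1) ((P * 'X) ^+ (p - i.+1) * c%:P ^+ i.+1) *+ 'C(p, i.+1).
have -> : \sum_(i < p.+1) ((P * 'X) ^+ (p - i) * c%:P ^+ i) *+ 'C(p, i)
    = (P * 'X) ^+ p + rest + c%:P ^+ p.
  rewrite big_ord_recr /= subnn expr0 mul1r binn mulr1n; congr (_ + _).
  rewrite -(big_mkord xpredT (fun i => ((P * 'X) ^+ (p - i) * c%:P ^+ i) *+ 'C(p, i))).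
  by rewrite big_ltn // big_add1 big_mkord subn0 expr0 mulr1 bin0 mulr1n.
have -> : (P * 'X) ^+ p + rest + c%:P ^+ p - ((P \Po 'X^p) * 'X^p + c%:P)
    = (P ^+ p - (P \Po 'X^p)) * 'X^p + rest + (c ^+ p - c)%:P.
  by rewrite exprMn polyCB polyC_exp; ring.
apply: poly_leD; first apply: poly_leD.
- by move=> i; rewrite coefMXn; case: ifP => _; [rewrite abs0 // ltW|apply: IHP].
- apply: poly_le_sum => [|i _]; first exact: ltW.
  rewrite -mulr_natr -[q]mul1r; apply: poly_leM => //; first exact: ltW.
    rewrite -[1%R]mulr1; apply: poly_leM => //; apply: poly_leX.
      by move=> j; rewrite coefMX; case: ifP => _; rewrite ?abs0.
    by move=> j; rewrite coefC; case: ifP => _; rewrite ?abs0.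
  move=> j; rewrite -polyC_natr coefC; case: ifP => _; last by rewrite abs0 // ltW.
  apply/abs_pmuln/prime_dvd_bin => //=; have := ltn_ord i; lia.
- by move=> i; rewrite coefC; case: ifP => _; [apply: frobenius|rewrite abs0 // ltW].
Qed.

Lemma coef_expDXn (B : {poly F}) c m : (0 < m)%N -> B`_0 = 1 ->
  ((B + c *: 'X^m) ^+ p)`_m = (B ^+ p)`_m + p%:R * c.
Proof.
move=> m0 B0; rewrite exprDn.
rewrite -(big_mkord xpredT (fun i => (B ^+ (p - i) * (c *: 'X^m) ^+ i) *+ 'C(p, i))).
rewrite big_ltn // big_ltn ?ltnS ?(ltnW p_gt1) // !coefD coef_sum.
rewrite [X in _ + (_ + X)]big1_seq ?addr0 => [|i].
  rewrite subn0 expr0 mulr1 bin0 mulr1n expr1 bin1; congr (_ + _).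
  rewrite coefMn -scalerAr coefZ coefMXn ltnn subnn.
  suff -> : (B ^+ (p - 1))`_0 = 1 by rewrite mulr1 mulr_natl.
  by elim: (p - 1)%N => [|k IHk]; rewrite ?coef1 // exprS coef0M IHk B0 mulr1.
rewrite mem_index_iota => /= /andP[i2 _].
rewrite coefMn (@coefM_small _ 0 m.+1) ?mul0rn // => j jm.
rewrite exprZn coefZ -exprM coefXn; case: eqP => [jE|]; last by rewrite mulr0.
by move: jm; rewrite jE; nia.
Qed.

(* Comparing the coefficients of T^m in E(T)^p = E(T^p) exp(pT), where E = exp l:
   both sides agree modulo p up to the term p E_m. *)
Lemma artin_hasse_integral m : abs (fps_exp (@l_coef F p) m) <= 1.
Proof.
have p0 : (0 < p)%N := ltnW p_gt1.
have fu n : n`!%:R != 0 :> F := fact_neq0 p_prime absP absp n.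
have l0 := @l_coef0 F p p_prime.
pose E := fps_exp (@l_coef F p).
elim/ltn_ind: m => m IHm; have [->|m0] := posnP m; first by rewrite fps_exp_0 abs1.
pose B := \poly_(j < m) E j.
have B1 : poly_le B 1.
  by move=> j; rewrite coef_poly; case: ifP => [/IHm //|_]; rewrite abs0.
have AE : \poly_(j < m.+1) E j = B + E m *: 'X^m.
  apply/polyP => j; rewrite coefD coefZ coefXn !coef_poly ltnS.
  by case: ltngtP => [||->]; rewrite ?mulr0 ?addr0 ?mulr1 ?add0r.
have EpE := fps_exp_natmul fu p l0 (ltnSn m).
pose g j : F := if j == 1%N then p%:R else 0.
have gE j : fps_exp g j = j`!%:R^-1 * p%:R ^+ j.
  case: j => [|j]; first by rewrite fps_exp_0 fact0 invr1 mul1r.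
  have gX : \poly_(i < j.+2) g i = p%:R *: 'X.
    apply/polyP => i; rewrite coefZ coefX coef_poly /g.
    by case: eqP => [->|_]; rewrite /= ?mulr1 ?mulr0 ?if_same.
  rewrite fps_expE coef_texp gX big_ord_recr big1 /= ?add0r => [|n _].
    by rewrite exprZn coefZ coefXn eqxx mulr1.
  by rewrite exprZn coefZ coefXn gtn_eqF ?ltn_ord // !mulr0.
move: EpE; rewrite AE coef_expDXn //; last by rewrite coef_poly m0 /E fps_exp_0.
rewrite (fps_exp_eq (g := fun j =>
  (if (p %| j)%N then @l_coef F p (j %/ p) else 0) + g j)); last first.
  by move=> j _; rewrite l_coef_rec.
rewrite fps_expD // ?dvdn0 ?div0n // big_ord_recr /= subnn fps_exp_0 mulr1.
rewrite fps_exp_subst // => eqE.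
have : abs (p%:R * E m) <= q.
  have -> : p%:R * E m = \sum_(j < m) fps_exp (fun j =>
        if (p %| j)%N then l_coef p (j %/ p) else 0) j * fps_exp g (m - j) +
      ((if (p %| m)%N then E (m %/ p)%N else 0) - (B ^+ p)`_m).
    by rewrite addrA eqE addrAC subrr add0r.
  apply: absD_le => //.
    apply: abs_sum_le => // [|j _]; first exact: ltW.
    rewrite absM // -[q]mul1r; apply: ler_pM; rewrite ?abs_ge0 //.
      rewrite fps_exp_subst //; case: ifP => _; last by rewrite abs0.
      by apply: IHm; apply: leq_ltn_trans (leq_div _ _) _.
    by rewrite gE; apply: abs_pX_fact => //; rewrite subn_gt0.
  rewrite absB_sym //; have := frobenius_poly B1 m.
  by rewrite coefB coef_comp_poly_Xn // coef_poly ltn_Pdiv.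
by rewrite absM // absp -/q ger_pMr.
Qed.

End Dwork.

Section PadicIntegers.
Context {R : realType} {F : fieldType}.
Variables (abs : F -> R) (p : nat) (p_prime : prime p) (padic : is_padic_field abs p).

Let absP : nonarch_abs abs := padic_abs padic.
Let absp : abs p%:R = p%:R^-1 := padic_absp padic.

Lemma abs_dvdn n k : (p ^ k %| n)%N -> abs n%:R <= p%:R ^- k.
Proof.
move=> /dvdnP[m ->]; rewrite natrM absM // natrX absX // absp exprVn.
by rewrite ler_piMl ?abs_nat // invr_ge0 exprn_ge0.
Qed.

Lemma padic_quotient_approx a b n : (0 < b)%N -> coprime b p ->
  exists m : nat, abs (a%:R / b%:R - m%:R) <= p%:R ^- n.
Proof.
move=> b0 bp; have [u v uv _] := egcdnP (p ^ n) b0; exists (u * a)%N.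
have cop : coprime b (p ^ n) by rewrite coprimeXr.
move: uv; rewrite (eqP cop) => uv.
have ab : abs b%:R = 1.
  by rewrite (abs_coprime p_prime) // -prime_coprime // coprime_sym.
have bF : b%:R != 0 :> F by rewrite -(abs_gt0 absP) ab.
have -> : a%:R / b%:R - (u * a)%:R = - (a * (v * p ^ n))%:R / b%:R :> F.
  apply: (mulIf bF); rewrite divfK // mulrBl divfK // -[X in X - _]mulr1.
  have -> : (u * a)%:R * b%:R = a%:R * (v * p ^ n + 1)%:R :> F.
    by rewrite -uv -!natrM; congr _%:R; lia.
  by rewrite [(_ + 1)%:R]natrD mulr1 natrM; ring.
by rewrite absM // absV // ab invr1 mulr1 absN // abs_dvdn // mulnA dvdn_mull.
Qed.

Lemma residueP n z : abs z <= 1 -> abs (z - (residue abs p n z)%:R) <= p%:R ^- n.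
Proof.
move=> z1; rewrite /residue; case: xgetP => [m _ //|nom].
have pn0 : 0 < p%:R ^- n :> R by rewrite invr_gt0 exprn_gt0 // ltr0n prime_gt0.
suff [m zm] : exists m : nat, abs (z - m%:R) <= p%:R ^- n by have := nom m.
have [x zx] := padic_dense padic z pn0.
suff [m xm] : exists m : nat, abs (ratr x - m%:R) <= p%:R ^- n.
  by exists m; apply: (absB_trans absP (ltW zx)).
have x1 : abs (ratr x) <= 1.
  rewrite -[ratr x](subKr z); apply: absB_le => //; apply: ltW.
  apply: lt_le_trans zx _; rewrite invf_le1 ?exprn_gt0 ?ltr0n ?prime_gt0 //.
  by rewrite exprn_ege1 // ler1n prime_gt0.
pose b := `|denq x|%N; have bE : denq x = b%:Z by rewrite gez0_abs // denq_ge0.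
have b0 : (0 < b)%N by rewrite absz_gt0 denq_neq0.
have bF : b%:R != 0 :> F by apply: natr_neq0 absP absp _ b0.
pose a := `|numq x|%N.
have xE : ratr x = (-1) ^+ (numq x < 0)%R * (a%:R / b%:R) :> F.
  by rewrite /ratr bE [X in X%:~R / _]intEsign rmorphMsign mulrA.
have ax1 : abs (a%:R / b%:R) <= 1.
  by move: x1; rewrite xE absM // absX // absN // abs1 // expr1n mul1r.
have bp : coprime b p.
  rewrite coprime_sym prime_coprime //; apply/negP => pb.
  have pa : ~~ (p %| a)%N.
    apply/negP => pa; have := coprime_num_den x; rewrite /coprime -/a -/b => /eqP g1.
    by have := dvdn_gcd p a b; rewrite g1 pa pb dvdn1 => /eqP p1; have := p_prime; rewrite p1.
  move: ax1; rewrite absM // absV // (abs_coprime p_prime absP absp pa) mul1r.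
  apply/negP; rewrite -ltNge invf_gt1 ?abs_gt0 //.
  by apply: le_lt_trans (inv_p_lt1 p_prime); rewrite -[p%:R^-1]expr1 exprVn abs_dvdn.
have [m am] := padic_quotient_approx a n b0 bp.
rewrite xE; case: (numq x < 0)%R; last by exists m; rewrite expr0 mul1r.
exists (m * (p ^ n - 1))%N; rewrite expr1 mulN1r.
have -> : - (a%:R / b%:R) - (m * (p ^ n - 1))%:R = - (a%:R / b%:R - m%:R) - (m * p ^ n)%:R :> F.
  rewrite mulnBr muln1 natrB; first by ring.
  by rewrite leq_pmulr // expn_gt0 prime_gt0.
by apply: absB_le; rewrite ?absN // abs_dvdn // dvdn_mull.
Qed.

Lemma padic_frobenius x : abs x <= 1 -> abs (x ^+ p - x) <= p%:R^-1.
Proof.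
move=> x1; have := residueP 1 x1; set m := residue _ _ _ _; rewrite expr1 => xm.
apply: (absB_trans absP (y := m%:R)); last by rewrite absB_sym.
apply: (absB_trans absP (y := m%:R ^+ p)).
  rewrite subrXX absM // -[X in _ <= X]mulr1; apply: ler_pM; rewrite ?abs_ge0 //.
  apply: abs_sum_le => // i _; rewrite (absM absP) !(absX absP).
  by rewrite mulr_ile1 ?exprn_ge0 ?exprn_ile1 ?abs_ge0 ?abs_nat.
rewrite -natrX -natrB; last by rewrite -{1}[m]expn1; case: m {xm} => // k; rewrite leq_pexp2l // prime_gt0.
rewrite -[p%:R^-1]expr1 exprVn abs_dvdn // expn1.
have := fermat_little m p_prime; move/eqP; rewrite eqn_mod_dvd //.
by rewrite -{1}[m]expn1; case: m {xm} => // k; rewrite leq_pexp2l // prime_gt0.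
Qed.

Lemma artin_hasse_fieldExt_integral (L : fieldExtType F) (absL : L -> R)
    (absLP : nonarch_abs absL) (abs_ext : forall x : F, absL x%:A = abs x) m :
  absL (fps_exp (@l_coef L p) m) <= 1.
Proof.
have -> : fps_exp (@l_coef L p) m = (fps_exp (@l_coef F p) m)%:A.
  rewrite -[_%:A]/(in_alg L _) -fps_exp_morph; apply: fps_exp_eq => j _.
  rewrite /l_coef rmorph_sum; apply: eq_bigr => k _.
  by rewrite fmorphV rmorphXn rmorph_nat.
rewrite abs_ext; apply: (artin_hasse_integral absP p_prime absp).
exact: padic_frobenius.
Qed.

End PadicIntegers.

Lemma fps_expN_integral (R : realType) (F : fieldType) (abs : F -> R)
    (absP : nonarch_abs abs) (fact_unit : forall n, n`!%:R != 0 :> F) (f : nat -> F) :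
  f 0%N = 0 -> (forall m, abs (fps_exp f m) <= 1) ->
  forall m, abs (fps_exp (fun j => - f j) m) <= 1.
Proof.
move=> f0 f1; elim/ltn_ind => -[_|m IHm]; first by rewrite fps_exp_0 abs1.
have := fps_expD fact_unit (f := f) (g := fun j => - f j) m.+1 f0.
rewrite f0 oppr0 => /(_ erefl).
rewrite (@fps_exp_eq _ _ (fun=> 0)) => [|j _]; last by rewrite subrr.
rewrite fps_exp_cst0 big_ord_recl fps_exp_0 mul1r subn0 => /esym/eqP.
rewrite addr_eq0 => /eqP ->; rewrite absN //; apply: abs_sum_le => // j _.
rewrite absM // mulr_ile1 ?abs_ge0 //; apply: IHm.
by rewrite lift0; have := ltn_ord j; lia.
Qed.

Section SubstPow.
Context {R : realType} {F : fieldType} {V : nafield R F}.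
Variables (mu : nat) (mu_gt0 : (0 < mu)%N).
Local Notation absP := (naabsP V).
Implicit Types f g : nat -> F.

Lemma subst_pow_mul f m : subst_pow mu f (Posz (mu * m)) = f m.
Proof. by rewrite /subst_pow dvdn_mulr // mulKn. Qed.

Lemma subst_pow_out f k : (forall m, k <> Posz (mu * m)) -> subst_pow mu f k = 0.
Proof.
move=> kP; case: k kP => // k kP /=; case: ifP => // /dvdnP[m km].
by case: (kP m); rewrite km mulnC.
Qed.

Lemma subst_powP (P : int -> F -> Prop) f :
  (forall m, P (Posz (mu * m)) (f m)) -> (forall k, (forall m, k <> Posz (mu * m)) -> P k 0) ->
  forall k, P k (subst_pow mu f k).
Proof.
move=> Pf P0 k; have [[m ->]|kP] := pselect (exists m, k = Posz (mu * m)).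
  by rewrite subst_pow_mul.
have k0 m : k <> Posz (mu * m) by move=> km; apply: kP; exists m.
by rewrite subst_pow_out //; apply: P0.
Qed.

Lemma hmul_subst_pow (a b : hser V) f g :
  hval a = subst_pow mu f -> hval b = subst_pow mu g ->
  hval (a * b) = subst_pow mu (fun m => \sum_(j < m.+1) f j * g (m - j)%N).
Proof.
move=> af bg; apply/funext; apply: (subst_powP (P := fun k v => hval (a * b) k = v)) => [m|k kP].
  apply: (has_sumE absP).
  have <- : \sum_(k <- [seq Posz (mu * j) | j <- iota 0 m.+1]) a k * b (Posz (mu * m) - k)
      = \sum_(j < m.+1) f j * g (m - j)%N.
    rewrite big_map -[X in \sum_(i <- X) _]/(index_iota 0 m.+1) big_mkord.
    apply: eq_bigr => j _; have jm : (j <= m)%N by rewrite -ltnS ltn_ord.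
    by rewrite subzn ?leq_pmul2l // -mulnBr af bg !subst_pow_mul.
  apply: (has_sum_finite absP); first by rewrite map_inj_uniq ?iota_uniq // => i j []; nia.
  move=> k kS; rewrite af; have [[j kj]|kP] := pselect (exists j, k = Posz (mu * j)); last first.
    by rewrite subst_pow_out ?mul0r // => j kj; apply: kP; exists j.
  rewrite kj bg mulrC subst_pow_out ?mul0r // => i ij.
  by move: kS; rewrite kj map_f // mem_iota; nia.
apply: (has_sumE absP).
have := @has_sum_finite _ _ V absP [::] (fun l => a l * b (k - l)).
rewrite big_nil; apply => // l _; rewrite af bg.
have [[j lj]|lP] := pselect (exists j, l = Posz (mu * j)); last first.
  by rewrite subst_pow_out ?mul0r // => j lj; apply: lP; exists j.
rewrite mulrC subst_pow_out ?mul0r // => i ij; apply: (kP (i + j)%N).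
by rewrite mulnDr; lia.
Qed.

Lemma subst_pow_exprn (x : hser V) f n : hval x = subst_pow mu f ->
  hval (x ^+ n) = subst_pow mu (fun m => ((\poly_(j < m.+1) f j) ^+ n)`_m).
Proof.
move=> xf; elim: n => [|n IHn].
  apply/funext; rewrite expr0 hval1.
  apply: (subst_powP (P := fun k v => mono 0 k = v)) => [m|k kP]; rewrite /mono.
    by rewrite coef1 -(muln0 mu) eqz_nat eqn_pmul2l.
  by case: eqP => // k0; case: (kP 0%N); rewrite muln0.
rewrite exprS (hmul_subst_pow xf IHn); congr subst_pow; apply/funext => m.
rewrite exprS coefM; apply: eq_bigr => j _; have := ltn_ord j => jm.
rewrite coef_poly jm; congr (_ * _); apply: (@coefX_eq _ (m - j).+1) => // i im.
by rewrite !coef_poly im ifT //; lia.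
Qed.

Variables (p : nat) (p_prime : prime p) (absp : V p%:R = p%:R^-1).

Lemma hexp_subst_pow (x : hser V) f : f 0%N = 0 -> hval x = subst_pow mu f ->
  hle x (@exp_radius R p) -> hval (hexp x) = subst_pow mu (fps_exp f).
Proof.
move=> f0 xf xr; have texpE N k : (texp N x) k =
    subst_pow mu (fun m => \sum_(n < N) n`!%:R^-1 * ((\poly_(j < m.+1) f j) ^+ n)`_m) k.
  rewrite hval_sum.
  under eq_bigr do rewrite hvalZ (subst_pow_exprn _ xf).
  have [[m ->]|kP] := pselect (exists m, k = Posz (mu * m)).
    by rewrite subst_pow_mul; apply: eq_bigr => n _; rewrite subst_pow_mul.
  have k0 m : k <> Posz (mu * m) by move=> km; apply: kP; exists m.
  by rewrite subst_pow_out // big1 // => n _; rewrite subst_pow_out ?mulr0.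
apply/funext => k; apply/eqP; rewrite -subr_eq0; apply/eqP.
apply: (abs_eps_eq0 absP) => e e0.
have [N xN] := hexp_cvg p_prime absp xr e0.
have [M kM] : exists M, forall n, (M <= n)%N -> (texp n x) k = subst_pow mu (fps_exp f) k.
  have [[m ->]|kP] := pselect (exists m, k = Posz (mu * m)); last first.
    by exists 0%N => n _; rewrite texpE !subst_pow_out // => m km; apply: kP; exists m.
  exists m.+1 => n mn; rewrite texpE !subst_pow_mul fps_expE coef_texp.
  rewrite [RHS](big_ord_widen n (fun i => i`!%:R^-1 * ((\poly_(j < m.+1) f j) ^+ i)`_m)) //.
  rewrite [RHS]big_mkcond; apply: eq_bigr => i _; case: ltnP => // im.
  by rewrite coefX_small ?mulr0 // coef_poly /= f0.
rewrite -(kM (maxn N M)) ?leq_maxr // (absB_sym absP).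
by have := xN (maxn N M) (leq_maxl _ _) k.
Qed.

End SubstPow.

(** * The groups Gamma and Gamma_A *)

Section GammaGroup.
Context {R : realType} {F : fieldType} {V : nafield R F}.
Implicit Types (x y : hser V) (rho eps : R).
Local Notation absP := (naabsP V).

Definition wt rho (k : int) : R := if k is Posz m then rho ^+ m else 1.

Lemma wt_ge0 rho k : 0 <= rho -> 0 <= wt rho k.
Proof. by case: k => k r0 //=; apply: exprn_ge0. Qed.

Lemma wt_le1 rho k : 0 <= rho <= 1 -> wt rho k <= 1.
Proof. by case: k => k /andP[r0 r1] //=; apply: exprn_ile1. Qed.

Lemma wt_le rho k : 0 <= rho <= 1 -> 0 < k -> wt rho k <= rho.
Proof.
case: k => [[|k]|k] // /andP[r0 r1] _ /=.
by rewrite exprS ler_piMr // exprn_ile1.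
Qed.

Lemma wt_anti rho k l : 0 <= rho <= 1 -> k <= l -> wt rho l <= wt rho k.
Proof.
case: k l => k [] l //= /andP[r0 r1]; first by rewrite lez_nat => kl; apply: ler_wiXn2l.
by move=> _; apply: exprn_ile1.
Qed.

Lemma wtM rho k l : 0 <= rho <= 1 -> wt rho k * wt rho l <= wt rho (k + l).
Proof.
move=> rho01; have /andP[r0 r1] := rho01.
have half (i : int) m : wt rho i <= 1 -> wt rho m * wt rho i <= wt rho m.
  by move=> i1; apply: ler_piMr => //; apply: wt_ge0.
case: k l => k [] l.
- by rewrite /= exprD.
- apply: le_trans (half _ _ (wt_le1 _ rho01)) _; apply: wt_anti => //; lia.
- rewrite mulrC; apply: le_trans (half _ _ (wt_le1 _ rho01)) _; apply: wt_anti => //; lia.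
- by rewrite /= mulr1.
Qed.

(* As 0 ^ 0 = 1, [gam 0 x] says that the coefficients of [x] in positive degrees
   vanish. *)
Definition gam rho x : Prop := (forall k, V (x k) <= wt rho k) /\ V (x 0) = 1.

Lemma gam_mono rho rho' x : 0 <= rho -> rho <= rho' -> gam rho x -> gam rho' x.
Proof.
move=> r0 rr' [xw x0]; split=> // k; apply: le_trans (xw k) _.
by case: k => k //=; apply: lerXn2r; rewrite ?nnegrE // (le_trans r0).
Qed.

Lemma gam_hle rho x : 0 <= rho <= 1 -> gam rho x -> hle x 1.
Proof. by move=> r [xw _] k; apply: le_trans (xw k) (wt_le1 k r). Qed.

Lemma conv_except x y n l :
  has_sum V (fun k => if k == l then 0 else x k * y (n - k)) ((x * y) n - x l * y (n - l)).
Proof.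
have := has_sumD absP (hmulP n (hvalP x) (hvalP y))
  (@has_sum_finite _ _ V absP [:: l] (fun k => if k == l then - (x k * y (n - k)) else 0) _ _).
rewrite big_seq1 eqxx.
have -> : (fun k => x k * y (n - k) + (if k == l then - (x k * y (n - k)) else 0))
    = (fun k => if k == l then 0 else x k * y (n - k)).
  by apply/funext => k; case: eqP => _; rewrite ?subrr ?addr0.
by apply=> // k; rewrite inE => /negPf ->.
Qed.

Lemma conv_except_le x y n l r : 0 <= r ->
  (forall k, k != l -> V (x k) * V (y (n - k)) <= r) ->
  V ((x * y) n - x l * y (n - l)) <= r.
Proof.
move=> r0 xy; apply: (has_sum_le absP _ (conv_except x y n l)) => k.
by case: eqP => [_|/eqP kl]; rewrite ?(abs0 absP) ?(absM absP) ?xy.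
Qed.

Lemma gam1 rho : 0 <= rho -> gam rho 1.
Proof.
move=> r0; split=> [k|]; rewrite hval1 /mono ?eqxx ?(abs1 absP) //.
by case: eqP => [->|_]; rewrite ?(abs1 absP) ?(abs0 absP) ?wt_ge0.
Qed.

Lemma gamM rho x y : 0 <= rho < 1 -> gam rho x -> gam rho y -> gam rho (x * y).
Proof.
move=> /andP[r0 r1] [xw x0] [yw y0]; have r01 : 0 <= rho <= 1 by rewrite r0 ltW.
have xyw k l : V (x k) * V (y l) <= wt rho k * wt rho l.
  by apply: ler_pM; rewrite ?(abs_ge0 absP).
split=> [n|].
  apply: (has_sum_le absP _ (hmulP n (hvalP x) (hvalP y))) => k.
  rewrite (absM absP); apply: le_trans (xyw _ _) _.
  by rewrite -{2}[n](subrKC k) wtM.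
have rest : V ((x * y) 0 - x 0 * y (0 - 0)) <= rho.
  apply: conv_except_le => // k k0; apply: le_trans (xyw _ _) _; rewrite sub0r.
  have [kpos|kneg] : 0 < k \/ 0 < - k by move: k0; lia.
    rewrite -[X in _ <= X]mulr1; apply: ler_pM; rewrite ?wt_ge0 //.
      exact: wt_le.
    exact: wt_le1.
  rewrite -[X in _ <= X]mul1r; apply: ler_pM; rewrite ?wt_ge0 //.
    exact: wt_le1.
  exact: wt_le.
rewrite -[(x * y) 0](subrK (x 0 * y (0 - 0))) addrC subr0 abs_lead.
- by rewrite (absM absP) x0 y0 mulr1.
- exact: absP.
rewrite (absM absP) x0 y0 mulr1; apply: le_lt_trans r1.
by move: rest; rewrite subr0.
Qed.

(* The coefficients of an element of H are small in large degrees, so estimates of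
   them can be proved by descending induction on the degree. *)
Lemma descending_ind y (B : int -> R) :
  (exists N : nat, forall k : int, N%:Z <= k -> V (y k) <= B k) ->
  (forall i, (forall j, i < j -> V (y j) <= B j) -> V (y i) <= B i) ->
  forall i, V (y i) <= B i.
Proof.
move=> [N yN] step i.
suff: forall m : nat, forall j, N%:Z - m%:Z <= j -> V (y j) <= B j.
  by move=> h; apply: (h (absz (N%:Z - i))); lia.
elim=> [|m IHm] j jm; first by apply: yN; lia.
by apply: step => l jl; apply: IHm; lia.
Qed.

(* Any bound M >= 1 of [y] can be improved to max(1, rho M). *)
Lemma gam_inv_le1 rho x y : 0 <= rho < 1 -> gam rho x -> x * y = 1 -> hle y 1.
Proof.
move=> /andP[r0 r1] [xw x0] xy; have r01 : 0 <= rho <= 1 by rewrite r0 ltW.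
have x1 k : V (x k) <= 1 := le_trans (xw k) (wt_le1 k r01).
have improve M : 1 <= M -> hle y M -> hle y (Num.max 1 (rho * M)).
  move=> M1 yM; have B1 : 1 <= Num.max 1 (rho * M) by rewrite le_max lexx.
  have B0 : 0 <= Num.max 1 (rho * M) := le_trans ler01 B1.
  apply: (descending_ind (B := fun=> Num.max 1 (rho * M))) => [|i yi].
    by apply: H_small (hvalP y) _ _; apply: lt_le_trans ltr01 B1.
  have rest : V ((x * y) i - x 0 * y (i - 0)) <= Num.max 1 (rho * M).
    apply: conv_except_le => // k k0.
    have [kpos|kneg] : 0 < k \/ k < 0 by move: k0; lia.
      apply: le_trans (_ : rho * M <= _); last by rewrite le_max lexx orbT.
      by apply: ler_pM; rewrite ?(abs_ge0 absP) ?yM // (le_trans (xw k)) ?wt_le.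
    rewrite -[X in _ <= X]mul1r; apply: ler_pM; rewrite ?(abs_ge0 absP) ?x1 //.
    by apply: yi; lia.
  have -> : V (y i) = V (x 0 * y i) by rewrite (absM absP) x0 mul1r.
  move: rest; rewrite subr0 -(absB_sym absP) => rest.
  rewrite -[x 0 * y i](subrK ((x * y) i)); apply: (absD_le absP) => //.
  by rewrite xy; apply: le_trans (hle1 i) B1.
have [M M1 yM] := hle_bound y.
have yr n : hle y (Num.max 1 (rho ^+ n * M)).
  elim: n => [|n IHn]; first by rewrite expr0 mul1r; apply: hle_trans yM _; rewrite le_max lexx orbT.
  have := improve (Num.max 1 (rho ^+ n * M)); rewrite le_max lexx => /(_ erefl IHn).
  move=> h; apply: hle_trans h _; rewrite ge_max le_max lexx /=.
  rewrite maxr_pMr // ge_max mulr1 !le_max (ltW r1) /=.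
  by rewrite exprS mulrA lexx orbT.
move=> k; apply: (abs_le_eps) => e e0.
have eM : 0 < e / M by rewrite divr_gt0 //; lra.
have [|N rN] := small_expr (q := rho) _ eM; first by rewrite r0.
apply: le_trans (yr N k) _; rewrite ge_max; apply/andP; split; first by lra.
have := rN N (leqnn N); rewrite ler_pdivlMr; last by lra.
by move=> h; apply: le_trans h _; lra.
Qed.

Lemma gam_inv rho x y : 0 < rho < 1 -> gam rho x -> x * y = 1 -> gam rho y.
Proof.
move=> /andP[r0 r1] gx xy; have r01 : 0 <= rho <= 1 by rewrite !ltW.
have y1 : hle y 1 by apply: gam_inv_le1 gx xy; rewrite ltW.
have [xw x0] := gx; pose w k (i : int) : R := if i is Posz m then rho ^+ (minn m k) else 1.
have yw k : forall i, V (y i) <= w k i.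
  elim: k => [|k IHk]; first by case=> m; rewrite /= ?minn0; apply: y1.
  apply: descending_ind => [|i yi].
    have [|N yN] := H_small (hvalP y) (eps := rho ^+ k.+1); first exact: exprn_gt0.
    exists N => -[] // m Nm; apply: le_trans (yN _ Nm) _ => /=.
    by apply: ler_wiXn2l; rewrite ?ltW // geq_minr.
  have [ineg|ipos] := leP i 0.
    by apply: le_trans (y1 i) _; case: i ineg {yi} => [[|i]|i] //= _; rewrite ?min0n.
  have -> : V (y i) = V ((x * y) i - x 0 * y (i - 0)).
    rewrite xy hval1 /mono gt_eqF // sub0r subr0 (absN absP) (absM absP) x0.
    by rewrite mul1r.
  case: i ipos yi => // m m0 yi.
  apply: conv_except_le => [|l l0]; first by rewrite /= exprn_ge0 // ltW.
  have [lpos|lneg] : 0 < l \/ l < 0 by move: l0; lia.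
    have := xw l; have := IHk (Posz m - l).
    case: l lpos {l0} => // l l0 yl xl.
    have [lm|ml] := leqP l m.
      apply: (@le_trans _ _ (rho ^+ l * rho ^+ minn (m - l) k)).
        apply: ler_pM; rewrite ?(abs_ge0 absP) //.
        by move: yl; rewrite subzn.
      by rewrite -exprD /=; apply: ler_wiXn2l; rewrite ?ltW //; move: l0; lia.
    apply: (@le_trans _ _ (rho ^+ l * 1)).
      by apply: ler_pM; rewrite ?(abs_ge0 absP) ?y1.
    by rewrite mulr1 /=; apply: ler_wiXn2l; rewrite ?ltW //; lia.
  rewrite -[X in _ <= X]mul1r; apply: ler_pM; rewrite ?(abs_ge0 absP) //.
    by apply: le_trans (xw l) (wt_le1 l r01).
  apply: le_trans (yi _ _) _; first by lia.
  case: l lneg {l0} => // l _; rewrite NegzE opprK -PoszD /=.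
  by apply: ler_wiXn2l; rewrite ?ltW //; lia.
have yw' i : V (y i) <= wt rho i.
  by case: i => i; [have := yw i i; rewrite /= minnn|apply: y1].
split=> //.
have rest : V ((x * y) 0 - x 0 * y (0 - 0)) <= rho.
  apply: conv_except_le => [|k k0]; first exact: ltW.
  rewrite sub0r; have [kpos|kneg] : 0 < k \/ 0 < - k by move: k0; lia.
    rewrite -[X in _ <= X]mulr1; apply: ler_pM; rewrite ?(abs_ge0 absP) ?y1 //.
    by apply: le_trans (xw k) _; apply: wt_le.
  rewrite -[X in _ <= X]mul1r; apply: ler_pM; rewrite ?(abs_ge0 absP) //.
    by apply: le_trans (xw k) (wt_le1 k r01).
  by apply: le_trans (yw' _) _; apply: wt_le.
have -> : V (y 0) = V (x 0 * y 0) by rewrite (absM absP) x0 mul1r.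
rewrite -[x 0 * y 0](subKr ((x * y) 0)) xy hval1 /mono eqxx abs_lead.
- by rewrite (abs1 absP).
- exact: absP.
rewrite (absN absP) (abs1 absP); apply: le_lt_trans r1.
by move: rest; rewrite xy subr0 hval1 /mono eqxx.
Qed.

Lemma gam0_inv x y : gam 0 x -> x * y = 1 -> gam 0 y.
Proof.
move=> gx xy; have gy rho : 0 < rho < 1 -> gam rho y.
  move=> r; apply: gam_inv (r) _ xy; apply: gam_mono gx => //.
  by case/andP: r => /ltW.
have half : (0 < 2^-1 :> R) && (2^-1 < 1 :> R) by rewrite invr_gt0 invf_lt1 ?ltr0n ?ltr1n.
have [yw y0] := gy _ half; split=> // -[[|m]|m].
- by rewrite y0.
- rewrite /= expr0n /=; apply: abs_le_eps => e e0; rewrite add0r.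
  have e01 : 0 < Num.min e 2^-1 < 1.
    by rewrite lt_min e0 gt_min; case/andP: half => -> ->; rewrite orbT.
  have [/(_ (Posz m.+1)) ym _] := gy _ e01; apply: le_trans ym _.
  apply: le_trans (wt_le _ _) _ => //; last by rewrite ge_min lexx.
  by case/andP: e01 => /ltW -> /ltW ->.
- by have := yw (Negz m).
Qed.

Lemma hnorm_le x r : hle x r -> hnorm V x <= r.
Proof.
move=> xr; apply: sup_le_ub; first by exists (V (x 0)), 0.
by move=> _ [k _ <-].
Qed.

Lemma hnorm_ub x k : V (x k) <= hnorm V x.
Proof.
have [r _ xr] := hle_bound x.
apply: sup_upper_bound; last by exists k.
by split; [exists (V (x 0)), 0|exists r => _ [l _ <-]].
Qed.

Lemma Gamma_rhoP rho x : 0 <= rho <= 1 ->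
  Gamma_rho V rho x <-> gam rho x /\ exists y, x * y = 1.
Proof.
move=> r01; split.
  move=> [[_ [y Hy xy]] x1 x0 xr]; split; last first.
    by exists (HSer Hy); apply: hser_ext => k; rewrite hval_mul /= xy.
  split=> // -[[|m]|m]; first by rewrite x0.
    exact: xr.
  by apply: le_trans (hnorm_ub x _) _; rewrite x1.
move=> [gx [y xy]]; have [xw x0] := gx; split=> //.
- split; first exact: hvalP.
  by exists y; [exact: hvalP|rewrite -hval_mul xy].
- apply/eqP; rewrite eq_le; apply/andP; split; first exact/hnorm_le/(gam_hle r01).
  by have := hnorm_ub x 0; rewrite x0.
Qed.

Lemma GammaP x : Gamma V x <->
  exists2 rho, 0 < rho < 1 & gam rho x /\ exists y, x * y = 1.
Proof.
split.
  move=> [rho /andP[r0 r1] /Gamma_rhoP]; rewrite r0 (ltW r1) => /(_ erefl) [gx ux].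
  exists (Num.max rho 2^-1).
    by rewrite lt_max gt_max r1 /=; apply/andP; split; [apply/orP; right|]; lra.
  by split=> //; apply: gam_mono gx => //; rewrite le_max lexx.
move=> [rho /andP[r0 r1] gx]; exists rho; first by rewrite /= ltW.
by apply/Gamma_rhoP => //; rewrite !ltW.
Qed.

Lemma GammaM x y : Gamma V x -> Gamma V y -> Gamma V (x * y).
Proof.
move=> /GammaP[r r01 [gx [x' xx']]] /GammaP[s s01 [gy [y' yy']]].
have [/andP[r0 r1] /andP[s0 s1]] := (r01, s01).
apply/GammaP; exists (Num.max r s); first by rewrite lt_max r0 gt_max r1.
split; last by exists (x' * y'); rewrite mulrACA xx' yy' mulr1.
apply: gamM; first by rewrite le_max (ltW r0) gt_max r1.
  by apply: gam_mono gx; rewrite ?(ltW r0) // le_max lexx.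
by apply: gam_mono gy; rewrite ?(ltW s0) // le_max lexx orbT.
Qed.

Lemma Gamma_inv x y : Gamma V x -> x * y = 1 -> Gamma V y.
Proof.
move=> /GammaP[r r01 [gx _]] xy; apply/GammaP; exists r => //.
by split; [apply: gam_inv gx xy|exists x; rewrite mulrC].
Qed.

Lemma Gamma0_Gamma x : Gamma_rho V 0 x -> Gamma V x.
Proof. by exists 0 => //=; rewrite lexx ltr01. Qed.

Lemma Gamma1 : Gamma V (1 : hser V).
Proof.
by apply/Gamma0_Gamma/Gamma_rhoP; [rewrite lexx ler01|split; [apply: gam1|exists 1; rewrite mulr1]].
Qed.

Lemma Gamma0M x y : Gamma_rho V 0 x -> Gamma_rho V 0 y -> Gamma_rho V 0 (x * y).
Proof.
have r01 : 0 <= (0 : R) <= 1 by rewrite lexx ler01.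
move=> /(Gamma_rhoP _ r01)[gx [x' xx']] /(Gamma_rhoP _ r01)[gy [y' yy']].
apply/(Gamma_rhoP _ r01); split; first by apply: gamM => //; rewrite lexx ltr01.
by exists (x' * y'); rewrite mulrACA xx' yy' mulr1.
Qed.

Lemma Gamma0_inv x y : Gamma_rho V 0 x -> x * y = 1 -> Gamma_rho V 0 y.
Proof.
have r01 : 0 <= (0 : R) <= 1 by rewrite lexx ler01.
move=> /(Gamma_rhoP _ r01)[gx _] xy; apply/(Gamma_rhoP _ r01).
by split; [apply: gam0_inv gx xy|exists x; rewrite mulrC].
Qed.

End GammaGroup.

Section Classes.
Context {R : realType} {F : fieldType} {V : nafield R F}.
Variables (A : set (int -> F)) (A_subalg : subalgebra V A).
Implicit Types (x y a b h t : hser V) (eps : R).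
Local Notation absP := (naabsP V).

Definition clA x : Prop := forall eps, 0 < eps -> exists2 a : hser V, A a & hle (x - a) eps.

Lemma A_anP x : A_an V A x <-> clA x.
Proof.
split=> [[_ xA] e /xA[a [Aa Ha ax]]|xA].
  exists (HSer Ha) => // k; apply: ltW; apply: le_lt_trans ax.
  exact: (hnorm_ub (x - HSer Ha)).
split; first exact: hvalP.
move=> e e0; have [|a Aa ax] := xA (e / 2); first by rewrite divr_gt0.
exists a; split=> //; first exact: hvalP.
by apply: le_lt_trans (hnorm_le ax) _; lra.
Qed.

Lemma clA_lim x : (forall eps, 0 < eps -> exists2 b, clA b & hle (x - b) eps) -> clA x.
Proof.
move=> xA e e0; have [b bA xb] := xA e e0; have [a Aa ba] := bA e e0.
by exists a => //; apply: hleB_trans xb ba.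
Qed.

Lemma clA_sub a : A a -> clA a.
Proof. by move=> Aa e e0; exists a => //; rewrite subrr; apply/hle0/ltW. Qed.

Lemma clA1 : clA 1.
Proof. exact/clA_sub/(subalg1 A_subalg). Qed.

Lemma clAD x y : clA x -> clA y -> clA (x + y).
Proof.
move=> xA yA e e0; have [a Aa xa] := xA e e0; have [b Ab yb] := yA e e0.
exists (a + b); first exact: (subalgD A_subalg).
by rewrite opprD addrACA; apply: hleD.
Qed.

Lemma clAZ c x : clA x -> clA (c *: x).
Proof.
move=> xA e e0; have c1 : 0 < V c + 1 by have := abs_ge0 absP c; lra.
have [|a Aa xa] := xA (e / (V c + 1)); first by rewrite divr_gt0.
exists (c *: a); first exact: (subalgZ A_subalg).
rewrite -scalerBr; apply: hle_trans (hleZ c xa) _.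
by rewrite mulrA ler_pdivrMr // mulrC; apply: ler_wpM2l; [exact: ltW|lra].
Qed.

Lemma clAM x y : clA x -> clA y -> clA (x * y).
Proof.
move=> xA yA; have [r r1 xr] := hle_bound x; have [s s1 ys] := hle_bound y.
move=> e e0.
have [|a Aa xa] := xA (e / s); first by rewrite divr_gt0 //; lra.
have [t t1 at_] := hle_bound a.
have [|b Ab yb] := yA (e / t); first by rewrite divr_gt0 //; lra.
exists (a * b); first exact: (subalgM A_subalg).
apply: (hleB_trans (b := a * y)).
  by rewrite -mulrBl; apply: hle_trans (hleM xa ys) _; rewrite divfK // gt_eqF //; lra.
rewrite -mulrBr; apply: hle_trans (hleM at_ yb) _.
by rewrite mulrC divfK // gt_eqF //; lra.
Qed.

Lemma clAX x n : clA x -> clA (x ^+ n).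
Proof.
move=> xA; elim: n => [|n IHn]; first exact: clA1.
by rewrite exprS; apply: clAM.
Qed.

Lemma clA_sum n (u : nat -> hser V) : (forall i, clA (u i)) -> clA (\sum_(i < n) u i).
Proof.
move=> uA; elim: n => [|n IHn]; last by rewrite big_ord_recr; apply: clAD.
by rewrite big_ord0 -[0](scale0r (1 : hser V)); apply/clAZ/clA1.
Qed.

Lemma clA_exp p x : prime p -> V p%:R = p%:R^-1 ->
  hle x (@exp_radius R p) -> clA x -> clA (hexp x).
Proof.
move=> p_prime absp xr xA; apply: clA_lim => e e0.
have [N xN] := hexp_cvg p_prime absp xr e0.
exists (texp N x); last exact/hleB_sym/xN.
by apply: (@clA_sum N (fun n => n`!%:R^-1 *: x ^+ n)) => n; apply: clAZ; apply: clAX.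
Qed.

Definition trivial x : Prop := exists u v, [/\ x = u * v, Gamma V u, clA u,
  (exists2 b, clA b & u * b = 1) & Gamma_rho V 0 v].

Lemma Gamma_trivialP f : Gamma_trivial V A f <-> exists2 x, f = hval x & trivial x.
Proof.
split.
  move=> [u [[uA [b bA ub]] Gu] [v Gv <-]].
  have Hu : H V u by case: uA.
  have Hb : H V b by case: bA.
  have Hv : H V v by case: Gv => -[].
  exists (HSer Hu * HSer Hv); first by [].
  exists (HSer Hu), (HSer Hv); split=> //; first exact/A_anP.
  exists (HSer Hb); first exact/A_anP.
  by apply: hser_ext => k; rewrite hval_mul /= ub.
move=> [_ -> [u [v [-> Gu uA [b bA ub]] Gv]]].
exists u; last by exists v.
split=> //; split; first exact/A_anP.
by exists b; [exact/A_anP|rewrite -hval_mul ub].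
Qed.

Lemma trivial_val x : Gamma_trivial V A x <-> trivial x.
Proof.
split=> [/Gamma_trivialP[y xy]|xT]; last by apply/Gamma_trivialP; exists x.
by have -> : x = y by apply: hser_ext => k; rewrite xy.
Qed.

Lemma trivial1 : trivial 1.
Proof.
exists 1, 1; split; rewrite ?mulr1 //; [exact: Gamma1|exact: clA1| |].
  by exists 1; [exact: clA1|rewrite mulr1].
have r01 : 0 <= (0 : R) <= 1 by rewrite lexx ler01.
by apply/(Gamma_rhoP _ r01); split; [apply: gam1|exists 1; rewrite mulr1].
Qed.

Lemma trivialM x y : trivial x -> trivial y -> trivial (x * y).
Proof.
move=> [u [v [-> Gu uA [b bA ub] Gv]]] [u' [v' [-> Gu' uA' [b' bA' ub']] Gv']].
exists (u * u'), (v * v'); split; [by rewrite mulrACA|exact: GammaM|exact: clAM| |exact: Gamma0M].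
by exists (b * b'); [exact: clAM|rewrite mulrACA ub ub' mulr1].
Qed.

Lemma trivial_inv x : trivial x -> exists2 y, trivial y & x * y = 1.
Proof.
move=> [u [v [-> Gu uA [b bA ub] Gv]]].
have r01 : 0 <= (0 : R) <= 1 by rewrite lexx ler01.
have [_ [w vw]] := (Gamma_rhoP v r01).1 Gv.
exists (b * w); last by rewrite mulrACA ub vw mulr1.
exists b, w; split=> //; [exact: Gamma_inv ub| |exact: Gamma0_inv vw].
by exists u; rewrite // mulrC.
Qed.

Lemma gclassP h f : gclass V A h f <-> exists2 t, trivial t & f = hval (h * t).
Proof.
split=> [[_ /Gamma_trivialP[t -> tT] <-]|[t tT ->]]; first by exists t.
by exists t; first exact/trivial_val.
Qed.

Lemma gclass_mul h t : trivial t -> gclass V A (h * t) = gclass V A h.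
Proof.
move=> tT; have [t' tT' tt'] := trivial_inv tT.
apply/seteqP; split=> f /gclassP[s sT ->]; apply/gclassP.
  by exists (t * s); [exact: trivialM|rewrite mulrA].
exists (t' * s); first exact: trivialM.
by rewrite mulrA -[h * t * t']mulrA tt' mulr1.
Qed.

Lemma gclass_inj h h' : gclass V A h = gclass V A h' -> exists2 t, trivial t & h = h' * t.
Proof.
move=> hh'; have : gclass V A h h by apply/gclassP; exists 1; [exact: trivial1|rewrite mulr1].
rewrite hh' => /gclassP[t tT ht]; exists t => //.
by apply: hser_ext => k; rewrite ht.
Qed.

Lemma gclass1 : gclass V A (1 : hser V) = Gamma_trivial V A.
Proof.
apply/seteqP; split=> f.
  by move=> /gclassP[t tT ->]; rewrite mul1r; apply/trivial_val.
by move=> /Gamma_trivialP[t -> tT]; apply/gclassP; exists t; rewrite ?mul1r.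
Qed.

Lemma gclassM x y : set_hmul V (gclass V A x) (gclass V A y) = gclass V A (x * y).
Proof.
apply/seteqP; split=> f.
  move=> [_ /gclassP[s sT ->] [_ /gclassP[t tT ->] <-]]; apply/gclassP.
  by exists (s * t); [exact: trivialM|rewrite mulrACA].
move=> /gclassP[t tT ->]; exists (hval (x * 1)).
  by apply/gclassP; exists 1 => //; exact: trivial1.
exists (hval (y * t)); first by apply/gclassP; exists t.
by rewrite -hval_mul mulr1 mulrA.
Qed.

Lemma gclassX x n : gpow V A (gclass V A x) n = gclass V A (x ^+ n).
Proof.
elim: n => [|n IHn]; first by rewrite expr0 gclass1.
by rewrite /gpow iterS -/(gpow V A _ _) IHn gclassM exprS.
Qed.

End Classes.

Section Dilation.
Context {R : realType} {F : fieldType} {V : nafield R F}.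
Variables (z : F) (z1 : V z = 1).
Implicit Types (x y : hser V).
Local Notation absP := (naabsP V).

Let z0 : z != 0.
Proof. by rewrite -(abs_gt0 absP) z1. Qed.

Lemma abs_exprz (k : int) : V (z ^ k) = 1.
Proof.
case: k => k; rewrite /exprz; first by rewrite (absX absP) z1 expr1n.
by rewrite (absV absP) (absX absP) z1 expr1n invr1.
Qed.

Lemma abs_dil (a : int -> F) k : V (dil z a k) = V (a k).
Proof. by rewrite (absM absP) abs_exprz mul1r. Qed.

Lemma H_dil a : H V a -> H V (dil z a).
Proof.
move=> Ha; apply: HP => [|e /(H_small Ha)[N aN]].
  by have [M _ aM] := H_bound Ha; exists M => k; rewrite abs_dil.
by exists N => k /aN; rewrite abs_dil.
Qed.

Definition hdil x : hser V := HSer (H_dil (hvalP x)).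

Lemma hdilM x y : hdil (x * y) = hdil x * hdil y.
Proof.
apply: hser_ext => n; symmetry; apply: (has_sumE absP).
have := has_sumZ absP (z ^ n) (hmulP n (hvalP x) (hvalP y)).
congr (has_sum _ _ _); apply/funext => k /=; rewrite /dil mulrACA -expfzDr //.
by rewrite subrKC.
Qed.

Lemma hdil1 : hdil 1 = 1.
Proof.
apply: hser_ext => k /=; rewrite /dil /mono; case: eqP => [->|_]; last by rewrite mulr0.
by rewrite expr0z mulr1.
Qed.

Lemma gam_dil rho x : gam rho x -> gam rho (hdil x).
Proof. by move=> [xw x0]; split=> [k|]; rewrite abs_dil. Qed.

Lemma unit_dil x : (exists y, x * y = 1) -> exists y, hdil x * y = 1.
Proof. by move=> [y xy]; exists (hdil y); rewrite -hdilM xy hdil1. Qed.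

Lemma Gamma_dil x : Gamma V x -> Gamma V (hdil x).
Proof.
move=> /GammaP[r r01 [gx ux]]; apply/GammaP; exists r => //.
by split; [exact: gam_dil|exact: unit_dil].
Qed.

Lemma Gamma0_dil x : Gamma_rho V 0 x -> Gamma_rho V 0 (hdil x).
Proof.
have r01 : 0 <= (0 : R) <= 1 by rewrite lexx ler01.
move=> /(Gamma_rhoP _ r01)[gx ux]; apply/(Gamma_rhoP _ r01).
by split; [exact: gam_dil|exact: unit_dil].
Qed.

Variables (A : set (int -> F)) (A_dil : forall a, A a -> A (dil z a)).

Lemma clA_dil x : clA A x -> clA A (hdil x).
Proof.
move=> xA e /xA[a Aa xa]; exists (hdil a); first exact: A_dil.
move=> k; have := xa k; rewrite -abs_dil; congr (V _ <= _).
exact: mulrBr.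
Qed.

Lemma trivial_dil x : trivial A x -> trivial A (hdil x).
Proof.
move=> [u [v [-> Gu uA [b bA ub] Gv]]]; exists (hdil u), (hdil v).
split; [exact: hdilM|exact: Gamma_dil|exact: clA_dil| |exact: Gamma0_dil].
by exists (hdil b); [exact: clA_dil|rewrite -hdilM ub hdil1].
Qed.

End Dilation.

Lemma dil_gclass (R : realType) (F : fieldType) (V : nafield R F) (z : F)
    (z1 : V z = 1) (A : set (int -> F)) (h : hser V) : subalgebra V A ->
  dil z @` A = A -> dil z @` gclass V A h = gclass V A (hdil z1 h).
Proof.
move=> A_subalg A_dil; have z0 : z != 0 by rewrite -(abs_gt0 (naabsP V)) z1.
have zV1 : V z^-1 = 1 by rewrite (absV (naabsP V)) z1 invr1.
have dilK a : dil z (dil z^-1 a) = a.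
  by apply/funext => k; rewrite /dil mulrA exprz_inv -invr_expz mulfV ?mul1r // expfz_neq0.
have dilVK a : dil z^-1 (dil z a) = a.
  by apply/funext => k; rewrite /dil mulrA exprz_inv -invr_expz mulVf ?mul1r // expfz_neq0.
have dA a : A a -> A (dil z a) by move=> Aa; rewrite -A_dil; exists a.
have dVA a : A a -> A (dil z^-1 a) by rewrite -{1}A_dil => -[b Ab <-]; rewrite dilVK.
apply/seteqP; split=> f.
  move=> [_ /gclassP[t tT ->] <-]; apply/gclassP; exists (hdil z1 t).
    exact: trivial_dil.
  by rewrite -hdilM.
move=> /gclassP[t tT ->]; exists (hval (h * hdil zV1 t)).
  by apply/gclassP; exists (hdil zV1 t); first exact: trivial_dil.
have -> : dil z (hval (h * hdil zV1 t)) = hval (hdil z1 (h * hdil zV1 t)) by [].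
by rewrite hdilM; congr (hval (_ * _)); apply: hser_ext => k /=; rewrite dilK.
Qed.

(** * Gaps and the standard basis *)

Lemma lcombE (F : fieldType) n (c : 'I_n -> F) v k :
  lcomb c v k = \sum_(i < n) c i * v i k.
Proof.
by rewrite /lcomb; elim/big_rec2: _ => // i x y _ <-.
Qed.

Section Gaps.
Context {R : realType} {F : fieldType} (abs : F -> R) (absP : nonarch_abs abs).
Variables (A : set (int -> F)) (A_subalg : subalgebra abs A).

Lemma eq0_outside_degrees a : A a -> (forall n : nat, degrees A n -> a n = 0) ->
  forall n : nat, a n = 0.
Proof.
move=> Aa a_deg n; apply/eqP/negP => /negP an.
have [N aN] := subalg_laurent A_subalg Aa.
have bound m : a (Posz m) != 0 -> (m <= absz N)%N.
  by move=> am; rewrite leqNgt; apply/negP => Nm; move: am; rewrite aN ?eqxx //; lia.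
have [m am max_m] := ex_maxnP (ex_intro (fun m : nat => a (Posz m) != 0) n an) bound.
have : degrees A m.
  exists a => //; split=> // -[] k mk; last by [].
  by apply/eqP/negP => /negP /max_m; move: mk; rewrite ltz_nat ltnNge => /negP.
by move/a_deg => am0; move: am; rewrite am0 eqxx.
Qed.

Lemma degrees0 : degrees A 0%N.
Proof.
exists (mono 0); first exact: (subalg1 A_subalg).
split=> [|k k0]; rewrite /mono ?eqxx ?oner_eq0 //.
by case: eqP k0 => // ->.
Qed.

Variables (g : nat) (mu : 'I_g -> nat) (mu_gaps : gap_sequence A mu).

Lemma gap_notin i : ~ degrees A (mu i).
Proof. by have [_ mu_range] := mu_gaps; rewrite -[~ _]/((~` degrees A) (mu i)) -mu_range; exists i. Qed.

Lemma gap_gt0 i : (0 < mu i)%N.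
Proof. by rewrite lt0n; apply/eqP => mu0; have := @gap_notin i; rewrite mu0; apply; exact: degrees0. Qed.

Lemma gap_inj : injective mu.
Proof.
move=> i j ij; have [mu_mono _] := mu_gaps; apply: val_inj => /=.
by case: (ltngtP i j) => // /mu_mono; rewrite ij ltnn.
Qed.

Variables (p d : nat) (p_mod_d : (p = 1 %[mod d])%N) (d_ge_mu : forall j, (mu j <= d)%N).
Variables (z : F) (z_prim : d.-primitive_root z) (A_dil : forall a, A a -> A (dil z a)).

Lemma prim_exp_p k : z ^+ (p ^ k) = z.
Proof.
rewrite -[RHS]expr1; apply/eqP; rewrite (eq_prim_root_expr z_prim).
by rewrite -modnXm p_mod_d modnXm exp1n.
Qed.

Lemma gap_prim_exp i j : z ^+ mu i = z ^+ mu j -> i = j.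
Proof.
move=> /eqP; rewrite (eq_prim_root_expr z_prim) => ij; apply: gap_inj.
have d0 := prim_order_gt0 z_prim.
have := gap_gt0 i; have := gap_gt0 j; have := d_ge_mu i; have := d_ge_mu j.
move: (mu i) (mu j) ij => a b /eqP ab bd ad b0 a0.
have [ad'|ad'] := ltnP a d; have [bd'|bd'] := ltnP b d.
- by move: ab; rewrite !modn_small.
- have bE : b = d by lia.
  by move: ab; rewrite bE modnn modn_small //; lia.
- have aE : a = d by lia.
  by move: ab; rewrite aE modnn modn_small //; lia.
- lia.
Qed.

(* [dil z f - z ^ mu j f] lies in [A] up to negative exponents, and its support in
   nonnegative exponents consists of gaps, so it vanishes there. *)
Lemma e_matrix_diag k (E : 'M[F]_g) i j : is_e_matrix abs p A mu k E -> i != j -> E i j = 0.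
Proof.
move=> [_ /(_ j)] [a [b [[Aa _] [_ b0] fE]]] ij.
set f := (X in X = _) in fE.
have fP n : f n = (n == (mu j * p ^ k)%N :> int)%:R - \sum_(l < g) E l j * (n == mu l :> int)%:R.
  by rewrite /f -[LHS]/(mono _ n - lcomb _ _ n) lcombE.
pose a' := dil z a + cmul (- z ^+ mu j) a.
have Aa' : A a' by apply: (subalgD A_subalg); [exact: A_dil|exact: (subalgZ A_subalg)].
have a'E (n : nat) : a' n = (z ^+ n - z ^+ mu j) * f n.
  rewrite fE -[(a + b) _]/(a n + b n) b0 // addr0.
  by rewrite -[LHS]/(z ^ n%:Z * a n + - z ^+ mu j * a n) -mulrDl.
have N0 : z ^+ (mu j * p ^ k) = z ^+ mu j by rewrite mulnC exprM prim_exp_p.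
have a'0 := eq0_outside_degrees Aa'.
have /(_ (mu i)) : forall n : nat, a' n = 0.
  apply: a'0 => n nA; rewrite a'E fP big1 ?subr0 => [|l _].
    by case: eqP => [[->]|_]; rewrite ?mulr0 // N0 subrr mul0r.
  by case: eqP => [[nE]|_]; rewrite ?mulr0 //; case: (@gap_notin l); rewrite -nE.
rewrite a'E fP (bigD1 i) //= eqxx mulr1 big1 ?addr0 => [|l li]; last first.
  by case: eqP => [[/gap_inj il]|_]; rewrite ?mulr0 //; rewrite il eqxx in li.
move=> /eqP; rewrite mulf_eq0 => /orP[|].
  by rewrite subr_eq0 => /eqP /gap_prim_exp ijE; rewrite ijE eqxx in ij.
rewrite eqz_nat; have [muiE _|_] := eqVneq (mu i) (mu j * p ^ k)%N; last first.
  by rewrite sub0r oppr_eq0 => /eqP.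
by move: N0; rewrite -muiE => /gap_prim_exp ijE; rewrite ijE eqxx in ij.
Qed.

Lemma e_matrix_decomp k (E : 'M[F]_g) i : is_e_matrix abs p A mu k E ->
  exists a b, [/\ A a /\ integral_series abs a,
    integral_series abs b, (forall n : int, 0 <= n -> b n = 0)
    & mono (mu i * p ^ k) = cmul (E i i) (mono (mu i)) + a + b].
Proof.
move=> EP; have [_ /(_ i)] := EP; move=> [a [b [aP [b1 b0] fE]]].
exists a, b; split=> //; rewrite -addrA -fE addrC.
suff -> : lcomb (E^~ i) (fun i => mono (mu i)) = cmul (E i i) (mono (mu i)) by rewrite subrK.
apply/funext => n; rewrite lcombE (bigD1 i) //= big1 ?addr0 // => l li.
by rewrite (e_matrix_diag EP li) mul0r.
Qed.

End Gaps.

(* Reducedness of the standard basis makes the coefficient of [v i] in [a] equal to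
   the coefficient of [a] at the degree [s i]. *)
Lemma gap_coef_le (R : realType) (F : fieldType) (abs : F -> R) (absP : nonarch_abs abs)
    (A : set (int -> F)) a (m : nat) (B : R) :
  strictly_integral abs A -> A a -> ~ degrees A m -> 0 <= B ->
  (forall k : int, m%:Z < k -> abs (a k) <= B) -> abs (a m) <= B.
Proof.
move=> [s [v [vP v_int]]] Aa mA B0 aB; move: Aa.
rewrite (stdb_span vP) => -[n [c aE]].
have s_deg i : degrees A (s i) by rewrite -(stdb_range vP); exists i.
have a_s (i : 'I_n) : a (s i) = c i.
  rewrite aE lcombE (bigD1 i) //= (stdb_monic vP) mulr1 big1 ?addr0 // => k ki.
  have [ik|ki'|/val_inj ik] := ltngtP i k.
  - by rewrite (stdb_reduced vP) // mulr0.
  - have [_ vk] := stdb_deg vP k; rewrite vk ?mulr0 // ltz_nat.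
    exact: (stdb_incr vP).
  - by rewrite ik eqxx in ki.
rewrite aE lcombE; apply: abs_sum_le => // i _; rewrite absM //.
have [sm|ms|sm] := ltngtP (s i) m.
- have [_ vi] := stdb_deg vP i; rewrite vi ?ltz_nat // abs0 // mulr0 //.
- rewrite -[X in _ <= X]mulr1; apply: ler_pM; rewrite ?abs_ge0 //; last exact: v_int.
  by rewrite -a_s aB ?ltz_nat.
- by case: mA; rewrite -sm.
Qed.

Section TorsionBounds.
Context {R : realType} (p : nat) (p_prime : prime p) (n : nat) (n_gt0 : (0 < n)%N).
Variables (w : R) (w_ge0 : 0 <= w).
Local Notation q := (p%:R^-1 : R).
Local Notation M := (p ^ n - p ^ n.-1)%N.
Hypothesis wM : w ^+ M <= q.

Let p_gt1 : (1 < p)%N := prime_gt1 p_prime.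
Let q0 : 0 < q := inv_p_gt0 p_prime.
Let q1 : q < 1 := inv_p_lt1 p_prime.

Let ME : M = (p.-1 * p ^ n.-1)%N.
Proof. by rewrite -{1}(prednK n_gt0) expnS -{1}(prednK (ltnW p_gt1)) mulSn addKn. Qed.

Let M_gt0 : (0 < M)%N.
Proof. by rewrite ME muln_gt0 expn_gt0; lia. Qed.

Lemma exponent_le k : (p ^ n + k * M <= n * M + p ^ k)%N.
Proof.
have step j : (p ^ j.+1 = p ^ j + p.-1 * p ^ j)%N by rewrite expnS; nia.
have [kn|/ltnW nk] := leqP k n.
  have : forall j, (j <= n)%N -> (p ^ n <= j * M + p ^ (n - j))%N.
    elim=> [|j IHj] jn; first by rewrite subn0.
    apply: leq_trans (IHj (ltnW jn)) _; rewrite mulSn [(M + _)%N]addnC -addnA leq_add2l.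
    have -> : (n - j = (n - j.+1).+1)%N by lia.
    rewrite step addnC leq_add2r ME leq_mul2l leq_pexp2l ?orbT //; lia.
  move=> /(_ _ (leq_subr k n)); rewrite subKn // mulnBl => h.
  by have := leq_mul2r M k n; rewrite kn orbT; lia.
rewrite -(subnK nk) [(_ - _ + _)%N]addnC; elim: (k - n)%N => [|j IHj].
  by rewrite addn0 addnC.
rewrite addnS mulSn step addnA [(_ + M)%N]addnC.
have : (M <= p.-1 * p ^ (n + j))%N by rewrite ME leq_mul2l leq_pexp2l ?orbT //; lia.
by move: IHj; lia.
Qed.

Lemma exponent_growth j : (j * M + (n + j) * M <= n * M + p ^ (n + j))%N.
Proof.
have : (2 * j * p.-1 <= p ^ j.+1)%N.
  elim: j => [|j IHj]; first by [].
  have : (2 <= p ^ j.+1)%N by rewrite expnS; have := expn_gt0 p j; nia.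
  by rewrite [(p ^ j.+2)%N]expnS; nia.
have -> : (p ^ (n + j) = p ^ j.+1 * p ^ n.-1)%N by rewrite -expnD; congr (_ ^ _)%N; lia.
by rewrite ME; nia.
Qed.

Lemma term_le_radius k : q ^+ n * w ^+ (p ^ k) <= @exp_radius R p * q ^+ k.
Proof.
have rM : @exp_radius R p ^+ M = q ^+ (p ^ n).
  rewrite ME exprM exp_radiusX // -exprM; congr (_ ^+ _).
  by rewrite -expnS prednK.
have := ltW (@exp_radius_gt0 R p p_prime); move: (@exp_radius R p) rM => r rM r0.
rewrite -(ler_pXn2r M_gt0) ?nnegrE; last 2 first.
- by rewrite mulr_ge0 ?exprn_ge0 // ?(ltW q0).
- by rewrite mulr_ge0 ?exprn_ge0 // ?(ltW q0).
rewrite !exprMn rM -!exprM [(p ^ k * M)%N]mulnC [w ^+ _]exprM.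
apply: (@le_trans _ _ (q ^+ (n * M) * q ^+ (p ^ k))).
  apply: ler_wpM2l; first exact: exprn_ge0 (ltW q0).
  by apply: lerXn2r wM; rewrite nnegrE ?exprn_ge0 // ?(ltW q0).
by rewrite -!exprD; apply: ler_wiXn2l; rewrite ?ltW // exponent_le.
Qed.

Lemma term_le_expr j : q ^+ n * w ^+ (p ^ (n + j)) <= q ^+ j * q ^+ (n + j).
Proof.
rewrite -(ler_pXn2r M_gt0) ?nnegrE; last 2 first.
- by rewrite mulr_ge0 ?exprn_ge0 // ?(ltW q0).
- by rewrite mulr_ge0 ?exprn_ge0 // ?(ltW q0).
rewrite !exprMn -!exprM [(p ^ (n + j) * M)%N]mulnC [w ^+ _]exprM.
apply: (@le_trans _ _ (q ^+ (n * M) * q ^+ (p ^ (n + j)))).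
  apply: ler_wpM2l; first exact: exprn_ge0 (ltW q0).
  by apply: lerXn2r wM; rewrite nnegrE ?exprn_ge0 // ?(ltW q0).
by rewrite -!exprD; apply: ler_wiXn2l; rewrite ?ltW // exponent_growth.
Qed.

End TorsionBounds.

(** * Classes of the series h *)

Section NegativeSupport.
Context {R : realType} {F : fieldType} {V : nafield R F}.
Implicit Types x y : hser V.
Local Notation absP := (naabsP V).

Definition negsupp x : Prop := forall k : int, 0 <= k -> x k = 0.

Lemma negsuppM x y : negsupp x -> negsupp y -> negsupp (x * y).
Proof.
move=> x0 y0 n n0; apply: (has_sumE absP).
have := @has_sum_finite _ _ V absP [::] (fun k => x k * y (n - k)).
rewrite big_nil; apply => // k _.
have [k0|k0] := leP 0 k; first by rewrite x0 ?mul0r.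
by rewrite mulrC y0 ?mul0r //; lia.
Qed.

Lemma texp_negsupp x N : negsupp x -> (0 < N)%N -> negsupp (texp N x - 1).
Proof.
move=> x0; case: N => // N _.
rewrite /texp big_ord_recl fact0 invr1 scale1r expr0 addrC addKr => k k0.
rewrite hval_sum big1 // => n _; rewrite hvalZ.
suff -> : (x ^+ lift ord0 n) k = 0 by rewrite mulr0.
rewrite lift0; elim: (nat_of_ord n) k k0 => [|m IHm]; first by rewrite expr1.
by rewrite exprS; apply: negsuppM.
Qed.

Variables (p : nat) (p_prime : prime p) (absp : V p%:R = p%:R^-1).

Lemma hexp_negsupp x : hle x (@exp_radius R p) -> negsupp x -> Gamma_rho V 0 (hexp x).
Proof.
move=> xr x0; have r01 : 0 <= (0 : R) <= 1 by rewrite lexx ler01.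
have ek (k : int) : 0 <= k -> hexp x k = mono 0 k.
  move=> k0; apply/eqP; rewrite -subr_eq0; apply/eqP; apply: (abs_eps_eq0 absP) => e e0.
  have [N xN] := hexp_cvg p_prime absp xr e0.
  have tk : texp N.+1 x k = mono 0 k.
    by apply/eqP; rewrite -subr_eq0 -(texp_negsupp x0 (ltn0Sn N) k0).
  by rewrite (absB_sym absP) -tk; apply: xN.
apply/(Gamma_rhoP _ r01); split; last by exists (hexp (- x)); exact: (hexpN p_prime absp xr).
split=> [k|]; last by rewrite ek // /mono eqxx (abs1 absP).
case: k => [m|m]; last exact: (hexp_le p_prime absp xr).
rewrite ek // /mono /= expr0n eqz_nat; case: eqP => _.
  by rewrite (abs1 absP).
by rewrite (abs0 absP).
Qed.

End NegativeSupport.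

Section TrivialClasses.
Context {R : realType} {F : fieldType} {V : nafield R F}.
Variables (p : nat) (p_prime : prime p) (absp : V p%:R = p%:R^-1).
Variables (A : set (int -> F)) (A_subalg : subalgebra V A).
Variables (mu : nat) (mu_gt0 : (0 < mu)%N) (e : nat -> F).
Hypothesis e_decomp : forall k, exists a b, [/\ A a /\ integral_series V a,
  integral_series V b, (forall n : int, 0 <= n -> b n = 0)
  & mono (mu * p ^ k) = cmul (e k) (mono mu) + a + b].
Hypothesis e_int : forall k, V (e k) <= 1.
Variables (n : nat) (n_gt0 : (0 < n)%N) (pi : F).
Local Notation absP := (naabsP V).
Local Notation q := (p%:R^-1 : R).
Local Notation r := (@exp_radius R p).
Hypothesis pi_le : V pi ^+ (p ^ n - p ^ n.-1) <= q.
Hypothesis l_pi : sum_nat V (fun k => e k / p%:R ^+ k * pi ^+ (p ^ k)) = 0.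

Let q0 : 0 < q := inv_p_gt0 p_prime.
Let q1 : q < 1 := inv_p_lt1 p_prime.

Variables (y : F) (y_le : V y <= q ^+ n).

Let c k : F := y * (p%:R ^- k * pi ^+ (p ^ k)).

Let term_abs k : V (p%:R ^- k * pi ^+ (p ^ k)) = (q ^+ k)^-1 * V pi ^+ (p ^ k).
Proof. by rewrite (absM absP) (absV absP) !(absX absP) absp. Qed.

Let qX_gt0 k : 0 < q ^+ k.
Proof. exact: exprn_gt0. Qed.

Let c_le_radius k : V (c k) <= r.
Proof.
rewrite (absM absP) term_abs.
apply: (@le_trans _ _ (q ^+ n * ((q ^+ k)^-1 * V pi ^+ (p ^ k)))).
  apply: ler_wpM2r y_le; apply: mulr_ge0; first by rewrite invr_ge0 ltW.
  by apply: exprn_ge0; apply: (abs_ge0 absP).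
rewrite mulrCA mulrC ler_pdivrMr //.
by apply: term_le_radius => //; apply: (abs_ge0 absP).
Qed.

Let term_small j : V (p%:R ^- (n + j) * pi ^+ (p ^ (n + j))) <= q ^+ j / q ^+ n.
Proof.
rewrite term_abs mulrC ler_pdivrMr // mulrAC ler_pdivlMr // mulrC.
by apply: term_le_expr => //; apply: (abs_ge0 absP).
Qed.

Let terms_tend0 eps : 0 < eps -> exists N, forall k, (N <= k)%N ->
  V (p%:R ^- k * pi ^+ (p ^ k)) <= eps.
Proof.
move=> e0; have eq0 : 0 < eps * q ^+ n by rewrite mulr_gt0.
have [|N qN] := small_expr (q := q) _ eq0; first by rewrite q1 ltW.
exists (n + N)%N => k Nk.
have -> : k = (n + (k - n))%N by lia.
apply: le_trans (term_small _) _; rewrite ler_pdivrMr //.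
by apply: qN; lia.
Qed.

Let y_le1 : V y <= 1.
Proof. by apply: le_trans y_le _; rewrite exprn_ile1 // ltW. Qed.

Let c_tend0 eps : 0 < eps -> exists N, forall k, (N <= k)%N -> V (c k) <= eps.
Proof.
move=> /terms_tend0[N tN]; exists N => k /tN; apply: le_trans.
by rewrite (absM absP) ler_piMl // (abs_ge0 absP).
Qed.

Definition hmono m : hser V := HSer (H_mono V m).

Let hle_mono m : hle (hmono m) 1.
Proof. by move=> k /=; rewrite /mono; case: eqP; rewrite ?(abs1 absP) ?(abs0 absP). Qed.

Let series_cvg (u : nat -> hser V) : (forall k, hle (u k) 1) ->
  exists2 s, hcvg (fun N => \sum_(k < N) c k *: u k) s & hle s r.
Proof.
move=> u1; have [eps /c_tend0[N cN]|s us] := @hser_series _ _ V (fun k => c k *: u k).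
  exists N => k /cN ck; apply: hle_trans (hleZ _ (u1 k)) _; by rewrite mulr1.
exists s => //; rewrite -[s]subr0; apply: (hcvg_le (N := 0) us) => m _; rewrite subr0.
apply: hle_sum => [|k _]; first exact/ltW/exp_radius_gt0.
by apply: hle_trans (hleZ _ (u1 k)) _; rewrite mulr1.
Qed.

Let ce_tend0 : cvg_abs V (fun N => \sum_(k < N) c k * e k) 0.
Proof.
have [l ul] : exists l, cvg_abs V (fun N => \sum_(k < N) e k / p%:R ^+ k * pi ^+ (p ^ k)) l.
  apply: (cvg_series (c := fun k => e k / p%:R ^+ k * pi ^+ (p ^ k)) absP (@naabs_complete _ _ V)).
  apply/cvg_absP => eps e0.
  have [N tN] := terms_tend0 e0; exists N => k /tN; rewrite subr0 -mulrA; apply: le_trans.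
  by rewrite (absM absP); apply: ler_piMl; [exact: abs_ge0 absP _|exact: e_int].
have l0 : l = 0 by rewrite -l_pi /sum_nat (lim_absE absP ul).
have := cvg_absMl absP y ul; rewrite l0 mulr0; congr (cvg_abs _ _ _).
apply/funext => N; rewrite mulr_sumr; apply: eq_bigr => k _; rewrite /c; ring.
Qed.

Let trivial_factor (t u u' v v' : hser V) : t = u * v -> Gamma V t ->
  clA A u -> clA A u' -> u * u' = 1 -> Gamma_rho V 0 v -> v * v' = 1 -> trivial A t.
Proof.
move=> tE Gt uA uA' uu' Gv vv'; exists u, v; split=> //; last by exists u'.
have -> : u = t * v' by rewrite tE -mulrA vv' mulr1.
by apply: GammaM Gt _; apply: Gamma_inv vv'; apply: Gamma0_Gamma.
Qed.

(* The argument of the exponential is a + b, where b is the sum of the parts of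
   negative degree: the multiples of T^mu add up to y l_i(pi) T^mu = 0. *)
Lemma trivial_hexp : exists x : hser V,
  [/\ hval x = subst_pow mu (fun m => y * (l_coef p m * pi ^+ m)), hle x r
    & Gamma V (hexp x) -> trivial A (hexp x)].
Proof.
have [ab abP] : exists ab : nat -> hser V * hser V, forall k,
    [/\ A (ab k).1, hle (ab k).2 1, negsupp (ab k).2
      & hmono (mu * p ^ k) = e k *: hmono mu + (ab k).1 + (ab k).2].
  suff h k : exists ab : hser V * hser V, [/\ A ab.1, hle ab.2 1, negsupp ab.2
      & hmono (mu * p ^ k) = e k *: hmono mu + ab.1 + ab.2].
    by have [ab abP] := choice h; exists ab.
  have [a [b [[Aa a1] b1 b0 abE]]] := e_decomp k.
  have Hb : H V b.
    apply: HP => [|eps e0]; first by exists 1; exact: b1.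
    by exists 0%N => i i0; rewrite b0 // (abs0 absP) ltW.
  have Ha : H V a.
    have -> : a = mono (mu * p ^ k) + (- cmul (e k) (mono mu)) + - b.
      by rewrite abE; apply/funext => i; rewrite !fctE /=; ring.
    by apply/H_add/H_opp/Hb/H_add/H_opp/H_cmul/H_mono/H_mono.
  exists (HSer Ha, HSer Hb); split=> //.
  by apply: hser_ext => i; rewrite /= abE.
have [x xcvg xr] := series_cvg (fun k => hle_mono (mu * p ^ k)).
have b1 k : hle (ab k).2 1 by have [] := abP k.
have [b bcvg br] := series_cvg b1.
have b0 : negsupp b.
  move=> i i0; apply: (abs_eps_eq0 absP) => eps /bcvg[N bN].
  have := bN N (leqnn N) i; rewrite hvalD hvalN hval_sum big1 ?sub0r ?(absN absP) // => k _.
  by rewrite hvalZ; have [_ _ -> //] := abP k; rewrite mulr0.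
exists x; split=> //.
  apply/funext => i; apply/eqP; rewrite -subr_eq0; apply/eqP.
  apply: (abs_eps_eq0 absP) => eps /xcvg[N xN].
  have xE M : (\sum_(k < M) c k *: hmono (mu * p ^ k)) i
      = \sum_(k < M) c k * (i == (mu * p ^ k)%N :> int)%:R.
    by rewrite hval_sum; apply: eq_bigr => k _; rewrite hvalZ.
  suff [M ->] : exists M, subst_pow mu (fun m => y * (l_coef p m * pi ^+ m)) i
      = (\sum_(k < maxn N M) c k *: hmono (mu * p ^ k)) i.
    by rewrite (absB_sym absP); apply: (xN (maxn N M)); rewrite leq_maxl.
  have zero : (forall k, i <> (mu * p ^ k)%N :> int) ->
      forall M, (\sum_(k < M) c k *: hmono (mu * p ^ k)) i = 0.
    by move=> ik M; rewrite xE big1 // => k _; case: eqP => [/ik|_]; rewrite ?mulr0.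
  have [[m im]|im] := pselect (exists m, i = Posz (mu * m)); last first.
    exists 0%N; rewrite subst_pow_out // => [|m mi]; last by apply: im; exists m.
    by rewrite zero // => k ik; apply: im; exists (p ^ k)%N.
  rewrite im subst_pow_mul //.
  have [[k mk]|mk] := pselect (exists k, m = (p ^ k)%N); last first.
    exists 0%N; rewrite -im zero; last first.
      by rewrite im => k [] /eqP; rewrite eqn_pmul2l // => /eqP mE; apply: mk; exists k.
    have [->|/(l_coef_neq0)] := eqVneq (l_coef p m : F) 0; first by rewrite mul0r mulr0.
    by case=> k mE; case: mk; exists k.
  exists k.+1; rewrite -im xE im mk.
  have kM : (k < maxn N k.+1)%N by rewrite leq_max leqnn orbT.
  rewrite (bigD1 (Ordinal kM)) //= eqxx mulr1 big1 ?addr0 => [|l lk].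
    by rewrite l_coef_pow.
  rewrite eqz_nat eqn_pmul2l // eqn_exp2l ?prime_gt1 //.
  by rewrite eq_sym; move: lk; rewrite -val_eqE /= => /negPf ->; rewrite mulr0.
move=> Gx; have ar : hle (x - b) r := hleB xr br.
have aA : clA A (x - b).
  apply: clA_lim => eps e0.
  have [N1 xN] := xcvg _ e0; have [N2 bN] := bcvg _ e0.
  have /cvg_absP /(_ _ e0)[N3 ceN] := ce_tend0.
  pose N := maxn (maxn N1 N2) N3.
  exists (\sum_(k < N) c k *: (ab k).1).
    apply: (@clA_sum _ _ _ _ A_subalg N (fun k => c k *: (ab k).1)) => k.
    by apply: clAZ => //; apply: clA_sub; have [] := abP k.
  have -> : \sum_(k < N) c k *: (ab k).1 = \sum_(k < N) c k *: hmono (mu * p ^ k)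
      - (\sum_(k < N) c k * e k) *: hmono mu - \sum_(k < N) c k *: (ab k).2.
    rewrite scaler_suml -!sumrB; apply: eq_bigr => k _; have [_ _ _ ->] := abP k.
    by rewrite -scalerA !scalerDr addrAC addrK addrC addKr.
  have -> (X B C : hser V) : x - b - (X - C - B) = (x - X) + C - (b - B) by ring.
  apply: hleB; last first.
    by apply/hleB_sym/bN; rewrite /N; lia.
  apply: hleD; first by apply/hleB_sym/xN; rewrite /N; lia.
  apply: hle_trans (hleZ _ (hle_mono mu)) _; rewrite mulr1.
  by have := ceN N; rewrite subr0; apply; rewrite /N; lia.
have ex : hexp x = hexp (x - b) * hexp b by rewrite -(hexpD p_prime absp ar br) subrK.
have Gb := hexp_negsupp p_prime absp br b0.
have bN := hexpN p_prime absp br.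
have aN := hexpN p_prime absp ar.
have exA := clA_exp A_subalg p_prime absp ar aA.
have aNA : clA A (- (x - b)) by rewrite -scaleN1r; apply: clAZ A_subalg _ _ aA.
have exNA := clA_exp A_subalg p_prime absp (hleN ar) aNA.
exact: (trivial_factor ex Gx exA exNA aN Gb bN).
Qed.

End TrivialClasses.

Section HSeries.
Context {R : realType} {F : fieldType} {V : nafield R F}.
Variables (p : nat) (p_prime : prime p) (absp : V p%:R = p%:R^-1).
Hypothesis artin_hasse : forall m, V (fps_exp (@l_coef F p) m) <= 1.
Variables (mu : nat) (mu_gt0 : (0 < mu)%N).
Local Notation absP := (naabsP V).
Let fact_unit n : n`!%:R != 0 :> F := fact_neq0 p_prime absP absp n.

Definition h_exp (y pi : F) : nat -> F := fps_exp (fun m => y * (l_coef p m * pi ^+ m)).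

Let l0 (y pi : F) : y * (l_coef p 0%N * pi ^+ 0) = 0.
Proof. by rewrite l_coef0 // mul0r mulr0. Qed.

Lemma h_exp1 pi : h_exp 1 pi = h_coef p pi.
Proof. by apply/funext => m; apply: fps_exp_eq => j _; rewrite mul1r. Qed.

Lemma h_expD y y' pi m :
  h_exp (y + y') pi m = \sum_(j < m.+1) h_exp y pi j * h_exp y' pi (m - j).
Proof.
rewrite -fps_expD //; apply: fps_exp_eq => j _; exact: mulrDl.
Qed.

Lemma h_exp_scale y z pi m : h_exp y pi m * z ^+ m = h_exp y (z * pi) m.
Proof.
rewrite -fps_exp_scale; apply: fps_exp_eq => j _; rewrite exprMn; ring.
Qed.

Lemma h_exp_prim y z pi : (forall k, z ^+ (p ^ k) = z) -> h_exp y (z * pi) = h_exp (y * z) pi.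
Proof.
move=> zp; apply/funext => m; apply: fps_exp_eq => j _.
have [->|/l_coef_neq0[k ->]] := eqVneq (l_coef p j : F) 0; first by rewrite !mul0r !mulr0.
by rewrite exprMn zp; ring.
Qed.

Lemma h_exp1_le pi m : V (h_exp 1 pi m) <= V pi ^+ m.
Proof.
have -> : h_exp 1 pi m = fps_exp (@l_coef F p) m * pi ^+ m.
  by rewrite -fps_exp_scale; apply: fps_exp_eq => j _; rewrite mul1r.
by rewrite (absM absP) (absX absP); apply: ler_piMl; rewrite ?exprn_ge0 ?(abs_ge0 absP).
Qed.

Lemma h_expN1_le pi m : V (h_exp (-1) pi m) <= V pi ^+ m.
Proof.
have -> : h_exp (-1) pi m = fps_exp (fun j => - (@l_coef F p j)) m * pi ^+ m.
  by rewrite -fps_exp_scale; apply: fps_exp_eq => j _; rewrite mulN1r mulNr.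
rewrite (absM absP) (absX absP); apply: ler_piMl; rewrite ?exprn_ge0 ?(abs_ge0 absP) //.
by apply: (fps_expN_integral absP) => //; apply: l_coef0.
Qed.

Lemma H_subst_pow (f : nat -> F) w : 0 <= w < 1 -> (forall m, V (f m) <= w ^+ m) ->
  H V (subst_pow mu f).
Proof.
move=> w01 fw; have /andP[w0 w1] := w01; apply: HP.
  exists 1 => k; apply: (subst_powP mu_gt0 (P := fun k v => V v <= 1)) => [m|i _].
    by apply: le_trans (fw m) _; rewrite exprn_ile1 // ltW.
  by rewrite (abs0 absP).
move=> eps e0; have [N wN] := small_expr w01 e0; exists (mu * N)%N => k.
move: k; apply: (subst_powP mu_gt0 (P := fun k v => _ <= k -> V v <= eps)) => [m|i _ _].
  by rewrite lez_nat leq_pmul2l // => /wN; apply: le_trans (fw m).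
by rewrite (abs0 absP) ltW.
Qed.

Lemma Gamma_subst_pow (x x' : hser V) (f : nat -> F) w : 0 <= w < 1 ->
  (forall m, V (f m) <= w ^+ m) -> f 0%N = 1 -> hval x = subst_pow mu f ->
  x * x' = 1 -> Gamma V x.
Proof.
move=> /andP[w0 w1] fw f0 xf xx'.
pose w' := Num.max w 2^-1; have w'0 : 0 < w' by rewrite lt_max invr_gt0 ltr0n orbT.
have w'1 : w' < 1 by rewrite gt_max w1 invf_lt1 ?ltr0n ?ltr1n.
pose rho := w' `^ mu%:R^-1; have rho0 : 0 < rho by apply: powR_gt0.
have rhoE : rho ^+ mu = w'.
  rewrite -powR_mulrn ?ltW // -powRrM mulVf ?powRr1 ?ltW //.
  by rewrite pnatr_eq0 -lt0n.
apply/GammaP; exists rho.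
  rewrite rho0 ltNge; apply/negP => rho1; move: w'1; rewrite -rhoE.
  by rewrite ltNge exprn_ege1.
split; last by exists x'.
split=> [k|]; last by rewrite xf -[0]/(Posz 0) -(muln0 mu) subst_pow_mul // f0 (abs1 absP).
rewrite xf; move: k; apply: (subst_powP mu_gt0 (P := fun k v => V v <= wt rho k)) => [m|k _].
  rewrite /= exprM rhoE; apply: le_trans (fw m) _; apply: lerXn2r.
  - by rewrite nnegrE.
  - by rewrite nnegrE ltW.
  - by rewrite le_max lexx.
by rewrite (abs0 absP) wt_ge0 // ltW.
Qed.

Lemma subst_pow_h_exp0 pi : subst_pow mu (h_exp 0 pi) = mono 0.
Proof.
apply/funext; apply: (subst_powP mu_gt0 (P := fun k v => v = mono 0 k)) => [m|k km].
  rewrite /h_exp (@fps_exp_eq _ _ (fun=> 0)) => [|j _]; last by rewrite mul0r.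
  by rewrite fps_exp_cst0 /mono eqz_nat muln_eq0 (gtn_eqF mu_gt0).
by rewrite /mono; case: eqP => // k0; case: (km 0%N); rewrite muln0.
Qed.

Lemma h_unit pi : V pi < 1 -> exists h h' : hser V,
  [/\ hval h = h_series p mu pi, hval h' = subst_pow mu (h_exp (-1) pi), h * h' = 1
    & Gamma V h].
Proof.
move=> pi1; have w01 : 0 <= V pi < 1 by rewrite pi1 (abs_ge0 absP).
have Hh := H_subst_pow w01 (h_exp1_le pi); have Hh' := H_subst_pow w01 (h_expN1_le pi).
have hh' : HSer Hh * HSer Hh' = 1.
  apply: hser_ext => k.
  rewrite (hmul_subst_pow mu_gt0 (f := h_exp 1 pi) (g := h_exp (-1) pi)) // hval1.
  rewrite -(subst_pow_h_exp0 pi); congr (subst_pow mu _ k); apply/funext => m.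
  by rewrite -h_expD subrr.
exists (HSer Hh), (HSer Hh'); split=> //; first by rewrite /= h_exp1.
apply: (Gamma_subst_pow w01 (h_exp1_le pi)) hh' => //.
by rewrite /h_exp fps_exp_0.
Qed.

Lemma h_exprn (h : hser V) pi m : hval h = h_series p mu pi ->
  hval (h ^+ m) = subst_pow mu (h_exp m%:R pi).
Proof.
rewrite /h_series -h_exp1 => hE; elim: m => [|m IHm].
  by rewrite expr0 hval1 subst_pow_h_exp0.
rewrite exprS (hmul_subst_pow mu_gt0 hE IHm); congr subst_pow; apply/funext => j.
by rewrite -h_expD nat1r.
Qed.

Lemma hdil_h (z : F) (z1 : V z = 1) (zp : forall k, z ^+ (p ^ k) = z) (h : hser V) pi :
  hval h = h_series p mu pi -> hval (hdil z1 h) = subst_pow mu (h_exp (z ^+ mu) pi).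
Proof.
rewrite /h_series -h_exp1 => hE; apply/funext => k /=; rewrite /dil hE.
have zmup j : (z ^+ mu) ^+ (p ^ j) = z ^+ mu by rewrite -exprM mulnC exprM zp.
have [[m ->]|km] := pselect (exists m, k = Posz (mu * m)); last first.
  by rewrite !subst_pow_out ?mulr0 // => m kE; apply: km; exists m.
rewrite !subst_pow_mul // -[z ^ _]/(z ^+ (mu * m)) mulrC exprM h_exp_scale.
by rewrite h_exp_prim // mul1r.
Qed.

Lemma h_exp_deg1 pi : h_exp 1 pi 1%N = pi.
Proof.
rewrite /h_exp fps_expE coef_texp !big_ord_recl big_ord0 addr0 expr0 coef1 mulr0 add0r.
rewrite expr1 coef_poly /= invr1 !mul1r expr1.
by have := @l_coef_pow F p p_prime 0; rewrite expn0 => ->; rewrite expr0 invr1 mul1r.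
Qed.

Variables (A : set (int -> F)) (A_subalg : subalgebra V A).

Lemma h_torsion_eigen (e : nat -> F) (n : nat) (pi z : F) (m : nat) :
  (forall k, exists a b, [/\ A a /\ integral_series V a,
     integral_series V b, (forall i : int, 0 <= i -> b i = 0)
     & mono (mu * p ^ k) = cmul (e k) (mono mu) + a + b]) ->
  (forall k, V (e k) <= 1) -> (0 < n)%N -> V pi < 1 ->
  V pi ^+ (p ^ n - p ^ n.-1) <= p%:R^-1 ->
  sum_nat V (fun k => e k / p%:R ^+ k * pi ^+ (p ^ k)) = 0 ->
  V z = 1 -> (forall k, z ^+ (p ^ k) = z) -> dil z @` A = A ->
  V (z ^+ mu - m%:R) <= p%:R ^- n ->
  Gamma_A_torsion V A (p ^ n) (gclass V A (h_series p mu pi)) /\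
  dil z @` gclass V A (h_series p mu pi) = gpow V A (gclass V A (h_series p mu pi)) m.
Proof.
move=> e_decomp e_int n0 pi1 pi_le l_pi z1 zp A_dil zm.
have [h [h' [hE h'E hh' Gh]]] := h_unit pi1.
have GhX j : Gamma V (h ^+ j).
  by elim: j => [|j IHj]; [exact: Gamma1|rewrite exprS; exact: GammaM].
have factor y : V y <= p%:R^-1 ^+ n -> exists2 x : hser V,
    hval x = subst_pow mu (h_exp y pi) & Gamma V x -> trivial A x.
  move=> y_le; have [x [xE xr xT]] := trivial_hexp p_prime absp A_subalg mu_gt0
    e_decomp e_int n0 pi_le l_pi y_le.
  exists (hexp x) => //.
  exact: (hexp_subst_pow mu_gt0 p_prime absp (l0 y pi) xE xr).
rewrite -hE; split.
  split; first by exists h.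
  rewrite gclassX //; have [|x xE xT] := factor (p ^ n)%:R.
    by rewrite natrX (absX absP) absp.
  have <- : x = h ^+ (p ^ n) by apply: hser_ext => k; rewrite xE (h_exprn _ hE).
  rewrite -gclass1 // -[x]mul1r; apply: gclass_mul => //; apply: xT.
  have -> : x = h ^+ (p ^ n) by apply: hser_ext => k; rewrite xE (h_exprn _ hE).
  exact: GhX.
rewrite (dil_gclass z1) // gclassX //.
have [|x xE xT] := factor (z ^+ mu - m%:R); first by rewrite exprVn.
have zhE : hdil z1 h = h ^+ m * x.
  apply: hser_ext => k; rewrite (hdil_h z1 zp hE).
  rewrite (hmul_subst_pow mu_gt0 (h_exprn m hE) xE).
  by congr (subst_pow mu _ k); apply/funext => j; rewrite -h_expD subrKC.
rewrite zhE; apply: gclass_mul => //; apply: xT.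
have hhm : h ^+ m * h' ^+ m = 1 by rewrite -exprMn hh' expr1n.
have -> : x = hdil z1 h * h' ^+ m by rewrite zhE mulrAC hhm mul1r.
by apply: GammaM (Gamma_dil z1 Gh) _; apply: Gamma_inv hhm.
Qed.

Let prod_le (f g : nat -> F) c w m : 0 <= c -> 0 <= w -> f 0%N = 0 ->
  (forall j, V (f j.+1) <= c * w ^+ j) -> (forall j, V (g j) <= w ^+ j) ->
  V (\sum_(j < m.+2) f j * g (m.+1 - j)%N) <= c * w ^+ m.
Proof.
move=> c0 w0 f0 fw gw; apply: (abs_sum_le absP) => [|j _].
  by rewrite mulr_ge0 ?exprn_ge0.
case: j => -[|j] jm /=; first by rewrite f0 mul0r (abs0 absP) mulr_ge0 ?exprn_ge0.
rewrite (absM absP).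
have -> : w ^+ m = w ^+ j * w ^+ (m.+1 - j.+1) by rewrite -exprD; congr (_ ^+ _); lia.
by rewrite mulrA; apply: ler_pM; rewrite ?(abs_ge0 absP).
Qed.

(* If [h = h' u v] with [u] in the closure of [A], then [u = (h / h') / v] has
   coefficient of absolute value [|pi - pi'|] at [mu], and strictly smaller ones
   above, which is impossible since [mu] is a gap. *)
Lemma h_class_inj pi pi' : strictly_integral V A -> ~ degrees A mu ->
  V pi < 1 -> V pi' < 1 ->
  gclass V A (h_series p mu pi) = gclass V A (h_series p mu pi') -> pi = pi'.
Proof.
move=> A_int mu_gap pi1 pi'1.
have [h [_ [hE _ _ _]]] := h_unit pi1.
have [h' [h'i [h'E h'iE h'h'i _]]] := h_unit pi'1.
rewrite -hE -h'E => /(gclass_inj A_subalg)[_ [u [v [-> _ uA _ Gv]]] huv].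
have r01 : 0 <= (0 : R) <= 1 by rewrite lexx ler01.
have [_ [v' vv']] := (Gamma_rhoP v r01).1 Gv.
have [[v'0 v'1] _] := (Gamma_rhoP v' r01).1 (Gamma0_inv Gv vv').
apply/eqP; rewrite -subr_eq0; apply/negP => /negP pi_neq.
pose c := V (pi - pi'); have c0 : 0 < c by rewrite (abs_gt0 absP).
pose w := Num.max (Num.max (V pi) (V pi')) 2^-1.
have w0 : 0 < w by rewrite lt_max invr_gt0 ltr0n orbT.
have w1 : w < 1 by rewrite !gt_max pi1 pi'1 invf_lt1 ?ltr0n ?ltr1n.
have piw : V pi <= w by rewrite /w !le_max lexx.
have pi'w : V pi' <= w by rewrite /w !le_max lexx orbT.
pose f m := h_exp 1 pi m - h_exp 1 pi' m.
have f0 : f 0%N = 0 by rewrite /f /h_exp !fps_exp_0 subrr.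
have fw j : V (f j.+1) <= c * w ^+ j.
  have -> : f j.+1 = fps_exp (@l_coef F p) j.+1 * (pi ^+ j.+1 - pi' ^+ j.+1).
    rewrite /f mulrBr -!fps_exp_scale; congr (_ - _);
    by apply: fps_exp_eq => i _; rewrite mul1r.
  rewrite (absM absP) subrXX (absM absP) mulrCA; apply: ler_wpM2l; first exact: ltW.
  rewrite -[X in _ <= X]mul1r; apply: ler_pM; rewrite ?(abs_ge0 absP) //.
  apply: (abs_sum_le absP) => [|i _]; first by rewrite exprn_ge0 // ltW.
  rewrite (absM absP) !(absX absP).
  have -> : w ^+ j = w ^+ (j.+1.-1 - i) * w ^+ i.
    by rewrite -exprD subnK // -ltnS ltn_ord.
  by apply: ler_pM; rewrite ?exprn_ge0 ?(abs_ge0 absP) //;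
    apply: lerXn2r; rewrite ?nnegrE ?(abs_ge0 absP) // ltW.
have gw j : V (h_exp (-1) pi' j) <= w ^+ j.
  apply: le_trans (h_expN1_le pi' j) _.
  by apply: lerXn2r; rewrite ?nnegrE ?(abs_ge0 absP) // ltW.
pose D := (h - h') * h'i.
pose Dc m := \sum_(j < m.+1) f j * h_exp (-1) pi' (m - j)%N.
have DE : hval D = subst_pow mu Dc.
  apply: (hmul_subst_pow mu_gt0 _ h'iE); apply/funext => k.
  rewrite hvalD hvalN hE h'E /h_series -!h_exp1 /subst_pow.
  by case: k => k; [case: ifP|]; rewrite ?subrr.
have Dc0 : Dc 0%N = 0 by rewrite /Dc big_ord1 f0 mul0r.
have Dc1 : Dc 1%N = pi - pi'.
  rewrite /Dc big_ord_recl big_ord1 f0 mul0r add0r /= /f !h_exp_deg1.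
  by rewrite [X in _ * X]fps_exp_0 mulr1.
have DcS m : V (Dc m.+1) <= c * w ^+ m by apply: prod_le; rewrite ?ltW.
have D_le (l k : int) : mu%:Z <= k -> (l = mu%:Z -> mu%:Z < k) ->
    V (D l) * V (v' (k - l)) <= c * w.
  move=> muk lmu; have cw0 : 0 <= c * w by rewrite mulr_ge0 // ltW.
  have [[m lm]|lm] := pselect (exists m, l = Posz (mu * m)); last first.
    by rewrite DE subst_pow_out ?(abs0 absP) ?mul0r // => m lE; apply: lm; exists m.
  rewrite lm DE subst_pow_mul //; case: m lm => [|[|m]] lm.
  - by rewrite Dc0 (abs0 absP) mul0r.
  - have kl : 0 < k - Posz (mu * 1) by move: lmu; rewrite lm muln1 => /(_ erefl); lia.
    apply: le_trans (_ : 0 <= _) => //; rewrite pmulr_rle0.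
      by apply: le_trans (v'0 _) _; apply: wt_le.
    by rewrite Dc1.
  - rewrite -[X in _ <= X]mulr1; apply: ler_pM; rewrite ?(abs_ge0 absP) //.
      apply: le_trans (DcS _) _; apply: ler_wpM2l; first exact: ltW.
      by rewrite exprS ler_piMr ?exprn_ile1 // ltW.
    by apply: le_trans (v'0 _) (wt_le1 _ r01).
have cw0 : 0 <= c * w by rewrite mulr_ge0 // ltW.
have uE k : 0 < k -> u k = (D * v') k.
  move=> k0; have -> : u = v' + D * v'.
    rewrite /D mulrBl h'h'i mulrBl mul1r addrCA subrr addr0 huv.
    have -> : h' * (u * v) * h'i * v' = u * (h' * h'i) * (v * v') by ring.
    by rewrite h'h'i vv' !mulr1.
  rewrite hvalD; have -> : v' k = 0; last by rewrite add0r.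
  apply/(nonarch_abs_eq0 absP)/eqP; rewrite eq_le (abs_ge0 absP) andbT.
  by apply: le_trans (v'0 k) _; apply: wt_le.
have u_above (k : int) : mu%:Z < k -> V (u k) <= c * w.
  move=> muk; rewrite uE; last by lia.
  apply: (has_sum_le absP _ (hmulP k (hvalP D) (hvalP v'))) => l.
  by rewrite (absM absP); apply: D_le => //; apply: ltW.
have u_mu : V (u mu - (pi - pi') * v' 0) <= c * w.
  rewrite uE ?ltz_nat //; have := @conv_except_le _ _ _ D v' mu mu (c * w) cw0.
  have Dmu : D mu = pi - pi' by have := subst_pow_mul mu_gt0 Dc 1; rewrite muln1 -DE Dc1.
  rewrite subrr Dmu; apply=> l lmu.
  by apply: D_le => // lE; rewrite lE eqxx in lmu.
have cwc : c * w < c by rewrite -[X in _ < X]mulr1 ltr_pM2l.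
have [a Aa ua] : exists2 a : hser V, A a & hle (u - a) (c * w).
  by apply: uA; apply: mulr_gt0.
have a_above (k : int) : mu%:Z < k -> V (a k) <= c * w.
  move=> /u_above uk; rewrite -[a k](subKr (u k)).
  by apply: (absB_le absP uk); apply: ua.
have a_mu := gap_coef_le absP A_int Aa mu_gap cw0 a_above.
move: cwc; rewrite ltNge => /negP; apply.
apply: le_trans (_ : V ((pi - pi') * v' 0) <= _); first by rewrite (absM absP) v'1 mulr1.
rewrite -[X in V X](subKr (u mu)); apply: (absB_le absP); last exact: u_mu.
by rewrite -[u mu](subrK (a mu)); apply: (absD_le absP); [exact: ua|exact: a_mu].
Qed.

End HSeries.

Theorem proposition3p13 (R : realType) (p : nat) (p_prime : prime p)
    (Qp : fieldType) (absQ : Qp -> R) (absQ_padic : is_padic_field absQ p)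
    (K : fieldExtType Qp) (abs : K -> R) (abs_nonarch : nonarch_abs abs)
    (abs_ext : forall x : Qp, abs x%:A = absQ x)
    (A : set (int -> K)) (A_subalg : subalgebra abs A)
    (A_const : A `&` invT_series = range (fun c : K => cmul c (mono 0)))
    (g : nat) (A_codim : codim_is A g)
    (mu : 'I_g -> nat) (mu_gaps : gap_sequence A mu)
    (A_integral : strictly_integral abs A)
    (d : nat) (p_mod_d : (p = 1 %[mod d])%N) (d_ge_mu : forall j, (mu j <= d)%N)
    (zeta : Qp) (zeta_int : absQ zeta <= 1) (zeta_prim : d.-primitive_root zeta)
    (A_dil : dil zeta%:A @` A = A)
    (e : nat -> 'M[K]_g) (e_def : forall k, is_e_matrix abs p A mu k (e k))
    (n : nat) (n_gt0 : (0 < n)%N) (i : 'I_g) :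
  (forall pi : K, T_set abs p e n i pi ->
     Gamma_A_eigen absQ abs p A zeta n (mu i)
       (gclass abs A (h_series p (mu i) pi))) /\
  set_inj (T_set abs p e n i)
    (fun pi : K => gclass abs A (h_series p (mu i) pi)).
Proof.
have absQP := padic_abs absQ_padic.
have complete := complete_fieldExt absQP abs_nonarch abs_ext (padic_complete absQ_padic).
pose V := NAField abs_nonarch complete.
have absp : V p%:R = p%:R^-1.
  by rewrite -(padic_absp absQ_padic) -abs_ext -in_algE rmorph_nat.
have ah m : V (fps_exp (@l_coef K p) m) <= 1.
  exact: (artin_hasse_fieldExt_integral p_prime absQ_padic abs_nonarch abs_ext).
have mu_gt0 := gap_gt0 A_subalg mu_gaps i.
have mu_gap : ~ degrees A (mu i) := gap_notin mu_gaps (i := i).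
split; last first.
  move=> pi pi' /set_mem[pi1 _ _] /set_mem[pi'1 _ _].
  exact: (h_class_inj p_prime absp ah mu_gt0 (V := V) A_subalg A_integral mu_gap pi1 pi'1).
move=> pi [pi1 l_pi pi_le].
pose z : K := zeta%:A.
have z_prim : d.-primitive_root z by rewrite -[z]/(in_alg K zeta) fmorph_primitive_root.
have zeta1 : absQ zeta = 1.
  apply/eqP; rewrite -(@pexpr_eq1 _ _ d) ?(abs_ge0 absQP) ?(prim_order_gt0 z_prim) //.
  by rewrite -(absX absQP) (prim_expr_order zeta_prim) (abs1 absQP).
have z1 : V z = 1 by rewrite -zeta1 -abs_ext.
have dA a : A a -> A (dil z a) by move=> Aa; rewrite -A_dil; exists a.
have e_decomp k := e_matrix_decomp A_subalg mu_gaps p_mod_d d_ge_mu z_prim dA i (e_def k).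
have e_int k : V (e k i i) <= 1 by have [] := e_def k.
have pi_le' : V pi ^+ (p ^ n - p ^ n.-1) <= p%:R^-1.
  have M0 : (0 < p ^ n - p ^ n.-1)%N.
    by rewrite subn_gt0 ltn_exp2l ?prime_gt1 // prednK.
  have p0 : 0 <= abs p%:R by apply: abs_ge0.
  rewrite -absp; apply: le_trans (_ : (abs p%:R `^ (p ^ n - p ^ n.-1)%N%:R^-1) ^+ _ <= _).
    by apply: lerXn2r pi_le; rewrite nnegrE ?powR_ge0 // abs_ge0.
  by rewrite -powR_mulrn ?powR_ge0 // -powRrM mulVf ?powRr1 // pnatr_eq0 -lt0n.
apply: (h_torsion_eigen p_prime absp ah mu_gt0 (V := V) A_subalg e_decomp e_int n_gt0 pi1 pi_le'
  l_pi z1 _ A_dil).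
  by move=> k; apply: (prim_exp_p p_mod_d z_prim).
have zmu1 : absQ (zeta ^+ mu i) <= 1 by rewrite (absX absQP) zeta1 expr1n.
have := residueP p_prime absQ_padic n zmu1.
rewrite -abs_ext; congr (_ <= _); congr abs.
by rewrite -in_algE rmorphB rmorphXn rmorph_nat.
Qed.
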